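(* There exist absolute constants $c, C > 0$ such that the following holds. Let $m \ge 1$, let $\mathcal{L} \subset \mathbb{R}^m$ be a nondegenerate lattice, let $\|\cdot\|_*$ be a norm on $\mathbb{R}^m$, and let $X$ be a random variable taking values in $\mathcal{L}$ with $\mathcal{L} = \operatorname{span}_{\mathbb{Z}} \operatorname{supp} X$. Let $\Sigma := \mathbb{E}[XX^\dagger]$ have least eigenvalue $\sigma$, and suppose $L > 0$ is such that $\operatorname{supp} X \subset \Sigma^{1/2} B(L)$. Put $$N := c \max\left\{ \frac{R_*^2\, \rho_*(\mathcal{L})^2}{\sigma},\; m^2L^2(\log m + \log L)^2,\; s(\Sigma^{-1/2}X)^{-4} L^{-2},\; L^2 \log^2\!\left(\frac{\det \mathcal{L}}{\sqrt{\det \Sigma}}\right) \right\}.$$ If $n \ge N$ and $M$ is an $m \times n$ random matrix whose columns are independent copies of $X$, then $$\operatorname{disc}_*(M) \le d_*(M\mathbf{1}, 2\mathcal{L}) \le 2\rho_*(\mathcal{L})$$ with probability at least $1 - C L \sqrt{\frac{\log n}{n}}$.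
   Context: A lattice is a discrete subgroup of $\mathbb{R}^m$; it is nondegenerate if its real span is $\mathbb{R}^m$. $\det\mathcal{L}$ is the (absolute value of the) determinant of any matrix whose columns form a basis of $\mathcal{L}$. The dual lattice is $\mathcal{L}^* = \{z \in \mathbb{R}^m : \langle z, \lambda\rangle \in \mathbb{Z} \text{ for all } \lambda \in \mathcal{L}\}$. $B(L)$ is the set of points of $\mathbb{R}^m$ of Euclidean length at most $L$. $\mathbf{1}$ is the all-ones vector. For a norm $\|\cdot\|_*$ on $\mathbb{R}^m$: $\operatorname{disc}_*(M) = \min_{y \in \{\pm1\}^n} \|My\|_*$ for an $m\times n$ matrix $M$; $d_*(x,S) = \inf_{y\in S}\|x-y\|_*$; the covering radius is $\rho_*(S) = \sup_{x \in \operatorname{span}_{\mathbb{R}} S} d_*(x,S)$; the distortion $R_*$ is the maximum Euclidean length of a vector $x$ with $\|x\|_* = 1$. Spanningness. Let $Z$ be a random variable with $\mathbb{E}[ZZ^\dagger] = I_m$ whose support generates (over $\mathbb{Z}$) a lattice $\mathcal{L}'$ (for $Z = \Sigma^{-1/2}X$, $\mathcal{L}' = \Sigma^{-1/2}\mathcal{L}$). Define $\tilde Z(\theta) := \sqrt{\mathbb{E}[|\langle \theta, Z\rangle \bmod 1|^2]}$, where $y \bmod 1$ denotes the representative of $y$ modulo $\mathbb{Z}$ in $(-1/2,1/2]$. A vector $\theta\in\mathbb{R}^m$ is pseudodual if $\tilde Z(\theta) \le d(\theta, \mathcal{L}'^* )/2$, where $d$ is Euclidean distance. The spanningness is $s(Z)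 := \inf\{\tilde Z(\theta) : \theta \text{ pseudodual},\ \theta \notin \mathcal{L}'^*\}$ (equal to $\infty$ if there is no such $\theta$, in which case $s(Z)^{-4} = 0$). *)

(* Defs.v *)
From HB Require Import structures.
From mathcomp Require Import all_boot all_order all_algebra.
From mathcomp Require Import all_classical all_reals all_analysis.

Set Implicit Arguments.
Unset Strict Implicit.
Unset Printing Implicit Defensive.

Import Order.TTheory GRing.Theory Num.Theory.
Import numFieldNormedType.Exports.

Local Open Scope classical_set_scope.
Local Open Scope ring_scope.

Section EuclideanSpace.
Context {R : realType} {m : nat}.
Implicit Types (x y : 'cV[R]_m) (S : set 'cV[R]_m).

Definition dot x y : R := \sum_(i < m) x i 0 * y i 0.

(* The library norm on matrices is the sup norm, hence this definition. *)
Definition enorm x : R := Num.sqrt (dot x x).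

Definition eball (r : R) : set 'cV[R]_m := [set x | enorm x <= r].

Definition is_norm (nrm : 'cV[R]_m -> R) : Prop :=
  [/\ forall x y, nrm (x + y) <= nrm x + nrm y,
      forall (a : R) x, nrm (a *: x) = `|a| * nrm x &
      forall x, nrm x = 0 -> x = 0].

Definition spanR S : set 'cV[R]_m :=
  [set x | exists (k : nat) (a : 'I_k -> R) (v : 'I_k -> 'cV[R]_m),
     (forall i, S (v i)) /\ x = \sum_(i < k) a i *: v i].

Definition spanZ S : set 'cV[R]_m :=
  [set x | exists (k : nat) (a : 'I_k -> int) (v : 'I_k -> 'cV[R]_m),
     (forall i, S (v i)) /\ x = \sum_(i < k) v i *~ a i].

Definition is_lattice S : Prop :=
  [/\ S 0, forall x y, S x -> S y -> S (x - y) &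
      forall x, S x -> isolated S x].

Definition nondegenerate_lattice S : Prop := spanR S = setT.

(* The columns of [B] are linearly independent and generate [S]; since [B] is
   square, this only makes sense for a nondegenerate lattice. *)
Definition is_lattice_basis S (B : 'M[R]_m) : Prop :=
  B \in unitmx /\ S = [set x | exists z : 'cV[int]_m, x = B *m map_mx intr z].

Definition lattice_det S : R :=
  xget 0 [set `|\det B| | B in is_lattice_basis S].

Definition dual_lattice S : set 'cV[R]_m :=
  [set z | forall x, S x -> dot z x \is a Num.int].

Definition dist (nrm : 'cV[R]_m -> R) x S : R :=
  inf [set nrm (x - y) | y in S].

Definition covering_radius (nrm : 'cV[R]_m -> R) S : R :=
  sup [set dist nrm x S | x in spanR S].

Definition distortion (nrm : 'cV[R]_m -> R) : R :=
  sup [set enorm x | x in [set x | nrm x = 1]].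

(* The all-ones vector, used as initial value of the minimum, is itself one of
   the sign vectors. *)
Definition disc (nrm : 'cV[R]_m -> R) (n : nat) (M : 'M[R]_(m, n)) : R :=
  \big[Num.min/nrm (M *m const_mx 1)]_(e : {ffun 'I_n -> bool})
     nrm (M *m \col_(j < n) (-1) ^+ e j).

Definition psd (A : 'M[R]_m) : Prop :=
  A^T = A /\ forall x, 0 <= dot x (A *m x).

(* The unique positive semidefinite square root, when [A] is positive
   semidefinite. *)
Definition sqrt_mx (A : 'M[R]_m) : 'M[R]_m :=
  xget 0 [set S : 'M[R]_m | psd S /\ S *m S = A].

Definition is_least_eigenvalue (A : 'M[R]_m) (a : R) : Prop :=
  eigenvalue A a /\ forall b, eigenvalue A b -> a <= b.

Definition borel : set (set 'cV[R]_m) :=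
  <<s [set U : set 'cV[R]_m | open U] >>.

End EuclideanSpace.

Section RandomVectors.
Context {R : realType} {m : nat} {d : measure_display} {T : measurableType d}.
Implicit Types (P : probability T R) (X Z : T -> 'cV[R]_m).

Definition random_vector X : Prop :=
  forall B : set 'cV[R]_m, borel B -> measurable (X @^-1` B).

Definition supp P X : set 'cV[R]_m :=
  [set x | forall U : set 'cV[R]_m, open U -> U x -> (0 < P (X @^-1` U))%E].

Definition second_moment P X : 'M[R]_m :=
  \matrix_(i, j) fine ('E_P[fun w => (X w i 0 * X w j 0)%R])%E.

(* The representative of [y] modulo 1 in the interval (-1/2, 1/2]. *)
Definition mod1 (y : R) : R := y - (Num.ceil (y - 2^-1))%:~R.

Definition Ztilde P Z (theta : 'cV[R]_m) : R :=
  Num.sqrt (fine ('E_P[fun w => (`|mod1 (dot theta (Z w))| ^+ 2)%R])%E).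

Definition pseudodual P Z (theta : 'cV[R]_m) : Prop :=
  Ztilde P Z theta <= dist enorm theta (dual_lattice (spanZ (supp P Z))) / 2.

Definition spanningness P Z : \bar R :=
  ereal_inf [set (Ztilde P Z theta)%:E | theta in
    [set theta | pseudodual P Z theta /\
                 ~ dual_lattice (spanZ (supp P Z)) theta]].

Definition mutually_independent P (n : nat) (Y : 'I_n -> T -> 'cV[R]_m) : Prop :=
  forall B : 'I_n -> set 'cV[R]_m, (forall j, borel (B j)) ->
    P (\bigcap_(j in [set: 'I_n]) (Y j @^-1` B j)) =
    (\prod_(j < n) P (Y j @^-1` B j))%E.

End RandomVectors.

(* [Y] may live on another probability space than [X]. *)
Definition independent_copies (R : realType) (m n : nat)
    (d d' : measure_display) (T : measurableType d) (T' : measurableType d')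
    (P : probability T R) (X : T -> 'cV[R]_m)
    (P' : probability T' R) (Y : 'I_n -> T' -> 'cV[R]_m) : Prop :=
  [/\ forall j, random_vector (Y j),
      forall j (B : set 'cV[R]_m), borel B ->
        P' (Y j @^-1` B) = P (X @^-1` B) &
      mutually_independent P' Y].

(* Main.v *)
Require Import Defs.
From HB Require Import structures.
From mathcomp Require Import all_boot all_order all_algebra.
From mathcomp Require Import all_classical all_reals all_analysis.
From mathcomp Require Import complex measurable_realfun.
From mathcomp Require Import ring lra zify.

(** The distance of [M 1] to [2 Lat] is the infimum of the norm over the coset
    [M 1 + 2 Lat], and this coset contains [M y] for every sign vector [y]. So
    it suffices that, with the required probability, every point [lam] of the
    coset whose norm is at most slightly above twice the covering radius has
    the form [M y]. The upper bound by twice the covering radius is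
    deterministic (lemma [dist_double_le]). Since the distortion bounds the
    Euclidean norm by the norm and [sigma] is the minimum of the Rayleigh
    quotient of [Sigma], the first term of the maximum ensures that after
    whitening, that is, multiplication by the inverse square root of [Sigma],
    these points lie in the Euclidean ball of radius [sqrt n].

    In a basis [B] of the lattice the columns of [M] are integer vectors [w_j],
    with whitened versions [z_j = U w_j], and [lam] is hit if and only if some
    subset sum of the [w_j] is a given integer vector [v]. To show that there is
    one, choose the subset at random, the elements independently, with
    probabilities tilted such that the mean of the subset sum is exactly [v];
    the tilts [t_j] are of order [L / sqrt n] (lemma [tilt_exists]). The
    characteristic function of the difference is a product [F] of explicit
    factors. Its sum over the grid of points with coordinates in [(1/K) Z]
    modulo 1 is zero unless [v] is hit, so a positive lower bound for the real
    part of this sum is enough (lemma [exists_subset_sum]). Three kinds of grid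
    points are distinguished by the distance [r] of the whitened frequency to
    the dual lattice.

    - For [r] at most [2 / sqrt (L sqrt n)], the real part of [F] is
      nonnegative, because the phase of each factor is only of order
      [t_j x_j^3], where [x_j] is the frequency seen by [w_j]: centring removes
      the linear term, and for [t_j = 0] the factor is real (lemmas
      [tilted_factor_sector] and [tilted_prod_sector]).
    - For [r] at most [1 / (8 sqrt n)], the real part is even at least [1/2]
      (lemma [tilted_prod_tiny]). The number of such grid points is bounded
      below by an elementary count of lattice points in an ellipsoid (lemma
      [lattice_point_count]); this is where the determinants of the lattice and
      of [Sigma] enter.
    - For all other points, the absolute value of [F] is bounded by a product
      over the columns which does not depend on the tilts. Its expectation over
      [M] decays exponentially in [n Ztilde^2], which by the definition of the
      spanningness is at least of order [sqrt n / L] (lemmas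
      [far_expectation] and [spread_of_spanningness]). By Markov's inequality
      the sum over these points is negligible compared with the contribution
      of the second kind, with high probability.

    No asymptotics of the local limit theorem are needed, because the mean of
    the tilted subset sum is the target itself. The other random input is that
    the sample covariance matrix of the whitened columns is close to the
    identity; here Chebyshev's inequality in Frobenius norm suffices (lemma
    [cov_error_tail]). Both failure probabilities are of order [L / sqrt n]. The
    remaining terms of the maximum make [sqrt n / L] large compared with
    [m log n] and with the logarithm of the determinant ratio (lemma
    [parameter_bounds]).

    Since a lattice has a basis (lemma [lattice_basis_exists]) and the support
    of [X] is bounded, [X] takes almost surely only finitely many values, so that
    all of this happens on a finite product probability space; the passage from
    there to the given probability spaces is [probability_ge_weight]. *)

Set Implicit Arguments.
Unset Strict Implicit.
Unset Printing Implicit Defensive.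

Import Order.TTheory GRing.Theory Num.Theory.
Import numFieldNormedType.Exports.

Local Open Scope classical_set_scope.
Local Open Scope ring_scope.

(** * Euclidean geometry *)

Section Euclidean.
Context {R : realType}.

Lemma dotC m (x y : 'cV[R]_m) : dot x y = dot y x.
Proof. by apply: eq_bigr => i _; rewrite mulrC. Qed.

Lemma dotDr m (x y z : 'cV[R]_m) : dot x (y + z) = dot x y + dot x z.
Proof. by rewrite /dot -big_split; apply: eq_bigr => i _; rewrite mxE mulrDr. Qed.

Lemma dotDl m (x y z : 'cV[R]_m) : dot (x + y) z = dot x z + dot y z.
Proof. by rewrite dotC dotDr !(dotC z). Qed.

Lemma dotZr m (a : R) (x y : 'cV[R]_m) : dot x (a *: y) = a * dot x y.
Proof. by rewrite /dot mulr_sumr; apply: eq_bigr => i _; rewrite mxE mulrCA. Qed.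

Lemma dotZl m (a : R) (x y : 'cV[R]_m) : dot (a *: x) y = a * dot x y.
Proof. by rewrite dotC dotZr dotC. Qed.

Lemma dotNr m (x y : 'cV[R]_m) : dot x (- y) = - dot x y.
Proof. by rewrite -scaleN1r dotZr mulN1r. Qed.

Lemma dotNl m (x y : 'cV[R]_m) : dot (- x) y = - dot x y.
Proof. by rewrite dotC dotNr dotC. Qed.

Lemma dotBr m (x y z : 'cV[R]_m) : dot x (y - z) = dot x y - dot x z.
Proof. by rewrite dotDr dotNr. Qed.

Lemma dotBl m (x y z : 'cV[R]_m) : dot (x - y) z = dot x z - dot y z.
Proof. by rewrite dotDl dotNl. Qed.

Lemma dot0r m (x : 'cV[R]_m) : dot x 0 = 0.
Proof. by rewrite -(scale0r 0) dotZr mul0r. Qed.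

Lemma dot0l m (x : 'cV[R]_m) : dot 0 x = 0.
Proof. by rewrite dotC dot0r. Qed.

Lemma dot_sumr m (I : Type) (r : seq I) (P : pred I) (x : 'cV[R]_m) F :
  dot x (\sum_(i <- r | P i) F i) = \sum_(i <- r | P i) dot x (F i).
Proof.
by apply: (big_morph (dot x)) => [y z|]; rewrite ?dotDr ?dot0r.
Qed.

Lemma dotE m (x y : 'cV[R]_m) : dot x y = (x^T *m y) 0 0.
Proof. by rewrite mxE; apply: eq_bigr => i _; rewrite mxE. Qed.

Lemma dot_mulmx m k (A : 'M[R]_(m, k)) x y : dot x (A *m y) = dot (A^T *m x) y.
Proof. by rewrite !dotE trmx_mul trmxK mulmxA. Qed.

Lemma dot_ge0 m (x : 'cV[R]_m) : 0 <= dot x x.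
Proof. by apply: sumr_ge0 => i _; rewrite -expr2 sqr_ge0. Qed.

Lemma dot_eq0 m (x : 'cV[R]_m) : dot x x = 0 -> x = 0.
Proof.
move=> /eqP; rewrite /dot psumr_eq0; last by move=> i _; rewrite -expr2 sqr_ge0.
move=> /allP x0; apply/matrixP => i j; rewrite ord1 mxE.
by have := x0 i (mem_index_enum _); rewrite mulf_eq0 orbb => /eqP.
Qed.

Lemma dot_gt0 m (x : 'cV[R]_m) : x != 0 -> 0 < dot x x.
Proof.
by move=> x0; rewrite lt_def dot_ge0 andbT; apply: contra x0 => /eqP /dot_eq0 ->.
Qed.

Lemma enorm_ge0 m (x : 'cV[R]_m) : 0 <= enorm x.
Proof. exact: sqrtr_ge0. Qed.

Lemma sqr_enorm m (x : 'cV[R]_m) : enorm x ^+ 2 = dot x x.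
Proof. by rewrite sqr_sqrtr// dot_ge0. Qed.

Lemma enorm0 m : enorm (0 : 'cV[R]_m) = 0.
Proof. by rewrite /enorm dot0r sqrtr0. Qed.

Lemma enorm_eq0 m (x : 'cV[R]_m) : enorm x = 0 -> x = 0.
Proof. by move=> x0; apply: dot_eq0; rewrite -sqr_enorm x0 expr0n. Qed.

Lemma enormZ m a (x : 'cV[R]_m) : enorm (a *: x) = `|a| * enorm x.
Proof. by rewrite /enorm dotZl dotZr mulrA -expr2 sqrtrM ?sqr_ge0// sqrtr_sqr. Qed.

Lemma enormN m (x : 'cV[R]_m) : enorm (- x) = enorm x.
Proof. by rewrite /enorm dotNl dotNr opprK. Qed.

(** The discriminant of a nonnegative quadratic polynomial is nonpositive;
    stated for an arbitrary positive semidefinite matrix, because the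
    characterization of the least eigenvalue applies it to a second moment
    matrix minus a multiple of the identity. *)
Lemma psd_cauchy_schwarz m (A : 'M[R]_m) x y : psd A ->
  dot x (A *m y) ^+ 2 <= dot x (A *m x) * dot y (A *m y).
Proof.
move=> [AT A0]; set a := dot x (A *m x); set b := dot x (A *m y).
set c := dot y (A *m y).
have sym : dot y (A *m x) = b by rewrite dot_mulmx AT dotC.
have q (s t : R) : 0 <= s ^+ 2 * a + 2 * s * t * b + t ^+ 2 * c.
  have := A0 (s *: x + t *: y).
  rewrite mulmxDr -!scalemxAr dotDl !dotDr !dotZl !dotZr sym -/a -/b -/c.
  by congr (_ <= _); ring.
have a0 : 0 <= a by exact: A0.
have c0 : 0 <= c by exact: A0.
have [a00|an0] := eqVneq a 0.
  have := q (- (c + 1) * b) (b ^+ 2).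
  have [->|bn0] := eqVneq b 0; first by rewrite expr0n /= mulr_ge0.
  have b2 : 0 < b ^+ 2 by rewrite exprn_even_gt0.
  rewrite a00 mulr0 add0r => h; exfalso.
  have : 0 <= b ^+ 2 * (b ^+ 2) * (- c - 2).
    by move: h; congr (_ <= _); ring.
  by rewrite pmulr_rge0 ?(mulr_gt0 b2 b2)// => h2; clear -c0 h2; lra.
have := q (- b) a.
have -> : (- b) ^+ 2 * a + 2 * - b * a * b + a ^+ 2 * c =
  a * (a * c - b ^+ 2) by ring.
by rewrite pmulr_rge0 ?subr_ge0// lt_def an0.
Qed.

Lemma psd1 m : psd (1%:M : 'M[R]_m).
Proof. by split=> [|x]; rewrite ?trmx1// mul1mx dot_ge0. Qed.

Lemma cauchy_schwarz m (x y : 'cV[R]_m) : dot x y ^+ 2 <= dot x x * dot y y.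
Proof. by have := @psd_cauchy_schwarz m _ x y (@psd1 m); rewrite !mul1mx. Qed.

Lemma ler_dot m (x y : 'cV[R]_m) : `|dot x y| <= enorm x * enorm y.
Proof.
rewrite -(@ler_pXn2r _ 2)// ?nnegrE ?mulr_ge0 ?enorm_ge0//.
by rewrite exprMn !sqr_enorm -normrX ger0_norm ?sqr_ge0// cauchy_schwarz.
Qed.

Lemma ler_enormD m (x y : 'cV[R]_m) : enorm (x + y) <= enorm x + enorm y.
Proof.
rewrite -(@ler_pXn2r _ 2)// ?nnegrE ?addr_ge0 ?enorm_ge0//.
rewrite sqrrD !sqr_enorm dotDl !dotDr (dotC y x).
have := le_trans (ler_norm _) (ler_dot x y); lra.
Qed.

Lemma ler_enormB m (x y : 'cV[R]_m) : enorm (x - y) <= enorm x + enorm y.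
Proof. by rewrite -(enormN y) ler_enormD. Qed.

Lemma ler_enorm_sum m (I : Type) (r : seq I) (P : pred I) (F : I -> 'cV[R]_m) :
  enorm (\sum_(i <- r | P i) F i) <= \sum_(i <- r | P i) enorm (F i).
Proof.
elim/big_ind2 : _ => [|x a y b xa yb|//]; first by rewrite enorm0.
exact: le_trans (ler_enormD _ _) (lerD _ _).
Qed.

Lemma ler_coord_enorm m (x : 'cV[R]_m) i : `|x i 0| <= enorm x.
Proof.
rewrite -sqrtr_sqr ler_wsqrtr// /dot (bigD1 i)//= expr2 lerDl.
by apply: sumr_ge0 => j _; rewrite -expr2 sqr_ge0.
Qed.

Lemma ler_enorm_coord m (x : 'cV[R]_m) : enorm x <= \sum_i `|x i 0|.
Proof.
rewrite -(@ler_pXn2r _ 2)// ?nnegrE ?enorm_ge0 ?sumr_ge0//.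
rewrite sqr_enorm /dot expr2 mulr_suml ler_sum// => i _.
rewrite -expr2 -real_normK ?num_real// expr2 ler_wpM2l//.
by rewrite (bigD1 i)//= lerDl sumr_ge0.
Qed.

Lemma mulmx_bounded m k (A : 'M[R]_(m, k)) :
  exists2 c : R, 0 < c & forall x, enorm (A *m x) <= c * enorm x.
Proof.
exists (1 + \sum_i \sum_j `|A i j|) => [|x].
  by rewrite ltr_wpDr// sumr_ge0// => i _; rewrite sumr_ge0.
apply: le_trans (ler_enorm_coord _) _.
apply: (@le_trans _ _ ((\sum_i \sum_j `|A i j|) * enorm x)); last first.
  by rewrite ler_wpM2r ?enorm_ge0// lerDr.
rewrite mulr_suml ler_sum// => i _; rewrite mxE mulr_suml.
apply: le_trans (ler_norm_sum _ _ _) _; rewrite ler_sum// => j _.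
by rewrite normrM ler_wpM2l// ler_coord_enorm.
Qed.

End Euclidean.

(** * Bases of lattices *)

Section TopologyOfColumns.
Context {R : realType} {m : nat}.
Implicit Types (x y : 'cV[R]_m) (U : set 'cV[R]_m).

Lemma nbhs_enorm x U : nbhs x U ->
  exists2 e : R, 0 < e & forall y, enorm (x - y) < e -> U y.
Proof.
move=> /nbhs_ballP[e /= e0 eU]; exists e => // y xy; apply: eU.
split=> // i j; rewrite ord1 /ball /=.
by have := ler_coord_enorm (x - y) i; rewrite !mxE => /le_lt_trans; apply.
Qed.

Lemma enorm_nbhs x (e : R) : 0 < e -> nbhs x [set y | enorm (x - y) < e].
Proof.
move=> e0; apply/nbhs_ballP; exists (e / m.+1%:R); first by rewrite /= divr_gt0.
move=> y [_ xy]; apply: le_lt_trans (ler_enorm_coord _) _.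
apply: (@le_lt_trans _ _ (\sum_(i < m) e / m.+1%:R)).
  by apply: ler_sum => i _; have := xy i 0; rewrite /ball /= !mxE => /ltW.
rewrite sumr_const card_ord -[_ *+ m]mulr_natr -mulrA gtr_pMr// mulrC.
by rewrite ltr_pdivrMr// mul1r ltr_nat.
Qed.

End TopologyOfColumns.

Section LatticeBasis.
Context {R : realType} {m : nat} (Lat : set 'cV[R]_m).
Hypothesis latL : is_lattice Lat.

Lemma lattice0 : Lat 0. Proof. by case: latL. Qed.

Lemma latticeB x y : Lat x -> Lat y -> Lat (x - y).
Proof. by case: latL => _ + _; apply. Qed.

Lemma latticeN x : Lat x -> Lat (- x).
Proof. by rewrite -(sub0r x); apply: latticeB; exact: lattice0. Qed.

Lemma latticeD x y : Lat x -> Lat y -> Lat (x + y).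
Proof. by move=> Lx Ly; rewrite -(opprK y); apply: latticeB => //; exact: latticeN. Qed.

Lemma lattice_mulrn x n : Lat x -> Lat (x *+ n).
Proof.
move=> Lx; elim: n => [|n IH]; first by rewrite mulr0n; exact: lattice0.
by rewrite mulrS; exact: latticeD.
Qed.

Lemma lattice_mulrz x (a : int) : Lat x -> Lat (x *~ a).
Proof.
move=> Lx; case: a => n; first by rewrite -pmulrn; exact: lattice_mulrn.
by rewrite NegzE mulrNz -pmulrn; apply: latticeN; exact: lattice_mulrn.
Qed.

Lemma lattice_sum (I : Type) (r : seq I) (P : pred I) (F : I -> 'cV[R]_m) :
  (forall i, P i -> Lat (F i)) -> Lat (\sum_(i <- r | P i) F i).
Proof. by move=> LF; elim/big_ind : _ => //; [exact: lattice0 | exact: latticeD]. Qed.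

Lemma mulmx_sum_col k (A : 'M[R]_(m, k)) x : A *m x = \sum_j x j 0 *: col j A.
Proof.
by apply/matrixP => i j; rewrite ord1 mxE summxE; apply: eq_bigr => l _;
  rewrite !mxE mulrC.
Qed.

Lemma lattice_mulmx k (A : 'M[R]_(m, k)) (z : 'cV[int]_k) :
  (forall j, Lat (col j A)) -> Lat (A *m map_mx intr z).
Proof.
move=> LA; rewrite mulmx_sum_col; apply: lattice_sum => j _.
by rewrite mxE scaler_int; exact: lattice_mulrz.
Qed.

Lemma lattice_separated :
  exists2 e : R, 0 < e & forall x, Lat x -> enorm x < e -> x = 0.
Proof.
have [L0 _ /(_ _ L0)[_ [V /nbhs_enorm[e e0 eV] V0]]] := latL.
exists e => // x Lx xe; suff : [set (0 : 'cV[R]_m)] x by [].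
by rewrite -V0; split => //; apply: eV; rewrite sub0r enormN.
Qed.

Hypothesis ndL : nondegenerate_lattice Lat.

(** A lattice vector outside the span of the previous ones exists as long as
    there are fewer than [m] of them, because the lattice spans the space. *)
Lemma lattice_free_family r : (r <= m)%N -> exists2 A : 'M[R]_(r, m),
  row_free A & forall i, Lat (row i A)^T.
Proof.
elim: r => [_|r IH rm].
  by exists 0 => [|[]//]; apply/eqP; rewrite mxrank0.
have [A fA LA] := IH (ltnW rm).
have [v Lv vA] : exists2 v, Lat v & ~~ (v^T <= A)%MS.
  apply: contrapT => /forall2NP H.
  suff : (1%:M <= A)%MS.
    by move=> /mxrankS; rewrite mxrank1 (eqP fA) leqNgt rm.
  apply/row_subP => i.
  have : setT (row i 1%:M : 'rV[R]_m)^T by [].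
  rewrite -ndL => -[k [a [u [Lu /(congr1 trmx)]]]]; rewrite trmxK => ->.
  rewrite linear_sum/=; apply: summx_sub => j _; rewrite linearZ/=.
  apply: scalemx_sub; have [nL|/negP] := H (u j); first by case: nL.
  by rewrite negbK.
exists (col_mx v^T A : 'M[R]_(1 + r, m)); last first.
  suff H (i : 'I_(1 + r)) : Lat (row i (col_mx v^T A))^T by [].
  case: (split_ordP i) => j ->; rewrite (rowKd, rowKu)//.
  by rewrite ord1 row_id trmxK.
apply: (@inj_row_free _ (1 + r)%N) => u; rewrite -[u]hsubmxK mul_row_col.
set b := lsubmx u; set a := rsubmx u => h.
have b0 : b = 0.
  apply: contraNeq vA => b0.
  have b00 : b 0 0 != 0.
    by apply: contra b0 => /eqP h0; rewrite [b]mx11_scalar h0 raddf0.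
  have : b *m v^T = - (a *m A) by apply/eqP; rewrite -addr_eq0 h.
  rewrite [b]mx11_scalar mul_scalar_mx => /(congr1 ( *:%R (b 0 0)^-1)).
  by rewrite scalerA mulVf// scale1r => ->; rewrite scalemx_sub// -mulNmx submxMl.
have a0 : a = 0.
  move: h; rewrite b0 mul0mx add0r => /eqP.
  by rewrite mulmx_free_eq0// => /eqP.
by rewrite a0 b0 row_mx0.
Qed.

(** Pigeonhole: among the multiples of a lattice vector, two have nearly the
    same fractional parts with respect to [A], so that the difference is a
    lattice vector too short to be nonzero up to an integer combination of the
    columns. Hence the lattice generated by [A] has finite index. *)
Lemma lattice_common_denominator (A : 'M[R]_m) : A \in unitmx ->
  (forall j, Lat (col j A)) ->
  exists2 Q : nat, (0 < Q)%N &
    forall x, Lat x -> forall i, (invmx A *m (x *+ Q)) i 0 \is a Num.int.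
Proof.
move=> uA LA; have [e e0 eL] := lattice_separated.
have [C C0 CA] := mulmx_bounded A.
pose N' := Num.truncn (C * m%:R / e); pose N := N'.+1.
have NC : C * m%:R / e < N%:R by exact: truncnS_gt.
exists (N ^ m)`! => [|x Lx]; first exact: fact_gt0.
set y := invmx A *m x.
pose frac (k : nat) i := k%:R * y i 0 - (Num.floor (k%:R * y i 0))%:~R.
have frac_itv k i : 0 <= frac k i < 1.
  have /andP[h1 h2] := floor_itv (k%:R * y i 0).
  by rewrite /frac; move: h2; rewrite intrD => h2; apply/andP; split; lra.
pose box (k : 'I_(N ^ m).+1) : {ffun 'I_m -> 'I_N} :=
  [ffun i => inord (Num.truncn (N%:R * frac k i))].
have /injectivePn[k1 [k2 k12 bk]] : ~~ injectiveb box.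
  by apply/negP => /injectiveP/leq_card; rewrite card_ffun !card_ord ltnn.
wlog k12' : k1 k2 {k12} bk / (k1 < k2)%N.
  by move: k12; rewrite neq_ltn => /orP[k12 /(_ _ _ bk k12)|k12 /(_ _ _ (esym bk) k12)].
pose z : 'cV[int]_m :=
  \col_i (Num.floor (k2%:R * y i 0) - Num.floor (k1%:R * y i 0)).
pose v := x *+ (k2 - k1) - A *m map_mx intr z.
have Lv : Lat v.
  by apply: latticeB; [exact: lattice_mulrn | exact: lattice_mulmx].
have vE : v = A *m (\col_i (frac k2 i - frac k1 i)).
  rewrite /v -{1}(mulKVmx uA x) -/y -[_ *+ _]scaler_nat scalemxAr -mulmxBr; congr (_ *m _).
  apply/matrixP => i j; rewrite ord1 !mxE natrB ?(ltnW k12')// /frac intrB.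
  by rewrite /y !mxE; ring.
have fr i : `|frac k2 i - frac k1 i| <= N%:R^-1.
  have N0 : 0 < N%:R :> R by [].
  have boxK (k : 'I_(N ^ m).+1) : (box k i)%:R <= N%:R * frac k i < (box k i).+1%:R.
    have /andP[f0 f1] := frac_itv k i.
    have Nf : 0 <= N%:R * frac k i by rewrite mulr_ge0.
    rewrite /box ffunE inordK ?truncn_itv// truncn_lt_nat//.
    by rewrite gtr_pMr.
  have /andP[] := boxK k1; have /andP[] := boxK k2; rewrite bk -natr1 => h1 h2 h3 h4.
  rewrite -(ler_pM2l N0) mulfV ?gt_eqF// -[X in X * _](gtr0_norm N0) -normrM.
  by rewrite ler_norml mulrBr; apply/andP; split; lra.
have v0 : v = 0.
  apply: eL => //; rewrite vE; apply: le_lt_trans (CA _) _.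
  rewrite -(ltr_pdivlMl _ _ C0); apply: le_lt_trans (ler_enorm_coord _) _.
  apply: (@le_lt_trans _ _ (\sum_(i < m) N%:R^-1)).
    by apply: ler_sum => i _; rewrite mxE.
  rewrite sumr_const card_ord -[_ *+ m]mulr_natr mulrC ltr_pdivrMr//.
  by rewrite -mulrA ltr_pdivlMl// (mulrC e) -ltr_pdivrMr.
move=> i.
have : ((k2 - k1) %| (N ^ m)`!)%N.
  by rewrite dvdn_fact// subn_gt0 k12' leq_subLR (leq_trans _ (leq_addl _ _))// -ltnS.
move=> /dvdnP[q ->]; rewrite mulnC mulrnA.
move/eqP: v0; rewrite subr_eq0 => /eqP ->.
rewrite -[_ *+ q]scaler_nat -!scalemxAr mulKmx// !mxE.
by rewrite rpredM// ?rpred_nat// intr_int.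
Qed.

(** The new matrix is the product of [B] and the identity matrix with [i]-th
    column replaced by [f]. *)
Lemma det_replace_col (B : 'M[R]_m) (f : 'cV[R]_m) i :
  \det (\matrix_(k, l) if l == i then (B *m f) k 0 else B k l) = \det B * f i 0.
Proof.
pose E : 'M[R]_m := \matrix_(k, l) if l == i then f k 0 else (k == l)%:R.
have -> : (\matrix_(k, l) if l == i then (B *m f) k 0 else B k l) = B *m E.
  apply/matrixP => k l; rewrite !mxE; case: eqP => li.
    by apply: eq_bigr => j _; rewrite mxE li eqxx.
  rewrite (bigD1 l)//= !mxE (introF eqP li) eqxx mulr1 big1 ?addr0// => j jl.
  by rewrite mxE (introF eqP li) (negbTE jl) mulr0.
rewrite det_mulmx (expand_det_row E i); congr (_ * _).
rewrite (bigD1 i)//= mxE eqxx big1 ?addr0; last first.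
  by move=> j ji; rewrite mxE (negbTE ji) eq_sym (negbTE ji) mul0r.
rewrite /cofactor addnn -signr_odd odd_double expr0 mul1r.
suff -> : row' i (col' i E) = 1%:M by rewrite det1 mulr1.
by apply/matrixP => k l; rewrite !mxE eq_sym (negbTE (neq_lift _ _)) (inj_eq lift_inj).
Qed.

(** Linearly independent lattice vectors whose determinant is minimal in
    absolute value form a basis: a lattice vector with a nonintegral coordinate
    could be reduced and exchanged for one of them, decreasing the
    determinant. The minimum exists because the determinants are integral
    multiples of a fixed number. *)
Lemma lattice_basis_exists : exists B : 'M[R]_m, is_lattice_basis Lat B.
Proof.
have [A0 fA0 LA0] := lattice_free_family (leqnn m).
pose A := A0^T.
have uA : A \in unitmx by rewrite unitmx_tr -row_free_unit.
have LA j : Lat (col j A) by rewrite -tr_row.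
have [Q Q0 QL] := lattice_common_denominator uA LA.
have dA0 : \det A != 0 by rewrite -unitfE -unitmxE.
pose alpha := `|\det A| / Q%:R ^+ m.
have alpha0 : 0 < alpha by rewrite divr_gt0 ?normr_gt0// exprn_gt0 ?ltr0n.
have detL (B : 'M[R]_m) : (forall j, Lat (col j B)) ->
    exists k : nat, `|\det B| = alpha * k%:R.
  move=> LB; pose D := invmx A *m (Q%:R *: B).
  have Dint i j : D i j \is a Num.int.
    have := QL _ (LB j) i; congr (_ \is a Num.int).
    by rewrite -[_ *+ Q]scaler_nat /D !mxE; apply: eq_bigr => k _; rewrite !mxE.
  have detD : \det D = \det B / \det A * Q%:R ^+ m.
    by rewrite /D det_mulmx det_inv detZ; ring.
  have : \det D \is a Num.int.
    by rewrite rpred_sum// => s _; rewrite rpredMsign rpred_prod.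
  move=> /natr_norm_int/natrP[k kE]; exists k.
  rewrite -kE detD normrM normf_div normrX normr_nat /alpha.
  have : `|\det A| != 0 by rewrite normr_eq0.
  have : Q%:R ^+ m != 0 :> R by apply: expf_neq0; rewrite pnatr_eq0 -lt0n.
  move: (`|\det A|) (Q%:R ^+ m) => a q q0 a0; field; rewrite a0 q0//.
pose has k := `[< exists B : 'M[R]_m, [/\ forall j, Lat (col j B), \det B != 0 &
   `|\det B| = alpha * k%:R] >].
have : exists k, has k.
  by have [k kE] := detL A LA; exists k; apply/asboolP; exists A.
move=> /ex_minnP[k /asboolP[B [LB dB kB]] kmin].
exists B; have uB : B \in unitmx by rewrite unitmxE unitfE.
split => //; apply/seteqP; split => [x Lx /=|_ [z ->]]; last exact: lattice_mulmx.
pose z : 'cV[int]_m := map_mx Num.floor (invmx B *m x).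
exists z; apply/eqP; rewrite -subr_eq0; apply/eqP.
pose f : 'cV[R]_m := invmx B *m x - map_mx intr z.
have xE : x - B *m map_mx intr z = B *m f by rewrite mulmxBr mulKVmx.
have f_itv i : 0 <= f i 0 < 1.
  have -> : f i 0 = (invmx B *m x) i 0 - (Num.floor ((invmx B *m x) i 0))%:~R.
    by rewrite /f /z mxE; congr (_ + _); rewrite !mxE.
  have /andP[] := floor_itv ((invmx B *m x) i 0).
  by move: (_ i 0) => t; rewrite intrD => h1 h2; apply/andP; split; lra.
rewrite xE; suff -> : f = 0 by rewrite mulmx0.
apply/matrixP => i j; rewrite ord1 [RHS]mxE; apply: contrapT => /eqP fi0.
pose B' := \matrix_(p, l) if l == i then (B *m f) p 0 else B p l.
have LB' l : Lat (col l B').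
  have [->|li] := eqVneq l i.
    have -> : col i B' = x - B *m map_mx intr z.
      by rewrite xE; apply/matrixP => p q; rewrite !ord1 !mxE eqxx.
    by apply: latticeB => //; exact: lattice_mulmx.
  have -> : col l B' = col l B; last by [].
  by apply/matrixP => p q; rewrite !mxE (negbTE li).
have [k' k'E] := detL B' LB'.
have dB' : \det B' = \det B * f i 0 by exact: det_replace_col.
have : (k <= k')%N.
  by apply: kmin; apply/asboolP; exists B'; split => //; rewrite dB' mulf_neq0.
apply/negP; rewrite -ltnNge -(ltr_nat R) -(ltr_pM2l alpha0) -k'E -kB dB' normrM.
have /andP[f0 f1] := f_itv i.
by rewrite gtr_pMr ?normr_gt0// ger0_norm.
Qed.

End LatticeBasis.

(** * Counting lattice points in ellipsoids *)

Section LatticePointCount.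
Context {R : realType}.

Lemma inj_unitmx m (A : 'M[R]_m) : (forall x : 'cV_m, A *m x = 0 -> x = 0) ->
  A \in unitmx.
Proof.
move=> inj; rewrite -unitmx_tr unitmxE unitfE; apply/negP => /det0P[v v0 vA].
have /eqP : v^T = 0 by apply: inj; rewrite -(trmxK A) -trmx_mul vA trmx0.
by rewrite trmx_eq0 (negbTE v0).
Qed.

Lemma gram_unitmx k m (A : 'M[R]_(k, m)) :
  (forall x : 'cV_m, A *m x = 0 -> x = 0) -> A^T *m A \in unitmx.
Proof.
move=> inj; apply: inj_unitmx => x Ax; apply: inj; apply: dot_eq0.
by rewrite dot_mulmx mulmxA Ax dot0l.
Qed.

(** An interval of length [2 T] contains at least [2 T - 1] integers, hence at
    least [T] of them. *)
Lemma ints_in_interval (s T : R) : 1 <= T ->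
  exists ys : seq int, [/\ uniq ys, T <= (size ys)%:R &
    forall y, y \in ys -> `|y%:~R + s| <= T].
Proof.
move=> T1; set y0 := Num.ceil (- s - T).
set k := Num.truncn (2 * T - 1).
have kT : k%:R <= 2 * T - 1 by rewrite truncn_le; lra.
have Tk : 2 * T - 1 < k.+1%:R by exact: truncnS_gt.
exists [seq y0 + (Posz i) | i <- iota 0 k.+1]; split.
- by rewrite map_inj_uniq ?iota_uniq// => i j /addrI [].
- by rewrite size_map size_iota; lra.
move=> _ /mapP[i + ->]; rewrite mem_iota add0n => /andP[_ ik].
have iR : i%:R <= (k%:R : R) by rewrite ler_nat.
have y0l : - s - T <= y0%:~R by exact: ceil_ge.
have y0u : y0%:~R < - s - T + 1 by have := ceilB1_lt (- s - T); rewrite intrB; lra.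
have i0 : 0 <= i%:R :> R by [].
by rewrite intrD -pmulrn ler_norml; apply/andP; split; lra.
Qed.

(** Triangularising the quadratic form [|A x|^2] by the Gram-Schmidt process,
    the coordinates are chosen one after the other, each in an interval whose
    length does not depend on the previous choices; the product of these
    lengths is governed by the Gram determinant. The shift [s] makes the
    induction work. *)
Lemma shifted_lattice_point_count m k (A : 'M[R]_(k, m)) :
  (forall x : 'cV_m, A *m x = 0 -> x = 0) ->
  exists T0 : R, forall T, T0 <= T -> forall s : 'cV[R]_m,
  exists l : seq 'cV[int]_m, [/\ uniq l,
    forall x, x \in l -> enorm (A *m (map_mx intr x + s)) ^+ 2 <= m%:R * T ^+ 2 &
    T ^+ m <= (size l)%:R * Num.sqrt (\det (A^T *m A))].
Proof.
elim: m A => [A _|m IH].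
  exists 0 => T T0 s; exists [:: 0]; split => // [x _|].
    by rewrite mul0r [A]thinmx0 mul0mx enorm0 expr0n.
  by rewrite det_mx00 sqrtr1 mulr1 expr0.
rewrite -[m.+1]/(1 + m)%N => A inj.
(* [b'] is the component of the first column [b] orthogonal to the other columns *)
pose b := lsubmx A; pose A1 := rsubmx A.
have AE : A = row_mx b A1 by rewrite hsubmxK.
have inj1 : forall x : 'cV_m, A1 *m x = 0 -> x = 0.
  move=> x A1x; have /inj : A *m col_mx 0 x = 0.
    by rewrite AE mul_row_col mulmx0 add0r.
  by rewrite -[0 in RHS](@col_mx0 _ 1 m) => /eq_col_mx[].
have uG := gram_unitmx inj1.
pose c : 'cV_m := invmx (A1^T *m A1) *m (A1^T *m b).
pose b' := b - A1 *m c.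
have ort : A1^T *m b' = 0.
  by rewrite mulmxBr mulmxA mulKVmx// subrr.
have b'0 : b' != 0.
  apply/eqP => b'0; have /inj : A *m col_mx 1 (- c) = 0.
    by rewrite AE mul_row_col mulmx1 mulmxN.
  rewrite -[0 in RHS](@col_mx0 _ 1 m) => /eq_col_mx[/eqP].
  by rewrite oner_eq0.
have AEE : A *m block_mx 1%:M 0 (- c) 1%:M = row_mx b' A1.
  by rewrite AE mul_row_block !mulmx1 mulmx0 add0r mulmxN.
have detG : \det (A^T *m A) = enorm b' ^+ 2 * \det (A1^T *m A1).
  have : \det ((A *m block_mx 1%:M 0 (- c) 1%:M)^T *m
               (A *m block_mx 1%:M 0 (- c) 1%:M)) = \det (A^T *m A).
    rewrite trmx_mul -mulmxA (mulmxA A^T) !det_mulmx det_tr.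
    by rewrite det_lblock !det1 !mulr1 mul1r.
  move=> <-; rewrite AEE tr_row_mx mul_col_row ort.
  have -> : b'^T *m A1 = 0 by rewrite -[LHS]trmxK trmx_mul trmxK ort trmx0.
  by rewrite det_ublock {1}[b'^T *m b']mx11_scalar det_scalar1 sqr_enorm dotE.
have beta0 : 0 < enorm b'.
  by rewrite lt_def enorm_ge0 andbT; apply: contra b'0 => /eqP /enorm_eq0 ->.
have [T0 HT0] := IH A1 inj1.
exists (Num.max T0 (enorm b')) => T; rewrite ge_max => /andP[TT0 Tb] s.
have T1 : 1 <= T / enorm b' by rewrite ler_pdivlMr ?mul1r.
have [ys [uys sys ysP]] := ints_in_interval (usubmx s 0 0) T1.
have [l lP] := choice (fun y : int => HT0 T TT0
  (dsubmx s + (y%:~R + usubmx s 0 0) *: c)).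
exists [seq col_mx (const_mx y : 'M[int]_1) x | y <- ys, x <- l y]; split.
- apply: allpairs_uniq_dep => // [y _|]; first by have [] := lP y.
  move=> [y x] [y' x'] _ _ /= /eq_col_mx[/matrixP/(_ 0 0)]; rewrite !mxE => -> ->.
  by [].
- move=> _ /allpairsPdep[y [x [yys xl ->]]].
  have [_ /(_ _ xl) h _] := lP y.
  set r := y%:~R + usubmx s 0 0 in h *.
  have -> : A *m (map_mx intr (col_mx (const_mx y : 'M[int]_1) x) + s) =
     r *: b' + A1 *m (map_mx intr x + (dsubmx s + r *: c)).
    rewrite map_col_mx -{1}[s]vsubmxK add_col_mx AE mul_row_col.
    have -> : map_mx intr (const_mx y : 'M[int]_1) + usubmx s = r%:M.
      apply/matrixP => i j; by rewrite !ord1 mxE mxE [RHS]mxE mulr1n mxE.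
    rewrite mul_mx_scalar addrA [in RHS]mulmxDr /b' scalerBr -scalemxAr -[RHS]addrA.
    by congr (_ + _); rewrite addrCA addNr addr0.
  rewrite sqr_enorm dotDl !dotDr.
  have o2 z : dot b' (A1 *m z) = 0 by rewrite dot_mulmx ort dot0l.
  rewrite (dotC (A1 *m _) (r *: b')) !dotZl !dotZr !o2 !mulr0 addr0 add0r.
  rewrite -!sqr_enorm natrD (mulrDl 1 m%:R) mul1r lerD//.
  rewrite mulrA -expr2 -exprMn -[leLHS]real_normK ?num_real//.
  have := ysP _ yys; rewrite -/r ler_pdivlMr// => hr.
  rewrite ler_pXn2r ?nnegrE// ?(le_trans (ltW beta0) Tb)//.
  by rewrite normrM (ger0_norm (ltW beta0)).
rewrite size_allpairs_dep detG sqrtrM ?sqr_ge0// sqrtr_sqr (ger0_norm (ltW beta0)).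
set D := Num.sqrt _.
have D0 : 0 <= D by exact: sqrtr_ge0.
have T0' : 0 <= T by rewrite (le_trans _ Tb)// ltW.
have : (size ys)%:R * T ^+ m <= (sumn [seq size (l y) | y <- ys])%:R * D.
  elim: (ys) => [|y ys' IHys]; first by rewrite !mul0r.
  have [_ _ h] := lP y.
  rewrite /= natrD -natr1 !(mulrDl _ 1) (mulrDl _ _ D) mul1r addrC. by apply: lerD.
move=> h; rewrite mulrCA exprS.
apply: (le_trans _ (ler_wpM2l (ltW beta0) h)).
by rewrite mulrA ler_wpM2r ?exprn_ge0// -ler_pdivrMl// mulrC.
Qed.

Lemma lattice_point_count m (A : 'M[R]_m) : A \in unitmx ->
  exists T0 : R, forall T, T0 <= T ->
  exists l : seq 'cV[int]_m, [/\ uniq l,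
    forall x, x \in l -> enorm (A *m map_mx intr x) ^+ 2 <= m%:R * T ^+ 2 &
    T ^+ m <= (size l)%:R * `|\det A|].
Proof.
move=> uA; have inj x : A *m x = 0 :> 'cV_m -> x = 0.
  by move=> Ax; rewrite -(mulKmx uA x) Ax mulmx0.
have [T0 HT0] := shifted_lattice_point_count inj.
exists T0 => T TT0; have [l [ul lP sl]] := HT0 T TT0 0; exists l; split => //.
- by move=> x /lP; rewrite addr0.
- by move: sl; rewrite det_mulmx det_tr -expr2 sqrtr_sqr.
Qed.

End LatticePointCount.

(** * Trigonometric estimates *)

Section TrigonometricEstimates.
Context {R : realType}.
Implicit Types a t x y : R.

Lemma derive_ge0_ge0 (f df : R -> R) : f 0 = 0 ->
  (forall x, is_derive x 1 f (df x)) -> (forall x, 0 <= x -> 0 <= df x) ->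
  forall x, 0 <= x -> 0 <= f x.
Proof.
move=> f0 fdf df0 x; rewrite le_eqVlt => /predU1P[<-|x0]; first by rewrite f0.
have [|c /andP[c0 _]] := @MVT R f df 0 x x0 (fun y _ => fdf y).
  by apply: derivable_within_continuous => y _; have [] := fdf y.
by rewrite f0 !subr0 => ->; rewrite mulr_ge0 ?df0 ?(ltW c0) ?(ltW x0).
Qed.

Lemma sin_le_id x : 0 <= x -> sin x <= x.
Proof.
move=> x0; rewrite -subr_ge0.
apply: (@derive_ge0_ge0 (fun y => y - sin y) (fun y => 1 - cos y)) => //.
by rewrite sin0 subrr.
Qed.

Lemma normr_sin_le x : `|sin x| <= `|x|.
Proof.
wlog x0 : x / 0 <= x => [H|].
  by have [/H//|/ltW] := leP 0 x; rewrite -oppr_ge0 => /H; rewrite sinN !normrN.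
rewrite (ger0_norm x0) ler_norml sin_le_id// andbT.
have [x1|x1] := leP 1 x; first by have := sin_geN1 x; lra.
have : 0 <= sin x by apply: sin_ge0_pi; have := @pi_ge2 R; lra.
lra.
Qed.

Lemma cos_double x : cos (2 * x) = 1 - 2 * sin x ^+ 2.
Proof. by have := cos2Dsin2 x; rewrite mulr_natl mulr2n cosD -!expr2; lra. Qed.

Lemma cos_ge_quadratic x : 1 - x ^+ 2 / 2 <= cos x.
Proof.
have -> : x = 2 * (x / 2) by field.
rewrite cos_double; have := normr_sin_le (x / 2).
rewrite -(@ler_pXn2r _ 2)// ?nnegrE// !real_normK ?num_real// => h.
have -> : (2 * (x / 2)) ^+ 2 / 2 = 2 * (x / 2) ^+ 2 by field.
lra.
Qed.

Lemma sin_ge_cubic x : 0 <= x -> x - x ^+ 3 / 6 <= sin x.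
Proof.
move=> x0; rewrite -subr_ge0.
apply: (@derive_ge0_ge0 (fun y => sin y - (y - y ^+ 3 / 6))
  (fun y => cos y - (1 - y ^+ 2 / 2))) => //.
- by rewrite sin0; ring.
- move=> y; apply: is_derive_eq; rewrite /GRing.scale /=; by field.
- by move=> y _; rewrite subr_ge0 cos_ge_quadratic.
Qed.

Lemma normr_sin_sub x : `|sin x - x| <= `|x| ^+ 3 / 6.
Proof.
wlog x0 : x / 0 <= x => [H|].
  have [/H//|/ltW] := leP 0 x; rewrite -oppr_ge0 => /H.
  by rewrite sinN -opprD !normrN.
rewrite (ger0_norm x0) distrC ger0_norm; last by rewrite subr_ge0 sin_le_id.
by have := sin_ge_cubic x0; lra.
Qed.

Lemma normr_cos_sub1 x : `|cos x - 1| <= x ^+ 2 / 2.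
Proof.
rewrite distrC ger0_norm; last by rewrite subr_ge0 cos_le1.
by have := cos_ge_quadratic x; lra.
Qed.

(** Any positive constant in place of [4 / 9] would do; this one follows from the
    cubic lower bound for the sine and [2 <= pi <= 4]. *)
Lemma sin_pi_ge x : `|x| <= 1 / 2 -> 4 / 9 * x ^+ 2 <= sin (pi * x) ^+ 2.
Proof.
wlog x0 : x / 0 <= x => [H|].
  have [/H//|/ltW] := leP 0 x; rewrite -oppr_ge0 => /H.
  by rewrite normrN mulrN sinN !sqrrN.
rewrite (ger0_norm x0) => x1.
have p2 := @pi_ge2 R; have p4 : pi < 4 :> R by have := @pihalf_lt2 R; lra.
set y := pi * x; have y2 : 2 * x <= y by rewrite ler_wpM2r.
have y4 : y <= 2 by rewrite /y; nra.
have y0 : 0 <= y by lra.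
have sy : y / 3 <= sin y.
  apply: le_trans (sin_ge_cubic y0); nra.
have -> : 4 / 9 * x ^+ 2 = (2 * x / 3) ^+ 2 by field.
by rewrite ler_pXn2r ?nnegrE//; lra.
Qed.

End TrigonometricEstimates.

Import Normc.
Local Notation Re := complex.Re.
Local Notation Im := complex.Im.

(** * Characters and sectors of the complex plane *)

Section Characters.
Context {R : realType}.
Local Open Scope complex_scope.
Local Notation C := (complex R).

Definition cis (x : R) : C := cos x +i* sin x.

Lemma cisD x y : cis (x + y) = cis x * cis y.
Proof. by apply/eqP; rewrite eq_complex /= cosD sinD eqxx/= addrC. Qed.

Lemma cis0 : cis 0 = 1.
Proof. by rewrite /cis cos0 sin0. Qed.

Lemma cis_sum (I : Type) (r : seq I) (F : I -> R) :
  cis (\sum_(i <- r) F i) = \prod_(i <- r) cis (F i).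
Proof. by apply: (big_morph cis cisD cis0). Qed.

Lemma cisMn x n : cis (x *+ n) = cis x ^+ n.
Proof.
elim: n => [|n IH]; first by rewrite mulr0n cis0.
by rewrite mulrS cisD IH exprS.
Qed.

Lemma cis_2pi_int (a : int) : cis (2 * pi * a%:~R) = 1.
Proof.
have h n : cis (2 * pi * n%:R) = 1.
  rewrite mulr_natr cisMn.
  have -> : 2 * pi = pi *+ 2 :> R by rewrite mulr_natl.
  by rewrite /cis cos2pi sin2pi expr1n.
case: a => n; first by rewrite -pmulrn h.
have : cis (2 * pi * (Negz n)%:~R) * cis (2 * pi * n.+1%:R) = 1.
  by rewrite -cisD NegzE mulrNz mulrN addNr cis0.
by rewrite h mulr1.
Qed.

Lemma normc_cis x : normc (cis x) = 1.
Proof. by rewrite /= cos2Dsin2 sqrtr1. Qed.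

Lemma Re_le_normc (z : C) : `|Re z| <= normc z.
Proof.
case: z => x y /=; rewrite -sqrtr_sqr ler_wsqrtr// lerDl sqr_ge0//.
Qed.

Lemma normc_prod (I : Type) (r : seq I) (F : I -> C) :
  normc (\prod_(i <- r) F i) = \prod_(i <- r) normc (F i).
Proof. by apply: (big_morph (@normc R)) => [x y|]; rewrite ?normcM ?normc1. Qed.

Lemma normc_ge0 (z : C) : 0 <= normc z.
Proof. by case: z => x y /=; rewrite sqrtr_ge0. Qed.

Lemma sqr_normc (z : C) : normc z ^+ 2 = Re z ^+ 2 + Im z ^+ 2.
Proof. by case: z => x y /=; rewrite sqr_sqrtr// addr_ge0 ?sqr_ge0. Qed.

Lemma Re_sum (I : Type) (r : seq I) (P : pred I) (F : I -> C) :
  Re (\sum_(i <- r | P i) F i) = \sum_(i <- r | P i) Re (F i).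
Proof. by apply: (big_morph (@complex.Re R)) => [[x y] [x' y']|]. Qed.

(** A product of complex numbers lying in narrow sectors around the positive
    real axis lies in a sector whose slope is at most twice the sum of their
    slopes. *)
Lemma prod_sector (I : Type) (r : seq I) (F : I -> C) (eta : I -> R) :
  (forall i, 0 <= eta i) ->
  (forall i, 0 <= Re (F i) /\ `|Im (F i)| <= eta i * Re (F i)) ->
  \sum_(i <- r) eta i <= 1 / 2 ->
  0 <= Re (\prod_(i <- r) F i) /\
  `|Im (\prod_(i <- r) F i)| <=
    2 * (\sum_(i <- r) eta i) * Re (\prod_(i <- r) F i).
Proof.
move=> eta0 FP; elim: r => [|i r IH].
  by rewrite !big_nil /= normr0 mulr0 mul0r.
rewrite !big_cons; set S := \sum_(j <- r) _ in IH *.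
have S0 : 0 <= S by rewrite sumr_ge0.
have e0 := eta0 i; move=> h.
have [|] := IH; first by lra.
case: (\prod_(j <- r) F j) => x y /=; have [] := FP i.
case: (F i) => a b /= a0 ba x0 yx.
have ax : 0 <= a * x by rewrite mulr_ge0.
have by_ : `|b * y| <= eta i * (2 * S) * (a * x).
  rewrite normrM; apply: le_trans (ler_pM _ _ ba yx) _ => //.
  by rewrite le_eqVlt; apply/orP; left; apply/eqP; ring.
have ay : `|a * y| <= 2 * S * (a * x).
  by rewrite normrM (ger0_norm a0) mulrCA ler_wpM2l.
have bx : `|b * x| <= eta i * (a * x).
  by rewrite normrM (ger0_norm x0) mulrA ler_wpM2r.
have hS : eta i * (2 * S) <= 1 / 2 by nra.
have [k1 k2] : b * y <= 1 / 2 * (a * x) /\ b * y <= eta i * (2 * S) * (a * x).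
  have := le_trans (ler_norm _) by_; split => //.
  by apply: le_trans (_ : eta i * (2 * S) * (a * x) <= _) => //; rewrite ler_wpM2r.
split; first by lra.
apply: le_trans (ler_normD _ _) _.
apply: le_trans (lerD ay bx) _.
rewrite -mulrDl.
apply: (@le_trans _ _ (2 * (eta i + S) * (a * x - eta i * (2 * S) * (a * x)))).
  rewrite -subr_ge0 (_ : _ - _ = eta i * (1 - 4 * S * (eta i + S)) * (a * x)).
    rewrite mulr_ge0// mulr_ge0//; nra.
  by ring.
by rewrite ler_wpM2l//; lra.
Qed.

Lemma cis_neq1 (x : R) : 0 < x -> x < 1 -> cis (2 * pi * x) != 1.
Proof.
move=> x0 x1; rewrite eq_complex /= -mulrA cos_double negb_and.
have s : 0 < sin (pi * x).
  by apply: sin_gt0_pi; rewrite mulr_gt0 ?pi_gt0//= gtr_pMr ?pi_gt0.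
apply/orP; left; apply/eqP.
have : 0 < sin (pi * x) ^+ 2 by rewrite exprn_gt0.
lra.
Qed.

(** A geometric sum whose ratio is a [K]-th root of unity other than 1. *)
Lemma sum_character (K : nat) (k : int) : k != 0 -> `|k| < K%:Z ->
  \sum_(x < K) cis (2 * pi * (k%:~R / K%:R)) ^+ x = 0.
Proof.
move=> k0 kK; have K0 : 0 < K%:R :> R.
  by rewrite ltr0n; case: (K) kK => //; rewrite normr_lt0.
set z := cis _; have z1 : z != 1.
  have kK' : `|k%:~R : R| < K%:R by rewrite -intr_norm pmulrn ltr_int.
  have [kp|kn] : 0 < k \/ k < 0 by apply/orP; move: k0; rewrite neq_lt orbC.
    by apply: cis_neq1; rewrite ?divr_gt0 ?ltr0z// ltr_pdivrMr// mul1r;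
      apply: le_lt_trans kK'; rewrite ler_norm.
  have zN : z * cis (2 * pi * (- k%:~R / K%:R)) = 1.
    by rewrite -cisD mulNr mulrN addrN cis0.
  apply: contra_eq_neq zN => ->; rewrite mul1r.
  apply: cis_neq1; rewrite ?divr_gt0 ?oppr_gt0 ?ltrz0// ltr_pdivrMr// mul1r.
  by apply: le_lt_trans kK'; rewrite -normrN ler_norm.
have zK : z ^+ K = 1.
  rewrite /z -cisMn (_ : _ *+ K = 2 * pi * k%:~R) ?cis_2pi_int//.
  by rewrite -mulr_natr; field; rewrite gt_eqF.
have /eqP := subrX1 z K; rewrite zK subrr eq_sym mulf_eq0 subr_eq0 (negbTE z1).
by move=> /eqP.
Qed.

Definition grid m K (a : {ffun 'I_m -> 'I_K}) : 'cV[R]_m :=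
  \col_i ((a i)%:R / K%:R).

Lemma sum_character_grid m (K : nat) (k : 'cV[int]_m) : k != 0 ->
  (forall i, `|k i 0| < K%:Z) ->
  \sum_(a : {ffun 'I_m -> 'I_K}) cis (2 * pi * dot (grid a) (map_mx intr k)) = 0.
Proof.
move=> k0 kK.
have [i ki] : exists i, k i 0 != 0.
  apply/existsP; apply: contraNT k0; rewrite negb_exists => /forallP h.
  by apply/eqP/matrixP => i j; rewrite ord1 mxE; apply/eqP; have := h i; rewrite negbK.
transitivity (\prod_(i < m) \sum_(x < K) cis (2 * pi * ((k i 0)%:~R / K%:R)) ^+ x).
  rewrite bigA_distr_bigA; apply: eq_bigr => a _.
  rewrite /dot mulr_sumr cis_sum; apply: eq_bigr => j _.
  rewrite -cisMn !mxE -mulr_natr; congr cis; ring.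
by rewrite (bigD1 i)//= sum_character// mul0r.
Qed.

End Characters.

(** * The characteristic function of a tilted random sign *)

Section TiltedFactor.
Context {R : realType}.
Local Open Scope complex_scope.
Local Notation C := (complex R).

(** The characteristic function at [2 a] of the centred Bernoulli variable
    taking the values [-(1-t)/2] and [(1+t)/2] with mean zero. *)
Definition tilted_factor (a t : R) : C := cis (a * t) * (cos a +i* - (t * sin a)).

Lemma tilted_factorE (a t : R) : tilted_factor a t =
  ((1 + t) / 2)%:C * cis (- (a * (1 - t))) + ((1 - t) / 2)%:C * cis (a * (1 + t)).
Proof.
have -> : - (a * (1 - t)) = a * t + - a by ring.
have -> : a * (1 + t) = a * t + a by ring.
rewrite !cisD !(mulrCA _ (cis (a * t))) -mulrDr; congr (_ * _).
by apply/eqP; rewrite eq_complex /= cosN sinN; apply/andP; split; apply/eqP; field.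
Qed.

Lemma sqr_normc_tilted_factor (a t : R) :
  normc (tilted_factor a t) ^+ 2 = 1 - (1 - t ^+ 2) * sin a ^+ 2.
Proof.
rewrite normcM normc_cis mul1r sqr_normc /=.
have -> : cos a ^+ 2 = 1 - sin a ^+ 2 by have := cos2Dsin2 a; lra.
ring.
Qed.

Lemma mod1_itv (x : R) : `|mod1 x| <= 1 / 2.
Proof.
rewrite /mod1; have := ceil_itv (x - 2^-1); rewrite intrB => /andP[h1 h2].
by rewrite ler_norml; apply/andP; split; lra.
Qed.

Lemma sqr_sin_pi_mod1 (x : R) : sin (pi * x) ^+ 2 = sin (pi * mod1 x) ^+ 2.
Proof.
have h : cos (2 * (pi * x)) = cos (2 * (pi * mod1 x)).
  have : cis (2 * (pi * x)) = cis (2 * (pi * mod1 x)).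
    have -> : 2 * (pi * x) = 2 * (pi * mod1 x) +
        2 * pi * (Num.ceil (x - 2^-1))%:~R by rewrite /mod1; ring.
    by rewrite cisD cis_2pi_int mulr1.
  by case.
by move: h; rewrite !cos_double; lra.
Qed.

(** This bound is uniform in the tilt, which depends on all the columns; hence it
    can be averaged over the columns factor by factor. *)
Lemma normc_tilted_factor_le (x t : R) : `|t| <= 1 / 2 ->
  normc (tilted_factor (pi * x) t) <= expR (- (mod1 x ^+ 2 / 6)).
Proof.
move=> t2; rewrite -(@ler_pXn2r _ 2)// ?nnegrE ?expR_ge0 ?normc_ge0//.
rewrite sqr_normc_tilted_factor sqr_sin_pi_mod1.
have -> : expR (- (mod1 x ^+ 2 / 6)) ^+ 2 = expR (- (mod1 x ^+ 2 / 3)).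
  by rewrite -expRM_natl; congr expR; field.
apply: le_trans (expR_ge1Dx _).
have := sin_pi_ge (mod1_itv x); set s := sin _ ^+ 2; set y := mod1 x ^+ 2.
have t4 : t ^+ 2 <= 1 / 4.
  rewrite -real_normK ?num_real// (_ : 1 / 4 = (1 / 2) ^+ 2 :> R); last by field.
  by rewrite ler_pXn2r ?nnegrE.
have : 0 <= s by exact: sqr_ge0.
by move: t4; set u := t ^+ 2; clearbody s u y => *; nra.
Qed.

(** For small [a] the phase of the factor is of order [t a^3]: the terms of
    order [t a] cancel because the variable is centred, and the whole phase
    vanishes for [t = 0]. *)
Lemma tilted_factor_sector (a t : R) : `|t| <= 1 -> `|a| <= 1 / 2 ->
  0 <= Re (tilted_factor a t) /\
  `|Im (tilted_factor a t)| <= 3 * `|t| * `|a| ^+ 3 * Re (tilted_factor a t).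
Proof.
move=> t1 a2 /=.
have aa : a ^+ 2 <= 1 / 4.
  rewrite -real_normK ?num_real// (_ : 1 / 4 = (1 / 2) ^+ 2 :> R); last by field.
  by rewrite ler_pXn2r ?nnegrE.
have tt : t ^+ 2 <= 1.
  by rewrite -real_normK ?num_real// expr_le1.
have at2 : (a * t) ^+ 2 <= a ^+ 2.
  by rewrite exprMn ler_piMr// sqr_ge0.
have ca := normr_cos_sub1 a; have cat := normr_cos_sub1 (a * t).
have sa := normr_sin_sub a; have sat := normr_sin_sub (a * t).
have sa1 := normr_sin_le a; have sat1 := normr_sin_le (a * t).
have n0 := normr_ge0 a; have nt0 := normr_ge0 t.
have re : 1 / 2 <= cos (a * t) * cos a - sin (a * t) * - (t * sin a).
  have c1 : 7 / 8 <= cos a by move: ca; rewrite ler_norml => /andP[]; lra.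
  have c2 : 7 / 8 <= cos (a * t) by move: cat; rewrite ler_norml => /andP[]; lra.
  have s1 : `|sin (a * t) * (t * sin a)| <= 1 / 4.
    have -> : 1 / 4 = 1 / 2 * (1 / 2) :> R by field.
    rewrite normrM; apply: ler_pM => //.
      apply: le_trans sat1 _; rewrite normrM; nra.
    rewrite normrM; nra.
  have : 7 / 8 * (7 / 8) <= cos (a * t) * cos a by apply: ler_pM.
  by move: s1; rewrite ler_norml => /andP[]; lra.
split; first by lra.
set r := (X in _ <= _ * X) in re *.
have -> : cos (a * t) * - (t * sin a) + sin (a * t) * cos a =
  (sin (a * t) - a * t) * cos a + a * t * (cos a - 1)
  - t * ((sin a - a) * cos (a * t)) - t * a * (cos (a * t) - 1) by ring.
have cl x : `|cos x| <= 1 :> R by rewrite ler_norml cos_geN1 cos_le1.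
set u := `|t| * `|a| ^+ 3.
have u0 : 0 <= u by rewrite mulr_ge0// exprn_ge0.
have e1 : `|(sin (a * t) - a * t) * cos a| <= u / 6.
  rewrite normrM -[leRHS]mulr1; apply: ler_pM => //.
  apply: le_trans sat _; rewrite ler_wpM2r// normrM exprMn /u mulrC.
  by rewrite ler_wpM2r ?exprn_ge0// exprS ler_piMr// expr_le1.
have e2 : `|a * t * (cos a - 1)| <= u / 2.
  rewrite !normrM; apply: le_trans (ler_wpM2l _ ca) _; first by rewrite mulr_ge0.
  by rewrite /u -[a ^+ 2]real_normK ?num_real// le_eqVlt; apply/orP; left; apply/eqP; field.
have e3 : `|t * ((sin a - a) * cos (a * t))| <= u / 6.
  rewrite normrM [X in _ * X]normrM /u -mulrA ler_wpM2l//.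
  by rewrite -[leRHS]mulr1; apply: ler_pM.
have e4 : `|t * a * (cos (a * t) - 1)| <= u / 2.
  rewrite !normrM; apply: le_trans (ler_wpM2l _ cat) _; first by rewrite mulr_ge0.
  apply: (@le_trans _ _ (`|t| * `|a| * (a ^+ 2 / 2))).
    by rewrite ler_wpM2l ?mulr_ge0// ler_wpM2r.
  by rewrite /u -[a ^+ 2]real_normK ?num_real// le_eqVlt; apply/orP; left; apply/eqP; field.
have -> : 3 * `|t| * `|a| ^+ 3 * r = u * (3 * r) by rewrite /u; ring.
apply: (@le_trans _ _ (u * (3 / 2))); last first.
  by rewrite ler_wpM2l//; move: (re : 1 / 2 <= r); clearbody r; clear; lra.
apply: le_trans (ler_normB _ _) _.
apply: (@le_trans _ _ ((u / 6 + u / 2) + u / 6 + u / 2)); last by lra.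
apply: lerD => //; apply: le_trans (ler_normB _ _) _; apply: lerD => //.
by apply: le_trans (ler_normD _ _) _; apply: lerD.
Qed.

End TiltedFactor.

(** * Subset sums by Fourier inversion on a grid *)

Section TiltedTransform.
Context {R : realType} {m n : nat}.
Variables (w : 'I_n -> 'cV[int]_m) (v : 'cV[int]_m) (t : 'I_n -> R).
Local Open Scope complex_scope.
Local Notation C := (complex R).
Local Notation "x ^R" := (map_mx intr x : 'cV[R]_m) (at level 2).

Definition subset_sum (e : {ffun 'I_n -> bool}) : 'cV[int]_m := \sum_j w j *+ e j.

(** The law of the choice of [w j] when the sign [1 - 2 e j] has mean [t j]. *)
Definition tilt (j : 'I_n) (b : bool) : R := if b then (1 - t j) / 2 else (1 + t j) / 2.

(** The characteristic function of the random subset sum, recentred at the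
    target [v]. *)
Definition tilted_transform (phi : 'cV[R]_m) : C :=
  \sum_(e : {ffun 'I_n -> bool})
    (\prod_j tilt j (e j))%:C * cis (2 * pi * dot phi (subset_sum e - v)^R).

(** The mean of the random subset sum is [v]. *)
Hypothesis balanced : \sum_j ((1 - t j) / 2) *: (w j)^R = v^R.

Lemma map_intr_sum (I : Type) (r : seq I) (F : I -> 'cV[int]_m) :
  (\sum_(i <- r) F i)^R = \sum_(i <- r) (F i)^R.
Proof. exact: raddf_sum. Qed.

(** The elements are chosen independently; as the mean is [v], the
    recentring can be distributed over the factors, each of which becomes
    centred. *)
Lemma tilted_transformE phi : tilted_transform phi =
  \prod_j tilted_factor (pi * dot phi (w j)^R) (t j).
Proof.
pose G (j : 'I_n) (b : bool) : C := (tilt j b)%:C *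
  cis (2 * pi * (dot phi (w j)^R * (b%:R - (1 - t j) / 2))).
transitivity (\prod_j \sum_b G j b); last first.
  apply: eq_bigr => j _; rewrite big_bool [LHS]addrC tilted_factorE /G /tilt.
  by rewrite mulr0n mulr1n; congr (_ * cis _ + _ * cis _); field.
rewrite bigA_distr_bigA; apply: eq_bigr => e _.
rewrite big_split/= rmorph_prod -cis_sum; congr (_ * cis _).
rewrite -mulr_sumr; congr (_ * _).
have -> : (subset_sum e - v)^R = \sum_j ((e j)%:R - (1 - t j) / 2) *: (w j)^R.
  under eq_bigr do rewrite scalerBl.
  rewrite sumrB balanced map_mxB map_intr_sum; congr (_ - _).
  by apply: eq_bigr => j _; rewrite scaler_nat raddfMn.
by rewrite dot_sumr; apply: eq_bigr => j _; rewrite dotZr mulrC.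
Qed.

(** The subset sums are integral, so that a grid point may be moved close to the
    origin by an integer vector before its factors are estimated. *)
Lemma tilted_transform_periodic phi (zeta : 'cV[int]_m) :
  tilted_transform (phi - zeta^R) = tilted_transform phi.
Proof.
apply: eq_bigr => e _; congr (_ * _).
set k := subset_sum e - v.
have [a aE] : exists a : int, dot zeta^R k^R = a%:~R.
  exists (\sum_i zeta i 0 * k i 0); rewrite /dot rmorph_sum.
  by apply: eq_bigr => i _; rewrite !mxE rmorphM.
rewrite dotBl mulrBr cisD aE.
have -> : cis (- (2 * pi * a%:~R)) = 1 :> C.
  by rewrite -mulrN -mulrNz cis_2pi_int.
by rewrite mulr1.
Qed.

(** If no subset sum equals [v], then every character sum over the grid
    vanishes, hence so does the sum of the transform over the grid. This is
    impossible if the tiny points contribute more than the far ones can cancel,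
    while the other points contribute nonnegatively. *)
Lemma exists_subset_sum (K : nat) (far : pred {ffun 'I_m -> 'I_K})
    (tiny : {set {ffun 'I_m -> 'I_K}}) :
  (forall e i, `|(subset_sum e - v) i 0| < K%:Z) ->
  (forall a, ~~ far a -> 0 <= Re (tilted_transform (grid a))) ->
  (forall a, a \in tiny -> ~~ far a /\ 1 / 2 <= Re (tilted_transform (grid a))) ->
  \sum_(a | far a) normc (tilted_transform (grid a)) < #|tiny|%:R / 2 ->
  exists e, subset_sum e = v.
Proof.
move=> kK near tinyP farP; apply: contrapT => /forallNP nohit.
have sum0 : \sum_(a : {ffun 'I_m -> 'I_K}) tilted_transform (grid a) = 0.
  rewrite exchange_big big1//= => e _; rewrite -mulr_sumr.
  rewrite sum_character_grid ?mulr0 ?subr_eq0//.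
  by apply/eqP; exact: nohit.
have := congr1 (@complex.Re R) sum0; rewrite Re_sum (bigID far)/= => h.
have h1 : - \sum_(a | far a) normc (tilted_transform (grid a)) <=
    \sum_(a | far a) Re (tilted_transform (grid a)).
  rewrite -sumrN; apply: ler_sum => a _.
  by have := Re_le_normc (tilted_transform (grid a)); rewrite ler_norml => /andP[].
have h2 : #|tiny|%:R / 2 <= \sum_(a | ~~ far a) Re (tilted_transform (grid a)).
  rewrite (bigID (mem tiny))/= -[leLHS]addr0; apply: lerD; last first.
    by apply: sumr_ge0 => a /andP[/near].
  rewrite (eq_bigl (mem tiny)); last first.
    move=> a /=; apply: andb_idl => at_; by have [] := tinyP a at_.
  apply: (@le_trans _ _ (\sum_(a in tiny) 1 / 2)).
    by rewrite sumr_const -[_ *+ _]mulr_natr; lra.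
  by apply: ler_sum => a /tinyP[].
lra.
Qed.

End TiltedTransform.

(** * Sample covariance under a finite product measure *)

Section ProductMeasure.
Context {R : realType} {I : finType} (p : I -> R) (n : nat).
Hypothesis p_ge0 : forall i, 0 <= p i.
Hypothesis p_sum1 : \sum_i p i = 1.

Definition prod_weight (f : {ffun 'I_n -> I}) : R := \prod_j p (f j).

Lemma prod_weight_ge0 f : 0 <= prod_weight f.
Proof. by apply: prodr_ge0. Qed.

Lemma expectation_prod (h : 'I_n -> I -> R) :
  \sum_f prod_weight f * \prod_j h j (f j) = \prod_j \sum_i p i * h j i.
Proof.
rewrite bigA_distr_bigA; apply: eq_bigr => f _.
by rewrite /prod_weight -big_split.
Qed.

Lemma prod_weight_sum1 : \sum_f prod_weight f = 1.
Proof.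
transitivity (\prod_(j < n) \sum_i p i * 1).
  rewrite -(expectation_prod (fun _ _ => 1)); apply: eq_bigr => f _.
  by rewrite big1_eq mulr1.
by rewrite big1// => j _; under eq_bigr do rewrite mulr1.
Qed.

(** The mixed terms vanish by independence. *)
Lemma expectation_sqr_sum (h : I -> R) : \sum_i p i * h i = 0 ->
  \sum_f prod_weight f * (\sum_j h (f j)) ^+ 2 = n%:R * \sum_i p i * h i ^+ 2.
Proof.
move=> h0.
have cov (j k : 'I_n) : \sum_f prod_weight f * (h (f j) * h (f k)) =
    (j == k)%:R * \sum_i p i * h i ^+ 2.
  pose g (l : 'I_n) i := (if l == j then h i else 1) * (if l == k then h i else 1).
  transitivity (\prod_(l < n) \sum_i p i * g l i).
    rewrite -expectation_prod; apply: eq_bigr => f _; congr (_ * _).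
    rewrite big_split/= -!big_mkcond/= !big_pred1_eq//.
  have [jk|jk] := eqVneq j k; last first.
    rewrite (bigD1 j)//= [X in X * _ = _](_ : _ = 0) ?mul0r//.
    by rewrite -[RHS]h0; apply: eq_bigr => i _; rewrite /g eqxx (negbTE jk) mulr1.
  rewrite [RHS]mul1r (bigD1 j)//= [X in _ * X]big1 ?mulr1.
    by apply: eq_bigr => i _; rewrite /g -jk eqxx expr2.
  move=> l lj; rewrite -[RHS]p_sum1; apply: eq_bigr => i _.
  by rewrite /g -jk (negbTE lj) !mulr1.
transitivity (\sum_j \sum_k \sum_f prod_weight f * (h (f j) * h (f k))).
  rewrite (eq_bigr (fun f => \sum_j \sum_k prod_weight f * (h (f j) * h (f k)))).
    by rewrite exchange_big; apply: eq_bigr => j _; rewrite exchange_big.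
  move=> f _; rewrite expr2 mulr_suml mulr_sumr; apply: eq_bigr => j _.
  by rewrite mulr_sumr mulr_sumr.
rewrite (eq_bigr (fun=> \sum_i p i * h i ^+ 2)).
  by rewrite sumr_const card_ord mulr_natl.
move=> j _; rewrite (eq_bigr _ (fun k _ => cov j k)) -mulr_suml.
by rewrite (bigD1 j)//= eqxx big1 ?addr0 ?mul1r// => k; rewrite eq_sym => /negbTE ->.
Qed.

Lemma markov_sum (Y : {ffun 'I_n -> I} -> R) (a : R) : 0 < a ->
  (forall f, 0 <= Y f) ->
  \sum_(f | a < Y f) prod_weight f <= (\sum_f prod_weight f * Y f) / a.
Proof.
move=> a0 Y0; rewrite ler_pdivlMr// mulr_suml.
rewrite [leRHS](bigID (fun f => a < Y f))/= -[leLHS]addr0; apply: lerD.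
  by apply: ler_sum => f /ltW aY; rewrite ler_wpM2l ?prod_weight_ge0.
by apply: sumr_ge0 => f _; rewrite mulr_ge0 ?prod_weight_ge0.
Qed.

Context {m : nat} (z : I -> 'cV[R]_m) (L : R).
Hypothesis isotropic :
  forall k l, \sum_i p i * (z i k 0 * z i l 0) = (k == l)%:R.
Hypothesis z_bounded : forall i, p i != 0 -> enorm (z i) <= L.

Lemma expectation_sqr_enorm : \sum_i p i * enorm (z i) ^+ 2 = m%:R.
Proof.
under eq_bigr do rewrite sqr_enorm /dot mulr_sumr.
rewrite exchange_big (eq_bigr (fun=> 1))/=; last first.
  by move=> k _; rewrite isotropic eqxx.
by rewrite sumr_const card_ord.
Qed.

(** The trace of the identity is the mean square length. *)
Lemma dim_le_sqr_radius : m%:R <= L ^+ 2.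
Proof.
rewrite -expectation_sqr_enorm -[leRHS]mul1r -p_sum1 mulr_suml.
apply: ler_sum => i _; have [->|pi0] := eqVneq (p i) 0; first by rewrite !mul0r.
have zL := z_bounded pi0.
by rewrite ler_wpM2l// ler_pXn2r ?nnegrE ?enorm_ge0// (le_trans (enorm_ge0 _) zL).
Qed.

(** [n] times the deviation of the sample covariance matrix from the identity. *)
Definition cov_error (f : {ffun 'I_n -> I}) : 'M[R]_m :=
  \matrix_(k, l) \sum_j (z (f j) k 0 * z (f j) l 0 - (k == l)%:R).

(** The sample covariance matrix concentrates, by Chebyshev's inequality in
    Frobenius norm. *)
Lemma cov_error_tail : (0 < n)%N ->
  \sum_(f | n%:R ^+ 2 / 4 < \sum_k \sum_l cov_error f k l ^+ 2) prod_weight f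
    <= 4 * m%:R * L ^+ 2 / n%:R.
Proof.
move=> n0; have n0R : 0 < n%:R :> R by rewrite ltr0n.
apply: le_trans (markov_sum _ _) _.
- by rewrite divr_gt0// exprn_gt0.
- by move=> f; apply: sumr_ge0 => k _; apply: sumr_ge0 => l _; rewrite sqr_ge0.
suff h : \sum_f prod_weight f * (\sum_k \sum_l cov_error f k l ^+ 2) <=
    n%:R * (L ^+ 2 * m%:R).
  rewrite ler_pdivrMr ?divr_gt0 ?exprn_gt0//; apply: le_trans h _.
  by rewrite le_eqVlt; apply/orP; left; apply/eqP; field; rewrite gt_eqF.
have kl (k l : 'I_m) : \sum_f prod_weight f * cov_error f k l ^+ 2 =
    n%:R * \sum_i p i * (z i k 0 * z i l 0 - (k == l)%:R) ^+ 2.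
  rewrite -expectation_sqr_sum; first by apply: eq_bigr => f _; rewrite mxE.
  under eq_bigr do rewrite mulrBr.
  by rewrite sumrB isotropic -mulr_suml p_sum1 mul1r subrr.
rewrite (eq_bigr (fun f => \sum_k \sum_l prod_weight f * cov_error f k l ^+ 2)); last first.
  by move=> f _; rewrite mulr_sumr; apply: eq_bigr => k _; rewrite mulr_sumr.
rewrite exchange_big/=.
under eq_bigr => k _ do rewrite exchange_big/=.
under eq_bigr => k _ do under eq_bigr => l _ do rewrite kl.
under eq_bigr => k _ do rewrite -mulr_sumr.
rewrite -mulr_sumr ler_pM2l//.
apply: (@le_trans _ _ (\sum_k \sum_l \sum_i p i * (z i k 0 * z i l 0) ^+ 2)).
  apply: ler_sum => k _; apply: ler_sum => l _; rewrite -subr_ge0 -sumrB.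
  have -> : \sum_i (p i * (z i k 0 * z i l 0) ^+ 2 -
      p i * (z i k 0 * z i l 0 - (k == l)%:R) ^+ 2) =
      2 * (k == l)%:R * (\sum_i p i * (z i k 0 * z i l 0)) - (k == l)%:R ^+ 2 * \sum_i p i.
    rewrite !mulr_sumr -sumrB; apply: eq_bigr => i _; ring.
  by rewrite isotropic p_sum1; case: eqP => _; rewrite ?expr0n ?expr1n/=; lra.
apply: (@le_trans _ _ (\sum_i p i * (enorm (z i) ^+ 2) ^+ 2)).
  under eq_bigr => k _ do rewrite exchange_big/=.
  rewrite exchange_big/=; apply: ler_sum => i _.
  rewrite sqr_enorm [in leRHS]/dot expr2 mulr_suml mulr_sumr; apply: ler_sum => k _.
  rewrite !mulr_sumr; apply: ler_sum => l _.
  by rewrite le_eqVlt; apply/orP; left; apply/eqP; ring.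
rewrite -expectation_sqr_enorm mulr_sumr; apply: ler_sum => i _.
have [->|pi0] := eqVneq (p i) 0; first by rewrite !mul0r mulr0.
have zL := z_bounded pi0.
rewrite [leRHS]mulrCA ler_wpM2l// [leLHS]expr2 ler_wpM2r ?sqr_ge0//.
by rewrite ler_pXn2r ?nnegrE ?enorm_ge0// (le_trans (enorm_ge0 _) zL).
Qed.

Lemma ler_enorm_frobenius k l (A : 'M[R]_(k, l)) x :
  enorm (A *m x) ^+ 2 <= (\sum_i \sum_j A i j ^+ 2) * enorm x ^+ 2.
Proof.
rewrite !sqr_enorm {1}/dot mulr_suml; apply: ler_sum => i _.
have -> : (A *m x) i 0 = dot (row i A)^T x.
  by rewrite mxE; apply: eq_bigr => j _; rewrite !mxE.
rewrite -expr2; apply: le_trans (cauchy_schwarz _ _) _; rewrite ler_wpM2r ?dot_ge0//.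
by rewrite le_eqVlt; apply/orP; left; apply/eqP; apply: eq_bigr => j _; rewrite !mxE expr2.
Qed.

Lemma sample_covariance (f : {ffun 'I_n -> I}) :
  \sum_k \sum_l cov_error f k l ^+ 2 <= n%:R ^+ 2 / 4 -> forall x,
  n%:R / 2 * enorm x ^+ 2 <= \sum_j dot x (z (f j)) ^+ 2 <=
  3 / 2 * n%:R * enorm x ^+ 2.
Proof.
move=> hf x.
have Ex : dot x (cov_error f *m x) = \sum_j dot x (z (f j)) ^+ 2 - n%:R * enorm x ^+ 2.
  have -> : cov_error f = \sum_j z (f j) *m (z (f j))^T - n%:R%:M.
    apply/matrixP => k l; rewrite !mxE summxE.
    rewrite sumrB; congr (_ - _).
      by apply: eq_bigr => j _; rewrite !mxE big_ord1 mxE.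
    by rewrite sumr_const card_ord; case: eqP; rewrite ?mulr1n ?mulr0n ?mul0rn.
  rewrite mulmxBl mul_scalar_mx dotBr dotZr sqr_enorm; congr (_ - _).
  rewrite mulmx_suml dot_sumr; apply: eq_bigr => j _.
  rewrite -mulmxA [_^T *m x]mx11_scalar mul_mx_scalar dotZr -dotE.
  by rewrite (dotC (z _)) expr2.
have : `|dot x (cov_error f *m x)| <= n%:R / 2 * enorm x ^+ 2.
  apply: le_trans (ler_dot _ _) _; rewrite mulrC expr2 mulrA ler_wpM2r ?enorm_ge0//.
  rewrite -(@ler_pXn2r _ 2)// ?nnegrE ?mulr_ge0 ?enorm_ge0//.
  apply: le_trans (ler_enorm_frobenius _ _) _; rewrite exprMn ler_wpM2r ?sqr_ge0//.
  apply: le_trans hf _.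
  by rewrite le_eqVlt; apply/orP; left; apply/eqP; field.
rewrite Ex ler_norml => /andP[h1 h2]; apply/andP; split; lra.
Qed.

End ProductMeasure.

(** * Products of tilted factors at low frequencies *)

Section TiltedProducts.
Context {R : realType} {n : nat}.
Variables (x t : 'I_n -> R) (s : R).
Hypothesis s_ge0 : 0 <= s.
Hypothesis s_small : 96 * (96 * s) <= 1.
Hypothesis x_le : forall j, `|x j| <= 2 * s.
Hypothesis t_le : forall j, `|t j| <= 2 * s ^+ 2.
Hypothesis sum_x : s ^+ 2 * \sum_j x j ^+ 2 <= 6.

Let P := \prod_j tilted_factor (pi * x j) (t j).

Lemma pi_lt4 : pi < 4 :> R.
Proof. by have := @pihalf_lt2 R; lra. Qed.

Lemma normr_pi_mul (y : R) : `|pi * y| <= 4 * `|y|.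
Proof. by rewrite normrM (ger0_norm (@pi_ge0 R)) ler_wpM2r// ltW// pi_lt4. Qed.

(** The slopes of the factors are at most of order [s^2 s x_j^2], so that they sum
    up to a multiple of [s], because the [x_j^2] sum up to [6 / s^2] at most. *)
Lemma tilted_prod_sector : 0 <= Re P /\ `|Im P| <= Re P.
Proof.
have h0 := s_ge0; have hs := s_small.
have s2 : s ^+ 2 <= s by rewrite expr2 ler_piMr//; lra.
have tj j : `|t j| <= 1 by apply: le_trans (t_le j) _; lra.
have xj j : `|pi * x j| <= 1 / 2.
  by apply: le_trans (normr_pi_mul _) _; have := x_le j; lra.
pose eta j := 3 * `|t j| * `|pi * x j| ^+ 3.
have eta0 j : 0 <= eta j by rewrite !mulr_ge0// exprn_ge0.
have etaS : \sum_j eta j <= 1 / 2.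
  apply: (@le_trans _ _ (\sum_j 48 * 16 * s ^+ 3 * x j ^+ 2)).
    apply: ler_sum => j _; rewrite /eta exprS.
    have -> : 48 * 16 * s ^+ 3 * x j ^+ 2 = 3 * (2 * s ^+ 2) * ((8 * s) * (16 * `|x j| ^+ 2)).
      by rewrite real_normK ?num_real//; ring.
    apply: ler_pM.
    - by rewrite mulr_ge0.
    - by rewrite mulr_ge0 ?exprn_ge0.
    - by rewrite ler_wpM2l.
    apply: ler_pM => //.
      by apply: le_trans (normr_pi_mul _) _; have := x_le j; lra.
    have -> : 16 * `|x j| ^+ 2 = (4 * `|x j|) ^+ 2 by ring.
    by rewrite ler_pXn2r ?nnegrE ?mulr_ge0// normr_pi_mul.
  rewrite -mulr_sumr.
  have -> : 48 * 16 * s ^+ 3 * \sum_j x j ^+ 2 = 48 * 16 * s * (s ^+ 2 * \sum_j x j ^+ 2) by ring.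
  apply: (@le_trans _ _ (48 * 16 * s * 6)); last by lra.
  by rewrite ler_wpM2l// mulr_ge0.
have [re im] := prod_sector eta0 (fun j => tilted_factor_sector (tj j) (xj j)) etaS.
split=> //; apply: le_trans im _; rewrite ler_piMl//.
by move: etaS; rewrite -/P; set S := \sum_j eta j; lra.
Qed.

Lemma subr_sum_le_prod (r : seq 'I_n) (u : 'I_n -> R) :
  (forall j, 0 <= u j <= 1) ->
  1 - \sum_(j <- r) u j <= \prod_(j <- r) (1 - u j) <= 1.
Proof.
move=> u01; elim: r => [|j r /andP[h1 h2]]; first by rewrite !big_nil subr0 lexx.
rewrite !big_cons; have /andP[u0 u1] := u01 j.
have h3 : 0 <= \prod_(i <- r) (1 - u i).
  by apply: prodr_ge0 => i _; rewrite subr_ge0; case/andP: (u01 i).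
move: h1 h2 h3; set p := \prod_(i <- r) _; set S := \sum_(i <- r) _ => h1 h2 h3.
have h4 : u j * p <= u j by rewrite ler_piMr.
have h5 : 0 <= u j * p by rewrite mulr_ge0.
by rewrite mulrBl mul1r; apply/andP; split; lra.
Qed.

(** The modulus is close to 1, since it is governed by the sum of the [x_j^2], and
    the product lies in the sector of slope 1. *)
Lemma tilted_prod_tiny : \sum_j x j ^+ 2 <= 1 / 32 -> 1 / 2 <= Re P.
Proof.
move=> xS; have [re im] := tilted_prod_sector.
have tj j : t j ^+ 2 <= 1.
  rewrite -real_normK ?num_real// expr_le1// (le_trans (t_le j))//.
  have h0 := s_ge0; have hs := s_small.
  have s2 : s ^+ 2 <= s by rewrite expr2 ler_piMr//; lra.
  lra.
have s1 (y : R) : sin y ^+ 2 <= 1 by have := cos2Dsin2 y; have := sqr_ge0 (cos y); lra.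
have h : 1 / 2 <= normc P ^+ 2.
  rewrite normc_prod -prodrXl.
  under eq_bigr do rewrite sqr_normc_tilted_factor.
  have := @subr_sum_le_prod (index_enum _) (fun j => (1 - t j ^+ 2) * sin (pi * x j) ^+ 2).
  have b j : 0 <= (1 - t j ^+ 2) * sin (pi * x j) ^+ 2 <= sin (pi * x j) ^+ 2.
    rewrite mulr_ge0 ?sqr_ge0 ?subr_ge0//= ler_piMl ?sqr_ge0//.
    by rewrite lerBlDr lerDl sqr_ge0.
  case/(_ _)/andP => [j|+ _]; first by have /andP[-> /le_trans ->] := b j.
  apply: le_trans.
  have : \sum_j (1 - t j ^+ 2) * sin (pi * x j) ^+ 2 <= \sum_j 16 * x j ^+ 2.
    apply: ler_sum => j _; have /andP[_ h] := b j; apply: le_trans h _.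
    have := le_trans (normr_sin_le _) (normr_pi_mul (x j)).
    rewrite -(@ler_pXn2r _ 2)// ?nnegrE ?mulr_ge0// real_normK ?num_real// exprMn.
    by rewrite real_normK ?num_real// => /le_trans -> //; lra.
  by rewrite -mulr_sumr; lra.
move: h; rewrite sqr_normc => h.
have : Im P ^+ 2 <= Re P ^+ 2.
  by rewrite -(@real_normK _ (Im P)) ?num_real// ler_pXn2r ?nnegrE.
move=> h2; rewrite -(@ler_pXn2r _ 2)// ?nnegrE//.
have -> : (1 / 2) ^+ 2 = 1 / 4 :> R by field.
lra.
Qed.

End TiltedProducts.

(** * A deterministic criterion for reaching a target *)

Section DeterministicHit.
Context {R : realType} {m n : nat}.
Local Notation "x ^R" := (map_mx intr x : 'cV[R]_m) (at level 2).

Lemma gram_sum_mulmx (z : 'I_n -> 'cV[R]_m) x :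
  (\sum_j z j *m (z j)^T) *m x = \sum_j dot (z j) x *: z j.
Proof.
rewrite mulmx_suml; apply: eq_bigr => j _.
by rewrite -mulmxA [_^T *m x]mx11_scalar mul_mx_scalar -dotE.
Qed.

(** The tilts are the least norm solution [t_j = dot (z j) (G^-1 l)], where [G] is
    the Gram matrix, which is at least [n / 2] times the identity. *)
Lemma tilt_exists (z : 'I_n -> 'cV[R]_m) (L : R) (l : 'cV[R]_m) : (0 < n)%N ->
  (forall x, n%:R / 2 * enorm x ^+ 2 <= \sum_j dot x (z j) ^+ 2) ->
  (forall j, enorm (z j) <= L) ->
  exists2 t : 'I_n -> R, \sum_j t j *: z j = l &
    forall j, `|t j| <= L * (2 * enorm l / n%:R).
Proof.
move=> n0 zlow zL; have n0R : 0 < n%:R :> R by rewrite ltr0n.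
pose G := \sum_j z j *m (z j)^T.
have dotG x : dot x (G *m x) = \sum_j dot x (z j) ^+ 2.
  rewrite gram_sum_mulmx dot_sumr; apply: eq_bigr => j _.
  by rewrite dotZr (dotC (z j)) expr2.
have uG : G \in unitmx.
  apply: inj_unitmx => x Gx; apply: enorm_eq0; apply/eqP; rewrite -sqrf_eq0.
  have := zlow x; rewrite -dotG Gx dot0r pmulr_rle0 ?divr_gt0// => h.
  by rewrite eq_le h sqr_ge0.
pose x := invmx G *m l; exists (fun j => dot (z j) x) => [|j].
  by rewrite -gram_sum_mulmx -/G mulKVmx.
apply: le_trans (ler_dot _ _) _; apply: ler_pM; rewrite ?enorm_ge0//.
have [x0|x0] := eqVneq (enorm x) 0; first by rewrite x0 divr_ge0 ?mulr_ge0 ?enorm_ge0 ?ler0n.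
have xp : 0 < enorm x by rewrite lt_def x0 enorm_ge0.
have : n%:R / 2 * enorm x ^+ 2 <= enorm x * enorm l.
  by apply: le_trans (zlow x) _; rewrite -dotG mulKVmx// (le_trans (ler_norm _))// ler_dot.
rewrite expr2 mulrCA ler_pM2l// => h; rewrite ler_pdivlMr//; lra.
Qed.

Variables (U : 'M[R]_m) (L s : R) (K : nat) (w : 'I_n -> 'cV[int]_m)
  (v : 'cV[int]_m).
Let A := (invmx U)^T.
Let z j := U *m (w j)^R.
Hypotheses (uU : U \in unitmx) (L_gt0 : 0 < L) (n_gt0 : (0 < n)%N)
  (s_gt0 : 0 < s) (s_small : 96 * (96 * s) <= 1)
  (sE : s ^+ 2 = L / Num.sqrt n%:R).
Hypothesis z_le : forall j, enorm (z j) <= L.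
Hypothesis z_cov : forall x, n%:R / 2 * enorm x ^+ 2 <= \sum_j dot x (z j) ^+ 2 <=
  3 / 2 * n%:R * enorm x ^+ 2.
Hypothesis v_near : enorm (U *m (\sum_j w j - v *+ 2)^R) <= Num.sqrt n%:R.

(** [A] maps the integer vectors onto the dual of the lattice generated by the
    columns of [U], so this says that the whitened frequency of a grid point has
    distance more than [r] from each dual vector. *)
Definition far_from_integers (r : R) (a : {ffun 'I_m -> 'I_K}) : bool :=
  `[< forall zeta : 'cV[int]_m, r < enorm (A *m (grid a - zeta^R)) >].

Variable tiny : {set {ffun 'I_m -> 'I_K}}.
Hypothesis K_large : forall x,
  enorm (U *m x) <= Num.sqrt n%:R + n%:R * L -> enorm x < K%:R.
Hypothesis tinyP : forall a, a \in tiny -> exists zeta : 'cV[int]_m,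
  enorm (A *m (grid a - zeta^R)) <= (8 * Num.sqrt n%:R)^-1.
Hypothesis far_small :
  \sum_(a | far_from_integers (2 * s / L) a)
    \prod_j expR (- (mod1 (dot (grid a) (w j)^R) ^+ 2 / 6)) < #|tiny|%:R / 2.

Lemma dot_dual phi y : dot phi y = dot (A *m phi) (U *m y).
Proof.
by rewrite dot_mulmx mulmxA -trmx_mul mulVmx// trmx1 mul1mx.
Qed.

(** All the deterministic estimates combined. The parameter [s] is
    [sqrt (L / sqrt n)]: a frequency at distance at most [2 s / L] from the dual
    lattice is seen as at most [2 s] by each column, since [z j] has length at
    most [L], and the tilts are at most [2 L / sqrt n = 2 s^2]. *)
Lemma subset_sum_of_near : exists e, subset_sum w e = v.
Proof.
have n0R : 0 < n%:R :> R by rewrite ltr0n.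
have sn0 : 0 < Num.sqrt n%:R :> R by rewrite sqrtr_gt0.
have snE : Num.sqrt n%:R ^+ 2 = n%:R :> R by rewrite sqr_sqrtr ?ler0n.
pose l := U *m (\sum_j w j - v *+ 2)^R; have l_le : enorm l <= Num.sqrt n%:R by [].
have [t tE tle] := tilt_exists l n_gt0 (fun x => proj1 (andP (z_cov x))) z_le.
have t_le j : `|t j| <= 2 * s ^+ 2.
  apply: le_trans (tle j) _.
  have -> : 2 * s ^+ 2 = L * (2 * Num.sqrt n%:R / n%:R).
    by rewrite sE; set rn := Num.sqrt _ in sn0 snE *; rewrite -snE; field; rewrite gt_eqF.
  by rewrite ler_pM2l// ler_pM2r ?invr_gt0// ler_pM2l.
have balanced : \sum_j ((1 - t j) / 2) *: (w j)^R = v^R.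
  have : U *m (\sum_j t j *: (w j)^R) = U *m (\sum_j w j - v *+ 2)^R.
    rewrite -[RHS]/l -tE mulmx_sumr; apply: eq_bigr => j _.
    by rewrite -scalemxAr.
  move=> /(congr1 (mulmx (invmx U))); rewrite !mulKmx// map_mxB map_intr_sum => h.
  under eq_bigr do rewrite mulrBl scalerBl.
  rewrite sumrB.
  have -> : \sum_j (t j / 2) *: (w j)^R = 2^-1 *: (\sum_j t j *: (w j)^R).
    by rewrite scaler_sumr; apply: eq_bigr => j _; rewrite scalerA mulrC.
  rewrite h scalerBr -scaler_sumr mul1r opprB addrC subrK.
  have -> : (v *+ 2)^R = 2 *: v^R by rewrite scaler_nat raddfMn.
  by rewrite scalerA mulVf ?scale1r.
have s0 := ltW s_gt0; have L0 := ltW L_gt0.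
have r0 : 0 <= 2 * s / L by rewrite divr_ge0// mulr_ge0.
have near (a : {ffun 'I_m -> 'I_K}) (zeta : 'cV[int]_m) :
    enorm (A *m (grid a - zeta^R)) <= 2 * s / L ->
    let x j := dot (grid a - zeta^R) (w j)^R in
    [/\ tilted_transform w v t (grid a) = \prod_j tilted_factor (pi * x j) (t j),
      forall j, `|x j| <= 2 * s,
      s ^+ 2 * \sum_j x j ^+ 2 <= 6 &
      \sum_j x j ^+ 2 <= 3 / 2 * n%:R * enorm (A *m (grid a - zeta^R)) ^+ 2].
  set th := A *m _ => thr x.
  have xE j : x j = dot th (z j) by exact: dot_dual.
  have x2 : \sum_j x j ^+ 2 <= 3 / 2 * n%:R * enorm th ^+ 2.
    by under eq_bigr do rewrite xE; have /andP[] := z_cov th.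
  split => //.
  - by rewrite -(tilted_transform_periodic w v t (grid a) zeta) tilted_transformE.
  - move=> j; rewrite xE; apply: le_trans (ler_dot _ _) _.
    apply: (@le_trans _ _ (2 * s / L * L)); last by rewrite divfK// gt_eqF.
    by apply: ler_pM; rewrite ?enorm_ge0.
  apply: le_trans (ler_wpM2l (sqr_ge0 s) x2) _.
  apply: (@le_trans _ _ (s ^+ 2 * (3 / 2 * n%:R * (2 * s / L) ^+ 2))).
    rewrite ler_wpM2l ?sqr_ge0// ler_wpM2l ?mulr_ge0 ?ler0n//.
    by rewrite ler_pXn2r// ?nnegrE ?enorm_ge0.
  have -> : s ^+ 2 * (3 / 2 * n%:R * (2 * s / L) ^+ 2) =
      6 * n%:R * (s ^+ 2) ^+ 2 / L ^+ 2 by field; rewrite gt_eqF.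
  rewrite sE; set rn := Num.sqrt _ in sn0 snE *; rewrite -snE.
  by rewrite le_eqVlt; apply/orP; left; apply/eqP; field; rewrite !gt_eqF.
have nfar a : ~~ far_from_integers (2 * s / L) a -> exists zeta : 'cV[int]_m,
    enorm (A *m (grid a - zeta^R)) <= 2 * s / L.
  move=> /asboolPn/existsNP[zeta /negP]; rewrite -leNgt => h; by exists zeta.
have t_le2 j : `|t j| <= 1 / 2.
  apply: le_trans (t_le j) _.
  have s2 : s ^+ 2 <= s by rewrite expr2 ler_piMr//; have := s_small; lra.
  by have := s_small; lra.
apply: (@exists_subset_sum R m n w v t K (far_from_integers (2 * s / L)) tiny).
- move=> e i.
  rewrite -(ltr_int R) intr_norm.
  have -> : ((subset_sum w e - v) i 0)%:~R = ((subset_sum w e - v)^R) i 0 by rewrite [RHS]mxE.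
  apply: le_lt_trans (ler_coord_enorm _ _) _; rewrite -pmulrn; apply: K_large.
  have -> : U *m (subset_sum w e - v)^R =
      2^-1 *: l + \sum_j ((e j)%:R - 2^-1) *: z j.
    have -> : l = U *m (\sum_j (w j)^R) - 2 *: (U *m v^R).
      by rewrite /l map_mxB map_intr_sum mulmxBr scalemxAr scaler_nat raddfMn.
    have -> : \sum_j ((e j)%:R - 2^-1) *: z j =
        U *m (subset_sum w e)^R - 2^-1 *: (U *m (\sum_j (w j)^R)).
      rewrite map_intr_sum !mulmx_sumr scaler_sumr -sumrB; apply: eq_bigr => j _.
      have -> : (w j *+ e j)^R = (e j)%:R *: (w j)^R by rewrite scaler_nat raddfMn.
      by rewrite scalerBl /z -scalemxAr.
    rewrite map_mxB mulmxBr; move: (U *m _) (U *m _) (U *m _) => c b a.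
    by rewrite scalerBr scalerA mulVf// scale1r [RHS]addrC addrA subrK.
  apply: le_trans (ler_enormD _ _) _; apply: lerD.
    rewrite enormZ gtr0_norm// (le_trans _ l_le)// ler_piMl ?enorm_ge0//.
    by rewrite invf_le1// ler1n.
  apply: le_trans (ler_enorm_sum _ _ _) _.
  apply: (@le_trans _ _ (\sum_(j < n) L)); last by rewrite sumr_const card_ord mulr_natl.
  apply: ler_sum => j _; rewrite enormZ -[leRHS]mul1r; apply: ler_pM; rewrite ?enorm_ge0//.
  by case: (e j); rewrite /= ler_norml; apply/andP; split; lra.
- move=> a /nfar[zeta /near[-> x1 x2 _]].
  by have [] := tilted_prod_sector s0 s_small x1 t_le x2.
- move=> a at_; have [zeta zh] := tinyP at_.
  have zr : enorm (A *m (grid a - zeta^R)) <= 2 * s / L.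
    apply: le_trans zh _.
    have -> : (8 * Num.sqrt n%:R)^-1 = s ^+ 2 / L / 8 :> R.
      by rewrite sE; field; rewrite !gt_eqF.
    have s2 : s ^+ 2 <= s by rewrite expr2 ler_piMr//; have := s_small; lra.
    rewrite mulrAC ler_pM2r ?invr_gt0//; lra.
  split; first by apply/asboolPn => /(_ zeta); rewrite ltNge zr.
  have [-> x1 x2 x3] := near a zeta zr.
  apply: (tilted_prod_tiny s0 s_small x1 t_le x2); apply: le_trans x3 _.
  apply: (@le_trans _ _ (3 / 2 * n%:R * (8 * Num.sqrt n%:R)^-1 ^+ 2)).
    rewrite ler_wpM2l ?mulr_ge0 ?ler0n//.
    by rewrite ler_pXn2r// ?nnegrE ?enorm_ge0// invr_ge0 mulr_ge0// ltW.
  set rn := Num.sqrt _ in sn0 snE *; rewrite -snE.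
  have -> : 3 / 2 * rn ^+ 2 * (8 * rn)^-1 ^+ 2 = 3 / 128 by field; rewrite gt_eqF.
  lra.
apply: le_lt_trans far_small; apply: ler_sum => a _.
rewrite tilted_transformE// normc_prod; apply: ler_prod => j _.
by rewrite normc_ge0 normc_tilted_factor_le.
Qed.

End DeterministicHit.

(** * Subset sums of random integer vectors *)

Section TinyGridPoints.
Context {R : realType} {m : nat}.
Local Notation "x ^R" := (map_mx intr x : 'cV[R]_m) (at level 2).

Definition residue (K : nat) (x : 'cV[int]_m) : {ffun 'I_m -> 'I_K.+1} :=
  [ffun i => inord (absz (modz (x i 0) K.+1%:Z))].

Lemma residueE K x i : (residue K x i : nat)%:Z = (modz (x i 0) K.+1%:Z).
Proof.
have r0 : 0 <= (modz (x i 0) K.+1%:Z) by rewrite modz_ge0.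
rewrite ffunE inordK ?gez0_abs// -ltz_nat gez0_abs//.
by have := @ltz_pmod (x i 0) K.+1%:Z; apply.
Qed.

Lemma grid_residue K x : exists zeta : 'cV[int]_m,
  grid (residue K x) - zeta^R = K.+1%:R^-1 *: x^R.
Proof.
exists (- \col_i (divz (x i 0) K.+1%:Z)); apply/matrixP => i j; rewrite ord1 !mxE.
have -> : (residue K x i : nat)%:R = ((modz (x i 0) K.+1%:Z))%:~R :> R.
  by rewrite -residueE pmulrn.
rewrite mulrNz opprK [in RHS](divz_eq (x i 0) K.+1%:Z).
move: (divz _ _) (modz _ _) => a b; rewrite intrD intrM -pmulrn.
have : K.+1%:R != 0 :> R by rewrite pnatr_eq0.
by move: (K.+1%:R) => k k0; field.
Qed.

(** The grid points close to an integer point are the residues modulo [K] of the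
    integer vectors in a large ellipsoid. By the hypothesis on short vectors,
    different vectors in the ellipsoid have different residues. *)
Lemma tiny_grid_points (A : 'M[R]_m) (h K0 : R) : (0 < m)%N -> A \in unitmx ->
  0 < h ->
  (forall y : 'cV[int]_m, enorm (A *m y^R) <= 2 * h -> y = 0) ->
  exists (K : nat) (tiny : {set {ffun 'I_m -> 'I_K.+1}}),
  [/\ K0 < K.+1%:R,
    forall a, a \in tiny -> exists zeta : 'cV[int]_m,
      enorm (A *m (grid a - zeta^R)) <= h &
    (K.+1%:R * h / Num.sqrt m%:R) ^+ m <= #|tiny|%:R * `|\det A|].
Proof.
move=> m0 uA h0 sep; have [T0 HT] := lattice_point_count uA.
have sm0 : 0 < Num.sqrt m%:R :> R by rewrite sqrtr_gt0 ltr0n.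
pose K := Num.truncn (Num.max K0 (T0 * Num.sqrt m%:R / h)).
have KS : Num.max K0 (T0 * Num.sqrt m%:R / h) < K.+1%:R by exact: truncnS_gt.
move: KS; rewrite gt_max => /andP[KK0 KT].
have [|l [ul lP sl]] := HT (K.+1%:R * h / Num.sqrt m%:R).
  by rewrite ler_pdivlMr// -ler_pdivrMr// ltW.
have Ax x : x \in l -> enorm (A *m (K.+1%:R^-1 *: x^R)) <= h.
  move=> /lP; rewrite -scalemxAr enormZ gtr0_norm ?invr_gt0// ler_pdivrMl//.
  have -> : m%:R * (K.+1%:R * h / Num.sqrt m%:R) ^+ 2 = (K.+1%:R * h) ^+ 2.
    by rewrite expr_div_n sqr_sqrtr// mulrC divfK// pnatr_eq0 -lt0n.
  by rewrite ler_pXn2r// nnegrE ?enorm_ge0// mulr_ge0// ltW.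
have res_inj : {in l &, injective (residue K)}.
  move=> x y xl yl xy; apply/eqP; rewrite -subr_eq0.
  pose d : 'cV[int]_m := \col_i ((divz (x i 0) K.+1%:Z) - (divz (y i 0) K.+1%:Z)).
  have xyd : x - y = d *+ K.+1.
    apply/matrixP => i j; rewrite ord1 mulmxnE !mxE.
    have := residueE K x i; rewrite xy residueE => e.
    rewrite {1}(divz_eq (x i 0) K.+1%:Z) {1}(divz_eq (y i 0) K.+1%:Z) e.
    by rewrite -mulr_natr natz; ring.
  rewrite xyd (sep d) ?mul0rn//.
  have -> : d^R = K.+1%:R^-1 *: x^R - K.+1%:R^-1 *: y^R.
    rewrite -scalerBr -map_mxB xyd.
    have -> : (d *+ K.+1)^R = K.+1%:R *: d^R by rewrite scaler_nat raddfMn.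
    by rewrite scalerA mulVf ?scale1r// pnatr_eq0.
  rewrite mulmxBr; apply: le_trans (ler_enormB _ _) _.
  have := Ax x xl; have := Ax y yl; lra.
exists K, [set a in [seq residue K x | x <- l]]; split => //.
  move=> a; rewrite inE => /mapP[x xl ->].
  by have [zeta xE] := grid_residue K x; exists zeta; rewrite xE; exact: Ax.
suff -> : #|[set a in [seq residue K x | x <- l]]| = size l by [].
by rewrite cardsE (card_uniqP _) ?size_map// map_inj_in_uniq.
Qed.

End TinyGridPoints.

Lemma int_norm_lt1 (k : int) : `|k| < 1 -> k = 0.
Proof. lia. Qed.

Section RandomSubsetSums.
Context {R : realType} {m n : nat} {I : finType}.
Variables (p : I -> R) (w : I -> 'cV[int]_m) (U : 'M[R]_m) (L : R).
Local Notation "x ^R" := (map_mx intr x : 'cV[R]_m) (at level 2).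
Let A := (invmx U)^T.
Let z i := U *m (w i)^R.
Let q := Num.sqrt n%:R / L.
Hypotheses (p_ge0 : forall i, 0 <= p i) (p_sum1 : \sum_i p i = 1).
Hypothesis isotropic :
  forall k l, \sum_i p i * (z i k 0 * z i l 0) = (k == l)%:R.
Hypothesis z_bounded : forall i, p i != 0 -> enorm (z i) <= L.
Hypotheses (uU : U \in unitmx) (L_gt0 : 0 < L) (m_gt0 : (0 < m)%N) (n_gt0 : (0 < n)%N).
Hypotheses (q_big : 96 ^+ 4 <= q) (q_dim : m%:R <= q)
  (q_ln : 96 * (2 * m%:R * ln n%:R + `|ln `|\det U| |) <= q).
Let s := Num.sqrt q^-1.
Hypothesis spread : forall phi : 'cV[R]_m,
  (forall zeta : 'cV[int]_m, 2 * s / L < enorm (A *m (phi - zeta^R))) ->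
  q / 4 <= n%:R * \sum_i p i * mod1 (dot phi (w i)^R) ^+ 2.

Lemma expRN_le (u : R) : 0 <= u <= 1 -> expR (- u) <= 1 - u / 2.
Proof.
move=> /andP[u0 u1]; rewrite expRN.
have h : 0 < 1 + u by lra.
apply: (@le_trans _ _ (1 + u)^-1).
  by rewrite lef_pV2 ?posrE ?expR_gt0// expR_ge1Dx.
rewrite -[_^-1]mul1r ler_pdivrMr//.
have : 0 <= u * (1 - u) by rewrite mulr_ge0// subr_ge0.
lra.
Qed.

(** The columns are independent, so the expectation of the product is a power, and
    [1 - u / 2] bounds [exp (- u)] on the unit interval. *)
Lemma far_expectation (K : nat) (far : pred {ffun 'I_m -> 'I_K}) :
  (forall a, far a -> q / 4 <= n%:R * \sum_i p i * mod1 (dot (grid a) (w i)^R) ^+ 2) ->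
  \sum_(f : {ffun 'I_n -> I}) prod_weight p f * (\sum_(a | far a)
     \prod_j expR (- (mod1 (dot (grid a) (w (f j))^R) ^+ 2 / 6))) <=
  K%:R ^+ m * expR (- (q / 48)).
Proof.
move=> farP.
rewrite (eq_bigr (fun f => \sum_(a | far a) prod_weight p f *
  \prod_j expR (- (mod1 (dot (grid a) (w (f j))^R) ^+ 2 / 6)))); last first.
  by move=> f _; rewrite mulr_sumr.
rewrite exchange_big/=.
apply: (@le_trans _ _ (\sum_(a | far a) expR (- (q / 48)))); last first.
  rewrite sumr_const -[_ *+ _]mulr_natl ler_wpM2r ?expR_ge0//.
  by rewrite -natrX ler_nat (leq_trans (max_card _))// card_ffun !card_ord.
apply: ler_sum => a fa.
rewrite (expectation_prod p (fun _ i => expR (- (mod1 (dot (grid a) (w i)^R) ^+ 2 / 6)))).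
rewrite prodr_const card_ord.
set S := \sum_i p i * mod1 (dot (grid a) (w i)^R) ^+ 2.
have h : \sum_i p i * expR (- (mod1 (dot (grid a) (w i)^R) ^+ 2 / 6)) <= expR (- (S / 12)).
  apply: (@le_trans _ _ (1 - S / 12)); last by have := expR_ge1Dx (- (S / 12)); lra.
  have -> : 1 - S / 12 = \sum_i p i * (1 - mod1 (dot (grid a) (w i)^R) ^+ 2 / 6 / 2).
    under eq_bigr do rewrite mulrBr mulr1.
    by rewrite sumrB p_sum1 /S mulr_suml; congr (_ - _); apply: eq_bigr => i _; field.
  apply: ler_sum => i _.
  have b : 0 <= mod1 (dot (grid a) (w i)^R) ^+ 2 / 6 <= 1.
    have := mod1_itv (dot (grid a) (w i)^R).
    rewrite -(@ler_pXn2r _ 2)// ?nnegrE// real_normK ?num_real//.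
    have -> : (1 / 2) ^+ 2 = 1 / 4 :> R by field.
    by have := sqr_ge0 (mod1 (dot (grid a) (w i)^R)) => *; apply/andP; split; lra.
  by apply: ler_wpM2l => //; exact: expRN_le.
apply: le_trans (lerXn2r n _ _ h) _; rewrite ?nnegrE ?expR_ge0//.
  by apply: sumr_ge0 => i _; rewrite mulr_ge0 ?expR_ge0.
by rewrite -expRM_natl ler_expR; have := farP a fa; rewrite -/S; lra.
Qed.

Lemma isotropic_dot (x : 'cV[R]_m) : \sum_i p i * dot x (z i) ^+ 2 = dot x x.
Proof.
transitivity (\sum_k \sum_l x k 0 * x l 0 * \sum_i p i * (z i k 0 * z i l 0)).
  under [RHS]eq_bigr => k _ do under eq_bigr => l _ do rewrite mulr_sumr.
  under [RHS]eq_bigr => k _ do rewrite exchange_big/=.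
  rewrite exchange_big/=; apply: eq_bigr => i _.
  rewrite expr2 mulr_suml mulr_sumr; apply: eq_bigr => k _.
  by rewrite !mulr_sumr; apply: eq_bigr => l _; ring.
apply: eq_bigr => k _; rewrite (bigD1 k)//= isotropic eqxx mulr1 big1 ?addr0// => l.
by rewrite isotropic eq_sym => /negbTE ->; rewrite mulr0.
Qed.

Definition hits_nearby_targets (f : {ffun 'I_n -> I}) : bool :=
  `[< forall v : 'cV[int]_m,
        enorm (U *m (\sum_j w (f j) - v *+ 2)^R) <= Num.sqrt n%:R ->
        exists e, subset_sum (fun j => w (f j)) e = v >].

(** The failure probability is the sum of those of the covariance estimate, at
    most [4 L / sqrt n], and of Markov's inequality for the far points. The
    latter is at most [4 exp (2 m ln n + |ln |det U|| - q / 48)], which the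
    hypothesis on [q] turns into [4 exp (- q / 96) <= 384 / q]. *)
Theorem random_subset_sums :
  \sum_(f | ~~ hits_nearby_targets f) prod_weight p f <= 400 * (L / Num.sqrt n%:R).
Proof.
have n0R : 0 < n%:R :> R by rewrite ltr0n.
have sn0 : 0 < Num.sqrt n%:R :> R by rewrite sqrtr_gt0.
have snE : Num.sqrt n%:R ^+ 2 = n%:R :> R by rewrite sqr_sqrtr ?ler0n.
have q1 : 1 <= q by apply: le_trans q_big; rewrite exprn_ege1// ler1n.
have q0 : 0 < q by lra.
have s0 : 0 < s by rewrite sqrtr_gt0 invr_gt0.
have s2 : s ^+ 2 = q^-1 by rewrite sqr_sqrtr// invr_ge0 ltW.
have qE : q^-1 = L / Num.sqrt n%:R by rewrite invf_div.
have s_small : 96 * (96 * s) <= 1.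
  rewrite -(@ler_pXn2r _ 2)// ?nnegrE ?mulr_ge0 ?(ltW s0)// expr1n !exprMn s2 mulrA.
  by rewrite -exprD ler_pdivrMr// mul1r.
pose h : R := (8 * Num.sqrt n%:R)^-1.
have h0 : 0 < h by rewrite invr_gt0 mulr_gt0.
have uA : A \in unitmx by rewrite unitmx_tr unitmx_inv.
(* a dual vector that short has inner products of absolute value less than 1,
   hence zero, with the support, so it vanishes by isotropy *)
have sep (y : 'cV[int]_m) : enorm (A *m y^R) <= 2 * h -> y = 0.
  move=> Ay.
  have d0 i : p i * dot (A *m y^R) (z i) ^+ 2 = 0.
    have [->|pi0] := eqVneq (p i) 0; first by rewrite mul0r.
    suff -> : dot (A *m y^R) (z i) = 0 by rewrite expr0n mulr0.
    have [k kE] : exists k : int, dot (A *m y^R) (z i) = k%:~R.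
      exists (\sum_l y l 0 * w i l 0); rewrite -dot_dual// /dot rmorph_sum.
      by apply: eq_bigr => l _; rewrite !mxE rmorphM.
    have : `|dot (A *m y^R) (z i)| < 1.
      apply: le_lt_trans (ler_dot _ _) _.
      apply: (@le_lt_trans _ _ (2 * h * L)).
        by apply: ler_pM; rewrite ?enorm_ge0// z_bounded.
      have -> : 2 * h * L = q^-1 / 4 by rewrite qE /h; field; rewrite gt_eqF.
      by have : q^-1 <= 1 by [rewrite invf_le1]; lra.
    rewrite kE -intr_norm -[1]/(1%:~R) ltr_int => k1.
    by rewrite (int_norm_lt1 k1).
  have Ay0 : A *m y^R = 0.
    by apply: dot_eq0; rewrite -isotropic_dot big1.
  have : y^R = 0 by rewrite -(mulKmx uA y^R) Ay0 mulmx0.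
  move=> yR; apply/matrixP => i j; rewrite ord1 mxE; apply/eqP.
  by rewrite -(intr_eq0 R); have := congr1 (fun x : 'cV[R]_m => x i 0) yR; rewrite !mxE => ->.
have [CU CU0 CUP] := mulmx_bounded (invmx U).
have [K [tiny [KK tinyP tinyC]]] :=
  tiny_grid_points (CU * (Num.sqrt n%:R + n%:R * L)) m_gt0 uA h0 sep.
pose far := far_from_integers U (2 * s / L) : pred {ffun 'I_m -> 'I_K.+1}.
pose Y (f : {ffun 'I_n -> I}) := \sum_(a | far a)
  \prod_j expR (- (mod1 (dot (grid a) (w (f j))^R) ^+ 2 / 6)).
have Y0 f : 0 <= Y f.
  by apply: sumr_ge0 => a _; apply: prodr_ge0 => j _; rewrite expR_ge0.
have K0 : 0 < K.+1%:R :> R by [].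
have sm0 : 0 < Num.sqrt m%:R :> R by rewrite sqrtr_gt0 ltr0n.
have dA0 : 0 < `|\det A| by rewrite normr_gt0 -unitfE -unitmxE.
have tiny0 : 0 < #|tiny|%:R :> R.
  by rewrite -(pmulr_lgt0 _ dA0) (lt_le_trans _ tinyC)// exprn_gt0// divr_gt0// mulr_gt0.
have EY : \sum_f prod_weight p f * Y f <= K.+1%:R ^+ m * expR (- (q / 48)).
  apply: far_expectation => a /asboolP fa; exact: spread.
have bad1 := cov_error_tail p_ge0 p_sum1 isotropic z_bounded n_gt0.
have t4 : 0 < #|tiny|%:R / 4 :> R by rewrite divr_gt0.
have bad2 := markov_sum p_ge0 t4 Y0.
have dimL := dim_le_sqr_radius p_ge0 p_sum1 isotropic z_bounded.
have L1 : 1 <= L.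
  rewrite -(@ler_pXn2r _ 2)// ?nnegrE ?(ltW L_gt0)// expr1n (le_trans _ dimL)//.
  by rewrite ler1n.
have split_bad : \sum_(f | ~~ hits_nearby_targets f) prod_weight p f <=
  \sum_(f | n%:R ^+ 2 / 4 < \sum_k \sum_l cov_error (n := n) z f k l ^+ 2) prod_weight p f +
  \sum_(f | #|tiny|%:R / 4 < Y f) prod_weight p f.
  rewrite (big_mkcond (fun f => ~~ _)) (big_mkcond (fun f => _ ^+ 2 / 4 < _)).
  rewrite (big_mkcond (fun f => _ < Y f)) -big_split/=; apply: ler_sum => f _.
  have wt0 := prod_weight_ge0 p_ge0 f.
  have [wt|wt] := eqVneq (prod_weight p f) 0; first by rewrite wt !if_same addr0.
  case: ifP => [nh|_]; last by apply: addr_ge0; case: ifP.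
  case: ltP => [_|cov]; first by rewrite lerDl; case: ifP.
  case: ltP => [_|far_le]; first by rewrite add0r.
  exfalso; move/negP: nh; apply; apply/asboolP => v vn.
  have zL j : enorm (z (f j)) <= L.
    apply: z_bounded; move: wt; rewrite /prod_weight prodf_seq_neq0 => /allP h1.
    by apply: (h1 j); rewrite mem_index_enum.
  apply: (@subset_sum_of_near R m n U L s K.+1 (fun j => w (f j)) v uU L_gt0 n_gt0
    s0 s_small _ zL (sample_covariance cov) vn tiny _ tinyP).
  - by rewrite s2 qE.
  - move=> x xU; rewrite -(mulKmx uU x); apply: le_lt_trans (CUP _) _.
    by apply: le_lt_trans KK; rewrite ler_pM2l.
  - by apply: le_lt_trans far_le _; rewrite ltr_pM2l// ltf_pV2 ?posrE// ltr_nat.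
apply: le_trans split_bad _.
have e1 : 4 * m%:R * L ^+ 2 / n%:R <= 4 * (L / Num.sqrt n%:R).
  have -> : 4 * m%:R * L ^+ 2 / n%:R = 4 * (m%:R / q) * (L / Num.sqrt n%:R).
    rewrite /q; set rn := Num.sqrt _ in sn0 snE *; rewrite -snE.
    by field; rewrite !gt_eqF.
  apply: ler_wpM2r; first by rewrite divr_ge0// ltW.
  by rewrite ler_piMr// ler_pdivrMr// mul1r.
have rnE : Num.sqrt n%:R = q * L :> R by rewrite divfK// gt_eqF.
have rnq : q <= Num.sqrt n%:R by rewrite rnE ler_peMr// ltW.
have rn1 : 1 <= Num.sqrt n%:R :> R by exact: le_trans q1 rnq.
have rnn : Num.sqrt n%:R <= n%:R :> R.
  by rewrite -[leRHS]snE expr2; apply: ler_peMr; first exact: ltW.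
have n8 : 8 <= n%:R :> R.
  by apply: le_trans (le_trans rnq rnn); apply: le_trans q_big; rewrite -natrX ler_nat.
have smrn : Num.sqrt m%:R <= Num.sqrt n%:R :> R.
  by rewrite ler_wsqrtr// (le_trans q_dim)// (le_trans rnq).
have g1 : (Num.sqrt m%:R / h) ^+ m <= expR (2 * m%:R * ln n%:R).
  have -> : expR (2 * m%:R * ln n%:R) = (n%:R ^+ 2) ^+ m :> R.
    by rewrite -[in RHS](lnK (_ : n%:R \is Num.pos)) ?posrE// -!expRM_natl; congr expR; ring.
  apply: lerXn2r; rewrite ?nnegrE ?divr_ge0 ?sqr_ge0 ?(ltW h0)//.
  rewrite /h invrK; apply: (@le_trans _ _ (n%:R * (8 : R))).
    have -> : Num.sqrt m%:R * (8 * Num.sqrt n%:R) = Num.sqrt m%:R * Num.sqrt n%:R * 8 :> R by ring.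
    by rewrite ler_pM2r// -[leRHS]snE expr2 ler_pM2r.
  by rewrite expr2 ler_pM2l.
have g2 : `|\det A| <= expR `|ln `|\det U| |.
  have dU0 : 0 < `|\det U| by rewrite normr_gt0 -unitfE -unitmxE.
  rewrite det_tr det_inv normfV -{1}(lnK (_ : `|\det U| \is Num.pos)) ?posrE//.
  by rewrite -expRN ler_expR (le_trans (ler_norm _))// normrN.
have kt : K.+1%:R ^+ m / #|tiny|%:R <= `|\det A| * (Num.sqrt m%:R / h) ^+ m.
  rewrite ler_pdivrMr//.
  have -> : K.+1%:R ^+ m = (K.+1%:R * h / Num.sqrt m%:R) ^+ m * (Num.sqrt m%:R / h) ^+ m :> R.
    by rewrite -exprMn; congr (_ ^+ m); field; rewrite !gt_eqF.
  rewrite [leRHS]mulrAC; apply: ler_wpM2r; last by rewrite [leRHS]mulrC.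
  by rewrite exprn_ge0// divr_ge0// ltW.
have e2 : \sum_(f | #|tiny|%:R / 4 < Y f) prod_weight p f <= 4 * 96 * (L / Num.sqrt n%:R).
  apply: le_trans bad2 _.
  apply: (@le_trans _ _ (K.+1%:R ^+ m * expR (- (q / 48)) / (#|tiny|%:R / 4))).
    by rewrite ler_wpM2r// invr_ge0 ltW.
  have -> : K.+1%:R ^+ m * expR (- (q / 48)) / (#|tiny|%:R / 4) =
      4 * (K.+1%:R ^+ m / #|tiny|%:R * expR (- (q / 48))) :> R.
    by field; rewrite gt_eqF.
  rewrite -[leRHS]mulrA ler_pM2l//.
  apply: (@le_trans _ _ (expR `|ln `|\det U| | * expR (2 * m%:R * ln n%:R) * expR (- (q / 48)))).
    rewrite ler_wpM2r ?expR_ge0//; apply: le_trans kt _.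
    by apply: ler_pM => //; rewrite exprn_ge0 ?divr_ge0 ?(ltW h0) ?(ltW sm0).
  rewrite -!expRD -qE.
  apply: (@le_trans _ _ (expR (- (q / 96)))).
    rewrite ler_expR; have := q_ln; move: (`|ln _|) (2 * _ * _) (q) => a b q'; lra.
  rewrite expRN -[leRHS]invrK lef_pV2 ?posrE ?expR_gt0//; last first.
    by rewrite invr_gt0 divr_gt0// invr_gt0.
  have -> : (96 / q)^-1 = q / 96 by rewrite invf_div.
  by apply: le_trans (expR_ge1Dx _); lra.
apply: le_trans (lerD (le_trans bad1 e1) e2) _.
have : 0 <= L / Num.sqrt n%:R by rewrite divr_ge0// ltW.
lra.
Qed.

End RandomSubsetSums.

(** * Least eigenvalues, norms and covering radii *)

Section LeastEigenvalue.
Context {R : realType} {m : nat}.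

(** Apply the Cauchy-Schwarz inequality of the form [A] to [x] and [A^-1 x]. *)
Lemma psd_unitmx_coercive (A : 'M[R]_m) : psd A -> A \in unitmx ->
  exists2 d : R, 0 < d & forall x, d * dot x x <= dot x (A *m x).
Proof.
move=> psdA uA; have [C C0 CP] := mulmx_bounded (invmx A).
exists C^-1; first by rewrite invr_gt0.
move=> x; rewrite ler_pdivrMl//.
have [->|x0] := eqVneq x 0; first by rewrite !(mulmx0, dot0r, mulr0).
have xx := dot_gt0 x0; set y := invmx A *m x.
have Ay : A *m y = x by rewrite mulKVmx.
have := psd_cauchy_schwarz x y psdA; rewrite Ay => h.
have yx : dot y x <= C * dot x x.
  apply: le_trans (ler_norm _) _; apply: le_trans (ler_dot _ _) _.
  rewrite -(sqr_enorm x) expr2 mulrA; apply: ler_wpM2r; first exact: enorm_ge0.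
  exact: CP.
have q0 : 0 <= dot x (A *m x) by case: psdA => _; apply.
rewrite -(ler_pM2r xx) -expr2; apply: le_trans h _.
by rewrite -mulrA [leRHS]mulrCA; apply: ler_wpM2l.
Qed.

(** The minimum of the Rayleigh quotient is an eigenvalue: subtracting it leaves
    a positive semidefinite matrix that is not coercive, hence singular. *)
Lemma least_eigenvalue_rayleigh (A : 'M[R]_m) (a : R) : (0 < m)%N -> psd A ->
  is_least_eigenvalue A a -> forall x, a * dot x x <= dot x (A *m x).
Proof.
move=> m0 [AT A0] [_ amin].
pose S := [set mu : R | forall x, mu * dot x x <= dot x (A *m x)].
have S0 : S 0 by move=> x; rewrite mul0r.
pose e : 'cV[R]_m := delta_mx (Ordinal m0) 0.
have ee : dot e e = 1.
  rewrite /dot (bigD1 (Ordinal m0))//= !mxE !eqxx mulr1 big1 ?addr0// => i.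
  by rewrite !mxE => /negbTE ->; rewrite /= mul0r.
have ubS : has_ubound S.
  by exists (dot e (A *m e)) => mu /(_ e); rewrite ee mulr1.
set mu := sup S.
have Smu : S mu.
  move=> x; have [->|x0] := eqVneq x 0; first by rewrite mulmx0 dot0r mulr0.
  rewrite -ler_pdivlMr ?dot_gt0//; apply: ge_sup; first by exists 0.
  by move=> nu Snu; rewrite ler_pdivlMr ?dot_gt0.
pose A' := A - mu%:M.
have dotA' x : dot x (A' *m x) = dot x (A *m x) - mu * dot x x.
  by rewrite mulmxBl mul_scalar_mx dotBr dotZr.
have psdA' : psd A'.
  split; first by rewrite raddfB /= AT tr_scalar_mx.
  by move=> x; rewrite dotA' subr_ge0.
have nuA' : A' \notin unitmx.
  apply/negP => /(psd_unitmx_coercive psdA')[d d0 dP].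
  have : mu + d <= mu.
    apply: ub_le_sup => // x; rewrite mulrDl.
    by have := dP x; rewrite dotA'; lra.
  lra.
have amu : a <= mu.
  apply: amin; apply/eigenvalueP.
  move: nuA'; rewrite unitmxE unitfE negbK => /det0P[v v0 vA].
  exists v => //; apply/eqP; rewrite -subr_eq0.
  by rewrite -mul_mx_scalar -mulmxBr vA.
by move=> x; apply: le_trans (Smu x); rewrite ler_wpM2r ?dot_ge0.
Qed.

End LeastEigenvalue.

Section Norms.
Context {R : realType} {m : nat} (nrm : 'cV[R]_m -> R).
Hypothesis nrmP : is_norm nrm.

Lemma ler_nrmD x y : nrm (x + y) <= nrm x + nrm y.
Proof. by case: nrmP. Qed.

Lemma nrmZ a x : nrm (a *: x) = `|a| * nrm x.
Proof. by case: nrmP. Qed.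

Lemma nrm0 : nrm 0 = 0.
Proof. by rewrite -(scale0r 0) nrmZ normr0 mul0r. Qed.

Lemma nrmN x : nrm (- x) = nrm x.
Proof. by rewrite -scaleN1r nrmZ normrN1 mul1r. Qed.

Lemma nrm_ge0 x : 0 <= nrm x.
Proof. by have := ler_nrmD x (- x); rewrite subrr nrm0 nrmN; lra. Qed.

Lemma ler_nrm_sum (I : Type) (r : seq I) (P : pred I) (F : I -> 'cV[R]_m) :
  nrm (\sum_(i <- r | P i) F i) <= \sum_(i <- r | P i) nrm (F i).
Proof.
elim/big_ind2 : _ => [|x a y b xa yb|//]; first by rewrite nrm0.
exact: le_trans (ler_nrmD _ _) (lerD _ _).
Qed.

Lemma nrm_bounded : exists2 C : R, 0 < C & forall x, nrm x <= C * enorm x.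
Proof.
exists (1 + \sum_i nrm (delta_mx i 0)) => [|x].
  by rewrite ltr_wpDr// sumr_ge0// => i _; exact: nrm_ge0.
rewrite [x in nrm x]matrix_sum_delta.
under eq_bigr do rewrite big_ord1.
apply: le_trans (ler_nrm_sum _ _ _) _.
rewrite mulrDl mul1r mulr_suml ler_wpDl ?enorm_ge0//.
apply: ler_sum => i _; rewrite nrmZ mulrC.
by rewrite ler_wpM2l ?nrm_ge0// ler_coord_enorm.
Qed.

Lemma nrm_lipschitz (C : R) : (forall x, nrm x <= C * enorm x) ->
  forall x y, `|nrm x - nrm y| <= C * enorm (x - y).
Proof.
move=> CP x y; have h1 := CP (x - y); have h2 := CP (y - x).
have := ler_nrmD (x - y) y; have := ler_nrmD (y - x) x.
rewrite !subrK => h3 h4; rewrite -opprB enormN opprB in h2.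
by rewrite ler_norml; apply/andP; split; lra.
Qed.

Lemma rV_lipschitz_continuous (f : 'rV[R]_m -> R) (C : R) : 0 < C ->
  (forall x y, `|f x - f y| <= C * enorm (x - y)^T) -> continuous f.
Proof.
move=> C0 fC x V /nbhs_ballP[e /= e0 eV].
apply/nbhs_ballP; exists (e / C / m.+1%:R); first by rewrite /= !divr_gt0.
move=> y [_ xy]; apply: eV; rewrite /ball /=; apply: le_lt_trans (fC _ _) _.
rewrite -ltr_pdivlMl// mulrC; apply: le_lt_trans (ler_enorm_coord _) _.
apply: (@le_lt_trans _ _ (\sum_(i < m) e / C / m.+1%:R)).
  by apply: ler_sum => i _; have := xy 0 i; rewrite /ball /= !mxE => /ltW.
rewrite sumr_const card_ord -[_ *+ m]mulr_natr -mulrA gtr_pMr ?divr_gt0// mulrC.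
by rewrite ltr_pdivrMr// mul1r ltr_nat.
Qed.

(** Equivalence of norms, by compactness of the Euclidean unit sphere. *)
Lemma nrm_coercive : (0 < m)%N ->
  exists2 c : R, 0 < c & forall x, c * enorm x <= nrm x.
Proof.
move=> m0; have [C C0 CP] := nrm_bounded.
pose A := [set v : 'rV[R]_m | enorm v^T = 1].
have cE : continuous (fun v : 'rV[R]_m => enorm v^T).
  apply: (@rV_lipschitz_continuous _ 1) => // x y; rewrite mul1r.
  have := ler_enormD (x - y)^T y^T; have := ler_enormD (y - x)^T x^T.
  rewrite -!raddfD /= !subrK -(opprB x y) raddfN /= enormN => h1 h2.
  by rewrite ler_norml; apply/andP; split; lra.
have cN : continuous (fun v : 'rV[R]_m => nrm v^T).
  apply: (@rV_lipschitz_continuous _ C) => // x y.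
  by rewrite raddfB; exact: nrm_lipschitz.
have A0 : A !=set0.
  exists (delta_mx 0 (Ordinal m0)); rewrite /A /= /enorm /dot.
  rewrite (bigD1 (Ordinal m0))//= !mxE !eqxx mulr1 big1 ?addr0 ?sqrtr1// => i.
  by rewrite !mxE => /negbTE ->; rewrite /= mul0r.
have clA : closed A.
  by apply: (@preimage_closed _ _ (fun v : 'rV[R]_m => enorm v^T) [set x | x = 1]);
    [move=> x _; exact: cE | exact: closed_eq].
have bA : bounded_set A.
  exists 1; split => // M M1 v vA; apply: le_trans (ltW M1).
  rewrite [leLHS]/Num.Def.normr /= mx_normrE; apply: bigmax_le => // -[i j] _ /=.
  have := ler_coord_enorm v^T j; rewrite mxE ord1.
  by rewrite (_ : enorm v^T = 1).
have := EVT_min_rV A0 (bounded_closed_compact bA clA) (continuous_subspaceT cN).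
move=> [v /set_mem vA vmin].
have v0 : 0 < nrm v^T.
  rewrite lt_def nrm_ge0 andbT; apply/eqP => v0.
  have [_ _ /(_ _ v0) vT0] := nrmP.
  by move: vA; rewrite /A /= vT0 enorm0 => /eqP; rewrite eq_sym oner_eq0.
exists (nrm v^T) => // x; have [->|x0] := eqVneq x 0.
  by rewrite enorm0 mulr0 nrm_ge0.
have ex : 0 < enorm x.
  by rewrite lt_def enorm_ge0 andbT; apply: contra x0 => /eqP/enorm_eq0 ->.
have := vmin ((enorm x)^-1 *: x)^T; rewrite trmxK nrmZ gtr0_norm ?invr_gt0//.
rewrite ler_pdivlMl// (mulrC (enorm x)); apply.
by apply/mem_set; rewrite /A /= trmxK enormZ gtr0_norm ?invr_gt0// mulVf// gt_eqF.
Qed.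

Lemma ler_enorm_distortion : (0 < m)%N ->
  forall x, enorm x <= distortion nrm * nrm x.
Proof.
move=> m0 x; have [c c0 cP] := nrm_coercive m0.
have [->|x0] := eqVneq x 0; first by rewrite enorm0 nrm0 mulr0.
have nx : 0 < nrm x.
  rewrite lt_def nrm_ge0 andbT; apply: contra x0 => /eqP nx0.
  by have [_ _ /(_ _ nx0) ->] := nrmP.
rewrite -ler_pdivrMr//; apply: ub_le_sup.
  exists c^-1 => _ [y y1 <-]; rewrite -[c^-1]mulr1 ler_pdivlMl//.
  by apply: le_trans (cP y) _; rewrite y1.
exists ((nrm x)^-1 *: x); last by rewrite enormZ gtr0_norm ?invr_gt0// mulrC.
by rewrite /= nrmZ gtr0_norm ?invr_gt0// mulVf// gt_eqF.
Qed.

Lemma distortion_ge0 : (0 < m)%N -> 0 <= distortion nrm.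
Proof.
move=> m0; have := ler_enorm_distortion m0 (delta_mx (Ordinal m0) 0).
move=> h; rewrite leNgt; apply/negP => d0.
have : distortion nrm * nrm (delta_mx (Ordinal m0) 0) <= 0.
  by rewrite mulr_le0_ge0 ?nrm_ge0// ltW.
move=> /(le_trans h) h2.
have /enorm_eq0/matrixP/(_ (Ordinal m0) 0) : enorm (delta_mx (Ordinal m0) 0 : 'cV[R]_m) = 0.
  by apply/eqP; rewrite eq_le h2 enorm_ge0.
by rewrite !mxE !eqxx => /eqP; rewrite oner_eq0.
Qed.

Lemma dist_le S x y : S y -> dist nrm x S <= nrm (x - y).
Proof.
move=> Sy; apply: ge_inf; last by exists y.
by exists 0 => _ [z _ <-]; exact: nrm_ge0.
Qed.

Lemma dist_ge0 S x : S !=set0 -> 0 <= dist nrm x S.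
Proof.
move=> [y Sy]; apply: lb_le_inf; first by exists (nrm (x - y)), y.
by move=> _ [z _ <-]; exact: nrm_ge0.
Qed.

Lemma dist_adherent S x (e : R) : S !=set0 -> 0 < e ->
  exists2 y, S y & nrm (x - y) < dist nrm x S + e.
Proof.
move=> [y Sy] e0.
have [] := @inf_adherent R [set nrm (x - y) | y in S] e e0.
  by split; [exists (nrm (x - y)), y|exists 0 => _ [z _ <-]; exact: nrm_ge0].
by move=> _ [z Sz <-] h; exists z.
Qed.

Section CoveringRadius.
Variables (Lat : set 'cV[R]_m) (B : 'M[R]_m).
Hypotheses (basisB : is_lattice_basis Lat B) (spanL : spanR Lat = setT).

Lemma basis_lattice0 : Lat 0.
Proof.
have [_ ->] := basisB; exists 0.
by rewrite map_mx0 mulmx0.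
Qed.

(** The supremum defining the covering radius is finite, because every vector can
    be reduced to bounded coordinates with respect to the basis. *)
Lemma dist_le_covering_radius x : dist nrm x Lat <= covering_radius nrm Lat.
Proof.
have [uB LE] := basisB.
apply: ub_le_sup; last by exists x => //; rewrite spanL.
exists (\sum_j nrm (col j B)) => _ [y _ <-].
pose z : 'cV[int]_m := map_mx Num.floor (invmx B *m y).
apply: (@le_trans _ _ (nrm (y - B *m map_mx intr z))).
  by apply: dist_le; rewrite LE; exists z.
rewrite -{1}(mulKVmx uB y) -mulmxBr mulmx_sum_col.
apply: le_trans (ler_nrm_sum _ _ _) _; apply: ler_sum => j _.
rewrite nrmZ ler_piMl ?nrm_ge0//.
have -> : (invmx B *m y - map_mx intr z) j 0 =
    (invmx B *m y) j 0 - (Num.floor ((invmx B *m y) j 0))%:~R.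
  by rewrite /z mxE; congr (_ + _); rewrite !mxE.
have /andP[] := floor_itv ((invmx B *m y) j 0).
by move: (_ j 0) => t; rewrite intrD => h1 h2; rewrite ler_norml; apply/andP; split; lra.
Qed.

Lemma covering_radius_ge0 : 0 <= covering_radius nrm Lat.
Proof.
apply: le_trans (dist_le_covering_radius 0); apply: dist_ge0.
by exists 0; exact: basis_lattice0.
Qed.

Lemma dist_double_le x :
  dist nrm x [set 2 *: y | y in Lat] <= 2 * covering_radius nrm Lat.
Proof.
apply/ler_addgt0Pr => e e0; have e2 : 0 < e / 2 by rewrite divr_gt0.
have L0 : Lat !=set0 by exists 0; exact: basis_lattice0.
have [y Ly yE] := dist_adherent (2^-1 *: x) L0 e2.
apply: (@le_trans _ _ (nrm (x - 2 *: y))); first by apply: dist_le; exists y.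
have -> : x - 2 *: y = 2 *: (2^-1 *: x - y).
  by rewrite scalerBr scalerA mulfV// scale1r.
rewrite nrmZ ger0_norm//; have := dist_le_covering_radius (2^-1 *: x).
lra.
Qed.

End CoveringRadius.

End Norms.

(** * Measurability of norms, distances and discrepancies *)

Section MeasurableNorm.
Context {R : realType} {d : measure_display} {T : measurableType d}.

Lemma measurable_fun_lt_real (f : T -> R) :
  (forall a, measurable [set x | f x < a]) -> measurable_fun setT f.
Proof.
move=> mf; apply: (measurability _ (measurable_realfun.RGenInftyO.measurableE R)).
move=> _ [_ [a ->] <-]; rewrite setTI.
by rewrite (_ : _ @^-1` _ = [set x | f x < a])//; apply/seteqP; split => x;
  rewrite /= in_itv.
Qed.

Lemma measurable_setlt (f : T -> R) a : measurable_fun setT f ->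
  measurable [set x | f x < a].
Proof.
move=> mf; have := mf measurableT `]-oo, a[%classic (measurable_itv _).
by rewrite setTI; congr measurable; apply/seteqP; split => x; rewrite /= in_itv.
Qed.

(** A norm is Lipschitz, so that its sublevel sets are countable unions of
    boxes with rational centres. *)
Lemma measurable_nrm {m : nat} (nrm : 'cV[R]_m -> R) (V : T -> 'cV[R]_m) :
  is_norm nrm -> (forall i, measurable_fun setT (fun w => V w i 0)) ->
  measurable_fun setT (fun w => nrm (V w)).
Proof.
move=> nP mV; have [C C0 CP] := nrm_bounded nP.
have lip := nrm_lipschitz nP CP.
apply: measurable_fun_lt_real => a.
pose h (q : 'cV[rat]_m) w :=
  nrm (map_mx ratr q) + C * \sum_i `|V w i 0 - ratr (q i 0)|.
have mh q : measurable_fun setT (h q).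
  apply: measurable_funD => //; apply: measurable_funM => //.
  apply: measurable_sum => i; apply: measurableT_comp => //.
  exact: measurable_funB.
have -> : [set w | nrm (V w) < a] = \bigcup_(q : 'cV[rat]_m) [set w | h q w < a].
  apply/seteqP; split => w /=; last first.
    move=> [q _ /=]; apply: le_lt_trans; rewrite /h -lerBlDl.
    apply: le_trans (ler_norm _) _; apply: le_trans (lip _ _) _.
    rewrite ler_pM2l//; apply: le_trans (ler_enorm_coord _) _.
    by apply: ler_sum => i _; rewrite !mxE.
  move=> wa; pose e := (a - nrm (V w)) / (2 * C * m.+1%:R).
  have e0 : 0 < e by rewrite divr_gt0 ?subr_gt0// !mulr_gt0.
  have /choice[q qP] : forall i, exists r : rat, `|V w i 0 - ratr r| < e.
    move=> i; have [|r] := @rat_in_itvoo R (V w i 0 - e) (V w i 0 + e).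
      lra.
    rewrite in_itv /= => /andP[r1 r2]; exists r.
    by rewrite ltr_norml; apply/andP; split; lra.
  exists (\col_i q i) => //=; rewrite /h.
  set D := \sum_i _.
  have DS : 2 * C * D < a - nrm (V w).
    apply: (@le_lt_trans _ _ (2 * C * \sum_(i < m) e)).
      rewrite ler_pM2l ?mulr_gt0//; apply: ler_sum => i _; rewrite mxE ltW//.
    rewrite sumr_const card_ord -[_ *+ m]mulr_natr /e.
    have -> : 2 * C * ((a - nrm (V w)) / (2 * C * m.+1%:R) * m%:R) =
        (a - nrm (V w)) * (m%:R / m.+1%:R).
      have : m.+1%:R != 0 :> R by rewrite pnatr_eq0.
      by move: (m.+1%:R) (m%:R) => k k' k0; field; rewrite k0 gt_eqF.
    by rewrite gtr_pMr ?subr_gt0// ltr_pdivrMr// mul1r ltr_nat.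
  have : nrm (map_mx ratr (\col_i q i)) - nrm (V w) <= C * D.
    apply: le_trans (ler_norm _) _; rewrite distrC; apply: le_trans (lip _ _) _.
    rewrite ler_pM2l//; apply: le_trans (ler_enorm_coord _) _.
    by apply: ler_sum => i _; rewrite !mxE.
  lra.
apply: countable_bigcupT_measurable => // q; exact: measurable_setlt.
Qed.

(** The infimum is over a countable set. *)
Lemma measurable_dist {m : nat} (nrm : 'cV[R]_m -> R) (V : T -> 'cV[R]_m)
    (K : countType) (S : K -> 'cV[R]_m) : is_norm nrm -> K ->
  (forall i, measurable_fun setT (fun w => V w i 0)) ->
  measurable_fun setT (fun w => dist nrm (V w) (range S)).
Proof.
move=> nP k0 mV; apply: measurable_fun_lt_real => a.
have S0 : range S !=set0 by exists (S k0), k0.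
have -> : [set w | dist nrm (V w) (range S) < a] =
    \bigcup_k [set w | nrm (V w - S k) < a].
  apply/seteqP; split => w /=.
    move=> wa; have [|_ [k _ <-] yE] :=
        @dist_adherent _ _ nrm nP _ (V w) (a - dist nrm (V w) (range S)) S0.
      by rewrite subr_gt0.
    by exists k => //=; apply: lt_le_trans yE _; rewrite [leLHS]addrC subrK.
  by move=> [k _]; apply: le_lt_trans; apply: dist_le => //; exists k.
apply: countable_bigcupT_measurable => // k; apply: measurable_setlt.
apply: measurable_nrm => // i; under eq_fun do rewrite mxE.
exact: measurable_funD.
Qed.

Lemma measurable_disc {m n : nat} (nrm : 'cV[R]_m -> R) (M : T -> 'M[R]_(m, n)) :
  is_norm nrm -> (forall i j, measurable_fun setT (fun w => M w i j)) ->
  measurable_fun setT (fun w => disc nrm (M w)).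
Proof.
move=> nP mM.
have mV (y : 'cV[R]_n) : measurable_fun setT (fun w => nrm (M w *m y)).
  apply: measurable_nrm => // i; under eq_fun do rewrite mxE.
  apply: measurable_sum => j; exact: measurable_funM.
rewrite /disc; elim: (index_enum _) => [|e r IH].
  by under eq_fun do rewrite big_nil; exact: mV.
by under eq_fun do rewrite big_cons; apply: measurable_minr.
Qed.

Lemma measurable_coord {m : nat} (Y : T -> 'cV[R]_m) i : random_vector Y ->
  measurable_fun setT (fun w => Y w i 0).
Proof.
move=> rY; apply: measurable_fun_lt_real => a.
apply: (rY [set x | x i 0 < a]); apply: sub_sigma_algebra => /=.
rewrite openE => x /= xa; rewrite /interior.
have e0 : 0 < a - x i 0 by rewrite subr_gt0.
apply: filterS (enorm_nbhs x e0) => y /= xy.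
have := ler_coord_enorm (x - y) i; rewrite !mxE ler_norml => /andP[]; lra.
Qed.

End MeasurableNorm.

(** * Lattice valued random vectors *)

Section LatticeValued.
Context {R : realType} {m : nat} {d : measure_display} {T : measurableType d}.
Variables (P : probability T R) (X : T -> 'cV[R]_m).
Variables (Lat : set 'cV[R]_m) (B : 'M[R]_m).
Hypotheses (rX : random_vector X) (basisB : is_lattice_basis Lat B)
  (LX : forall w, Lat (X w)).
Local Notation pt z := (B *m map_mx intr (z : 'cV[int]_m)).

Lemma borel1 (x : 'cV[R]_m) : borel [set x].
Proof.
rewrite -[ [set x] ]setCK; apply: sigma_algebraC; apply: sub_sigma_algebra => /=.
apply: closed_openC; apply: accessible_closed_set1.
exact/hausdorff_accessible/norm_hausdorff.
Qed.

Lemma measurable_preimage1 x : measurable (X @^-1` [set x]).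
Proof. by apply: rX; exact: borel1. Qed.

(** A lattice is countable, so every set is measurable for a lattice valued
    random vector. *)
Lemma preimage_lattice (D : set 'cV[R]_m) : X @^-1` D =
  \bigcup_(z : 'cV[int]_m) (if `[< D (pt z) >] then X @^-1` [set pt z] else set0).
Proof.
have [_ LE] := basisB; apply/seteqP; split => w /=.
  move=> DX; have := LX w; rewrite LE => -[z Xz]; exists z => //.
  by case: asboolP => //; rewrite -Xz.
by move=> [z _]; case: asboolP => // Dz /= ->.
Qed.

Lemma measurable_preimage (D : set 'cV[R]_m) : measurable (X @^-1` D).
Proof.
rewrite preimage_lattice; apply: countable_bigcupT_measurable => // z.
by case: ifP => // _; exact: measurable_preimage1.
Qed.

Lemma measurable_fun_lattice (g : 'cV[R]_m -> R) :
  measurable_fun setT (fun w => g (X w)).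
Proof.
by apply: measurable_fun_lt_real => a; exact: (measurable_preimage [set x | g x < a]).
Qed.

Lemma supp_of_gt0 x : (0 < P (X @^-1` [set x]))%E -> supp P X x.
Proof.
move=> Px U oU Ux; apply: lt_le_trans Px _; apply: le_measure; rewrite ?inE.
- exact: measurable_preimage1.
- exact: measurable_preimage.
- by move=> w /= ->.
Qed.

(** The lattice is countable, and each of its points outside the support is a null
    set. *)
Lemma preimage_not_supp : P (X @^-1` (~` supp P X)) = 0%E.
Proof.
apply/negligibleP; first exact: measurable_preimage.
pose F (k : nat) := if unpickle k is Some z then
  (if `[< (~` supp P X) (pt z) >] then X @^-1` [set pt z] else set0) else set0.
apply: (@negligibleS _ _ _ _ (\bigcup_k F k)).
  rewrite preimage_lattice => w [z _ wz].
  by exists (pickle z) => //; rewrite /F pickleK.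
apply: negligible_bigcup => k; rewrite /F; case: unpickle => [z|]; last exact: negligible_set0.
case: asboolP => [nz|_]; last exact: negligible_set0.
apply/negligibleP; first exact: measurable_preimage1.
apply/eqP; rewrite eq_le measure_ge0 andbT leNgt; apply/negP => /supp_of_gt0.
exact: nz.
Qed.

Context {I : finType} (x : I -> 'cV[R]_m).
Hypotheses (x_inj : injective x) (x_supp : forall y, supp P X y -> exists i, y = x i).

Definition point_mass (i : I) : R := fine (P (X @^-1` [set x i])).

Lemma point_massE i : P (X @^-1` [set x i]) = (point_mass i)%:E.
Proof. by rewrite fineK// fin_num_measure//; exact: measurable_preimage1. Qed.

Lemma point_mass_ge0 i : 0 <= point_mass i.
Proof. by rewrite -lee_fin -point_massE. Qed.

Lemma point_mass_supp i : point_mass i != 0 -> supp P X (x i).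
Proof.
move=> pi0; apply: supp_of_gt0.
by rewrite point_massE lte_fin lt_def pi0 point_mass_ge0.
Qed.

(** Up to a null set, [g \o X] is a finite linear combination of the indicators of
    the events [X = x i]. *)
Lemma expectation_lattice (g : 'cV[R]_m -> R) :
  'E_P[fun w => g (X w)]%E = (\sum_i point_mass i * g (x i))%:E.
Proof.
rewrite unlock.
pose h i w : \bar R := ((g (x i))%:E * (\1_(X @^-1` [set x i]) w)%:E)%E.
have hint i : P.-integrable setT (h i).
  by apply: integrableZl => //; apply: integrable_indic; exact: measurable_preimage1.
transitivity (\int[P]_w (\sum_i h i w))%E.
  apply: ae_eq_integral => //.
  - by apply/measurable_EFinP; exact: measurable_fun_lattice.
  - by apply: emeasurable_sum => i; exact: (measurable_int P).
  apply: (@negligibleS _ _ _ _ (X @^-1` (~` supp P X))).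
    move=> w /= nw sw; apply: nw => _; have [i Xi] := x_supp sw.
    rewrite (bigD1 i)//= big1 ?adde0.
      by rewrite /h indicE mem_set// mule1 Xi.
    move=> j ji; rewrite /h indicE memNset ?mule0// => /= Xj.
    by move/eqP: ji; apply; apply: x_inj; rewrite -Xi -Xj.
  by apply/negligibleP; [exact: measurable_preimage | exact: preimage_not_supp].
rewrite integral_sum//= -sumEFin; apply: eq_bigr => i _.
rewrite /h integralZl//; last by apply: integrable_indic; exact: measurable_preimage1.
rewrite integral_indic//; last exact: measurable_preimage1.
rewrite setIT; transitivity ((g (x i))%:E * P (X @^-1` [set x i]))%E => //.
by rewrite point_massE -EFinM mulrC.
Qed.

Lemma point_mass_sum1 : \sum_i point_mass i = 1.
Proof.
have := expectation_lattice (fun=> 1); rewrite (expectation_cst P 1) => -[h].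
by rewrite [RHS]h; apply: eq_bigr => i _; rewrite mulr1.
Qed.

End LatticeValued.

Section IndependentCopies.
Context {R : realType} {m n : nat} {d d' : measure_display}.
Context {T : measurableType d} {T' : measurableType d'}.
Variables (P : probability T R) (X : T -> 'cV[R]_m) (P' : probability T' R).
Variables (Y : 'I_n -> T' -> 'cV[R]_m).
Hypotheses (rX : random_vector X) (copies : independent_copies P X P' Y).
Context {I : finType} (x : I -> 'cV[R]_m).
Hypothesis x_inj : injective x.
Hypothesis mass1 : \sum_i point_mass P X x i = 1.

(** The copies may take any value on a null set, where [S] need not hold. The events
    that the copies take prescribed values among the [x i] are disjoint, and
    independence gives their probabilities. *)
Lemma probability_ge_weight (S : set T') (good : pred {ffun 'I_n -> I}) :
  measurable S ->
  (forall (f : {ffun 'I_n -> I}) w, good f -> (forall j, Y j w = x (f j)) -> S w) ->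
  ((1 - \sum_(f | ~~ good f) prod_weight (point_mass P X x) f)%:E <= P' S)%E.
Proof.
move=> mS goodS; have [rY lawY indY] := copies.
pose E (f : {ffun 'I_n -> I}) := \bigcap_(j in [set: 'I_n]) (Y j @^-1` [set x (f j)]).
have mE f : measurable (E f).
  by apply: fin_bigcap_measurable => // j _; apply: rY; exact: borel1.
have PE f : P' (E f) = (prod_weight (point_mass P X x) f)%:E.
  rewrite /E (indY (fun j => [set x (f j)])); last by move=> j; exact: borel1.
  rewrite /prod_weight -prodEFin; apply: eq_bigr => j _.
  by rewrite lawY; [exact: point_massE | exact: borel1].
have tE : trivIset setT E.
  move=> f f' _ _ [w [Ef Ef']]; apply/ffunP => j; apply: x_inj.
  by rewrite -(Ef j Logic.I) -(Ef' j Logic.I).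
have -> : 1 - \sum_(f | ~~ good f) prod_weight (point_mass P X x) f =
    \sum_(f | good f) prod_weight (point_mass P X x) f.
  have := prod_weight_sum1 n mass1; rewrite (bigID good)/=; lra.
rewrite -sumEFin (eq_bigr (fun f => P' (E f))); last by move=> f _; rewrite PE.
rewrite bigfs ?index_enum_uniq//; last by move=> f _; rewrite mem_index_enum.
rewrite -measure_fin_bigcup//.
- apply: le_measure; rewrite ?inE//; first exact: fin_bigcup_measurable.
  by move=> w [f gf Ef]; apply: (goodS f w gf) => j; exact: Ef.
- exact: sub_trivIset tE.
Qed.

End IndependentCopies.

(** * Quantitative consequences of the lower bound on n *)

Section LowerBoundOnN.
Context {R : realType}.

Lemma ln2_ge : 1 / 2 <= ln 2 :> R.
Proof.
have : ln (1 + - (1 / 2)) <= - (1 / 2) :> R by apply: le_ln1Dx; lra.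
have -> : 1 + - (1 / 2) = 2^-1 :> R by field.
by rewrite lnV ?posrE//; lra.
Qed.

Lemma ln_le_sqrt (u : R) : 0 < u -> ln u <= 2 * Num.sqrt u.
Proof.
move=> u0; have s0 : 0 < Num.sqrt u by rewrite sqrtr_gt0.
rewrite -{1}(sqr_sqrtr (ltW u0)) lnXn// mulr2n.
by have := ln_sublinear s0; lra.
Qed.

(** The elementary inequalities behind the choice of the constant [c]. When
    [m = 1] and [L] is close to [1], both logarithmic terms may be small, but
    then the first term of the maximum is bounded below. *)
Lemma parameter_bounds (E : R) (m n : nat) (L l : R) : 96 * 16 <= E ->
  (0 < m)%N -> (0 < n)%N -> 1 <= L ->
  (8 * E ^+ 2) ^+ 2 * (m%:R ^+ 2 * L ^+ 2 * (ln m%:R + ln L) ^+ 2) <= n%:R ->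
  (8 * E ^+ 2) ^+ 2 * (L ^+ 2 * l ^+ 2) <= n%:R ->
  (m = 1%N -> (8 * E ^+ 2) ^+ 2 * (expR l / 2) ^+ 2 <= n%:R) ->
  E ^+ 2 * m%:R <= Num.sqrt n%:R / L /\
  96 * (2 * m%:R * ln n%:R + `|l|) <= Num.sqrt n%:R / L.
Proof.
move=> E96 m0 n0 L1; set D := 8 * E ^+ 2 => H2 H4 H1.
have E0 : 0 < E by lra.
have E1 : 1 <= E by lra.
have E20 : 0 < E ^+ 2 by rewrite exprn_gt0.
have D0 : 0 < D by rewrite mulr_gt0.
have L0 : 0 < L by lra.
have n0R : 0 < n%:R :> R by rewrite ltr0n.
have m0R : 0 < m%:R :> R by rewrite ltr0n.
set rn := Num.sqrt n%:R; set q := rn / L.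
have rn0 : 0 < rn by rewrite sqrtr_gt0.
have q0 : 0 < q by rewrite divr_gt0.
have rnE : rn = q * L by rewrite divfK// gt_eqF.
have lnm0 : 0 <= ln m%:R :> R by rewrite ln_ge0// ler1n.
have lnL0 : 0 <= ln L by rewrite ln_ge0.
have root (a : R) : 0 <= a -> a ^+ 2 <= n%:R -> a <= rn.
  by move=> a0 an; rewrite -(ler_pXn2r (n := 2))// ?nnegrE// ?(ltW rn0)// sqr_sqrtr// ltW.
have h2 : D * (m%:R * (ln m%:R + ln L)) <= q.
  rewrite ler_pdivlMr//; apply: root.
    by rewrite !mulr_ge0// ?addr_ge0// ltW.
  apply: le_trans H2; rewrite le_eqVlt; apply/orP; left; apply/eqP.
  move: (ln m%:R + ln L) (m%:R : R) (D) => a b k; ring.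
have h4 : D * `|l| <= q.
  rewrite ler_pdivlMr//; apply: root; first by rewrite !mulr_ge0// ltW.
  apply: le_trans H4; rewrite le_eqVlt; apply/orP; left; apply/eqP.
  by rewrite -[l ^+ 2]real_normK ?num_real//; move: (D) => k; ring.
have h1 : m = 1%N -> D * (expR l / 2) <= rn.
  move=> /H1 h; apply: root; first by rewrite mulr_ge0 ?divr_ge0 ?expR_ge0// ltW.
  by rewrite exprMn.
have ln2 := ln2_ge.
have qm : E ^+ 2 * m%:R <= q.
  have DE : E ^+ 2 = D / 8 by rewrite /D; field.
  have [m2|m1] := leqP 2 m.
    have : 1 / 2 <= ln m%:R :> R by rewrite (le_trans ln2)// ler_ln ?posrE// ler_nat.
    move=> lm; apply: le_trans h2; rewrite DE.
    have : D * (m%:R * (1 / 2)) <= D * (m%:R * (ln m%:R + ln L)).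
      by rewrite !ler_pM2l//; lra.
    have : 0 <= D * m%:R by rewrite mulr_ge0 ?ltW.
    lra.
  have mE : m = 1%N by apply/eqP; rewrite eqn_leq m0 andbT -ltnS.
  rewrite DE mE mulr1; move: h2; rewrite mE ln1 add0r mul1r => h2.
  have [L2|L2] := leP 2 L.
    have : 1 / 2 <= ln L by rewrite (le_trans ln2)// ler_ln ?posrE.
    move=> lL; apply: le_trans h2.
    have : D * (1 / 2) <= D * ln L by rewrite ler_pM2l.
    lra.
  have [l2|l2] := leP (- (1 / 2)) l; last first.
    have : 1 / 2 <= `|l| by rewrite ler_normr; apply/orP; right; lra.
    move=> lL; apply: le_trans h4.
    have : D * (1 / 2) <= D * `|l| by rewrite ler_pM2l.
    lra.
  have el : 1 / 2 <= expR l by apply: le_trans (expR_ge1Dx l); lra.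
  have h3 : D * (expR l / 2) <= q * 2.
    by apply: le_trans (h1 mE) _; rewrite rnE ler_pM2l// ltW.
  have : D * (1 / 2 / 2) <= D * (expR l / 2) by rewrite ler_pM2l//; lra.
  lra.
split => //.
pose u := q / m%:R.
have uE2 : E ^+ 2 <= u by rewrite ler_pdivlMr.
have u0 : 0 < u by apply: lt_le_trans uE2.
have su : E <= Num.sqrt u.
  by rewrite -(ler_pXn2r (n := 2))// ?nnegrE ?sqrtr_ge0 ?(ltW E0)// sqr_sqrtr// ltW.
have qE : q = m%:R * u by rewrite /u mulrC divfK// gt_eqF.
have lnq : m%:R * ln q <= m%:R * ln m%:R + 2 * q / E.
  rewrite qE lnM ?posrE// mulrDr lerD2l.
  have -> : 2 * (m%:R * u) / E = m%:R * (2 * u / E) by ring.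
  rewrite ler_pM2l//; apply: le_trans (ln_le_sqrt u0) _.
  rewrite -mulrA ler_pM2l// ler_pdivlMr//.
  rewrite -[leRHS](sqr_sqrtr (ltW u0)) expr2 ler_wpM2l ?sqrtr_ge0//.
have lnn : ln n%:R = 2 * (ln q + ln L) :> R.
  by rewrite -lnM ?posrE// -rnE mulr_natl -lnXn// sqr_sqrtr// ltW.
have h2' : m%:R * ln m%:R + m%:R * ln L <= q / D.
  by rewrite -mulrDr ler_pdivlMr// mulrC.
have h4' : `|l| <= q / D by rewrite ler_pdivlMr// mulrC.
have mL0 : 0 <= m%:R * ln L by rewrite mulr_ge0// ltW.
have mm0 : 0 <= m%:R * ln m%:R :> R by rewrite mulr_ge0// ltW.
have b1 : 96 * 16 * (q / E) <= q.
  by rewrite mulrA ler_pdivrMr// mulrC ler_pM2l.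
have b2 : 96 * 16 * (q / D) <= q.
  rewrite mulrA ler_pdivrMr// mulrC ler_pM2l//; apply: le_trans E96 _.
  have : 1 * E <= E * E by rewrite ler_pM2r.
  by rewrite /D expr2; lra.
have -> : 2 * m%:R * ln n%:R = 4 * (m%:R * ln q) + 4 * (m%:R * ln L) :> R.
  by rewrite lnn; ring.
have : 0 <= q / D by rewrite divr_ge0 ?ltW.
have : 2 * q / E = 2 * (q / E) by rewrite mulrA.
move: lnq h2' h4' mL0 mm0 b1 b2 (q0).
move: (m%:R * ln q) (m%:R * ln m%:R) (m%:R * ln L) `|l| (q / D) (q / E) (2 * q / E) (q).
clear; move=> a b c d e f g q; lra.
Qed.

End LowerBoundOnN.

(** * The square root of the second moment matrix *)

Section SquareRoot.
Context {R : realType} {m : nat} {d : measure_display} {T : measurableType d}.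
Variables (P : probability T R) (X : T -> 'cV[R]_m) (Lat : set 'cV[R]_m) (L : R).
Hypotheses (m_gt0 : (0 < m)%N) (ndL : nondegenerate_lattice Lat)
  (LE : Lat = spanZ (supp P X)).
Let Sigma := second_moment P X.
Let S := sqrt_mx Sigma.
Hypothesis supp_ball : supp P X `<=` [set S *m x | x in eball L].

(** The support generates the lattice, which spans the space. *)
Lemma supp_separates (v : 'rV[R]_m) :
  (forall x, supp P X x -> v *m x = 0) -> v = 0.
Proof.
move=> vs; have vL x : Lat x -> v *m x = 0.
  rewrite LE => -[k [a [u [su ->]]]]; rewrite mulmx_sumr big1// => i _.
  by rewrite raddfMz /= vs// mul0rz.
have vT (x : 'cV[R]_m) : v *m x = 0.
  have : (setT : set 'cV[R]_m) x by []; rewrite -ndL => -[k [a [u [Lu ->]]]].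
  by rewrite mulmx_sumr big1// => i _; rewrite -scalemxAr vL// scaler0.
apply/matrixP => i j; rewrite ord1 mxE.
by have /matrixP/(_ 0 0) := vT (delta_mx j 0); rewrite -colE !mxE.
Qed.

(** The square root is a genuine one: otherwise it would denote zero by default,
    and the support condition would force [X = 0]. *)
Lemma sqrt_mxP : psd S /\ S *m S = Sigma.
Proof.
pose Q := [set A : 'M[R]_m | psd A /\ A *m A = Sigma].
suff : Q S by [].
apply: xgetPex; apply: contrapT => /forallNP noS.
have S0 : S = 0 by apply: xgetPN.
have := @supp_separates (delta_mx 0 (Ordinal m_gt0)).
have H x : supp P X x -> delta_mx 0 (Ordinal m_gt0) *m x = 0 :> 'M[R]_1.
  by move=> /supp_ball[y _ <-]; rewrite S0 mul0mx mulmx0.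
move=> /(_ H)/matrixP/(_ 0 (Ordinal m_gt0)); rewrite !mxE !eqxx.
by move=> /eqP; rewrite oner_eq0.
Qed.

Lemma sqrt_mx_unit : S \in unitmx.
Proof.
rewrite unitmxE unitfE; apply/negP => /det0P[v v0 vS].
move/eqP: v0; apply; apply: supp_separates => x /supp_ball[y _ <-].
by rewrite mulmxA vS mul0mx.
Qed.

Lemma supp_enorm x : supp P X x -> enorm (invmx S *m x) <= L.
Proof. by move=> /supp_ball[y yL <-]; rewrite mulKmx// sqrt_mx_unit. Qed.

Lemma sqr_det_sqrt_mx : Num.sqrt (\det Sigma) = `|\det S|.
Proof. by have [_ <-] := sqrt_mxP; rewrite det_mulmx -expr2 sqrtr_sqr. Qed.

Lemma enorm_sqrt_mx x : enorm (S *m x) ^+ 2 = dot x (Sigma *m x).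
Proof.
have [[ST _] <-] := sqrt_mxP.
by rewrite sqr_enorm -mulmxA [RHS]dot_mulmx ST.
Qed.

Lemma psd_sigma : psd Sigma.
Proof.
split=> [|x]; last by rewrite -enorm_sqrt_mx sqr_ge0.
by have [[ST _] <-] := sqrt_mxP; rewrite trmx_mul ST.
Qed.

Variable sigma : R.
Hypothesis sigmaP : is_least_eigenvalue Sigma sigma.

Lemma least_eigenvalue_gt0 : 0 < sigma.
Proof.
have [/eigenvalueP[v vS v0] _] := sigmaP.
have vv : 0 < dot v^T v^T by rewrite dot_gt0// trmx_eq0.
have e : dot v^T (Sigma *m v^T) = sigma * dot v^T v^T.
  have [ST _] := psd_sigma.
  by rewrite -{1}ST -trmx_mul vS linearZ dotZr.
have Sv : 0 < enorm (S *m v^T) ^+ 2.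
  rewrite sqr_enorm dot_gt0//; apply/eqP => Sv0; move/eqP: v0; apply.
  have : v^T = 0 by rewrite -(mulKmx sqrt_mx_unit v^T) Sv0 mulmx0.
  by move=> /(congr1 trmx); rewrite trmxK trmx0.
by move: Sv; rewrite enorm_sqrt_mx e pmulr_lgt0.
Qed.

(** Writing [x = S y], the right hand side is the quadratic form of [Sigma] at
    [y]. *)
Lemma enorm_whitened_le x : sigma * enorm (invmx S *m x) ^+ 2 <= enorm x ^+ 2.
Proof.
rewrite -{2}(mulKVmx sqrt_mx_unit x) enorm_sqrt_mx sqr_enorm.
exact: least_eigenvalue_rayleigh m_gt0 psd_sigma sigmaP _.
Qed.

Let Z := fun w => invmx S *m X w.

Lemma supp_whitened x : supp P X x -> supp P Z (invmx S *m x).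
Proof.
move=> sx U oU Ux; apply: (sx [set y | U (invmx S *m y)]) => //.
have [C C0 CP] := mulmx_bounded (invmx S).
move: oU; rewrite !openE => oU y /= Uy; rewrite /interior.
have /nbhs_enorm[e e0 eU] := oU _ Uy.
have eC : 0 < e / C by rewrite divr_gt0.
apply: filterS (enorm_nbhs y eC) => y' /= yy'; apply: eU.
rewrite -mulmxBr; apply: le_lt_trans (CP _) _.
by rewrite mulrC -ltr_pdivlMr.
Qed.

(** The whitened support lies in the support of the whitened vector, so a dual
    vector has integral inner products with the whitened basis vectors. *)
Lemma dual_whitened (B : 'M[R]_m) y : is_lattice_basis Lat B ->
  dual_lattice (spanZ (supp P Z)) y ->
  exists zeta : 'cV[int]_m,
    y = (invmx (invmx S *m B))^T *m map_mx intr zeta.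
Proof.
move=> [uB LB] dy; set U := invmx S *m B.
have uU : U \in unitmx by rewrite unitmx_mul unitmx_inv sqrt_mx_unit.
have int_k k : exists a : int, (U^T *m y) k 0 = a%:~R.
  have : dot y (invmx S *m col k B) \is a Num.int.
    apply: dy; have : Lat (col k B).
      rewrite LB; exists (delta_mx k 0).
      by rewrite map_delta_mx -colE.
    rewrite LE => -[j [a [u [su ->]]]].
    exists j, a, (fun i => invmx S *m u i); split=> [i|]; first exact: supp_whitened.
    by rewrite mulmx_sumr; apply: eq_bigr => i _; rewrite raddfMz.
  move=> /intrP[a aE]; exists a; rewrite -aE.
  have -> : invmx S *m col k B = col k U by rewrite !colE mulmxA.
  by rewrite mxE; apply: eq_bigr => i _; rewrite !mxE mulrC.
have [a aP] := choice int_k; exists (\col_k a k).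
have -> : map_mx intr (\col_k a k) = U^T *m y.
  by apply/matrixP => i j; rewrite ord1 [RHS]aP !mxE.
by rewrite mulmxA -trmx_mul mulmxV// trmx1 mul1mx.
Qed.

End SquareRoot.

(** * From subset sums to discrepancy *)

Section BoxPoints.
Context {R : realType} {m : nat}.

Definition box_point (N : nat) (i : {ffun 'I_m -> 'I_(N.*2.+1)}) : 'cV[int]_m :=
  \col_k ((i k : nat)%:Z - N%:Z).

Lemma box_point_inj N : injective (@box_point N).
Proof.
move=> i j /matrixP ij; apply/ffunP => k; apply: val_inj => /=.
by have := ij k 0; rewrite !mxE => /addIr [].
Qed.

Lemma box_point_surj N (z : 'cV[int]_m) : (forall k, `|z k 0| <= N%:Z) ->
  exists i, z = box_point (N := N) i.
Proof.
move=> zN; exists [ffun k => inord (absz (z k 0 + N%:Z))].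
apply/matrixP => k j; rewrite ord1 !mxE ffunE.
have := zN k; rewrite ler_norml => /andP[h1 h2].
have z0 : 0 <= z k 0 + N%:Z by rewrite -lerBlDr sub0r.
rewrite inordK ?gez0_abs ?addrK//.
by rewrite -ltz_nat gez0_abs//; move: (z k 0) h2; clear => t h; lia.
Qed.

Lemma bounded_box (C : R) (B : 'M[R]_m) : exists N : nat, forall z : 'cV[int]_m,
  enorm (map_mx intr z : 'cV[R]_m) <= C -> exists i, z = box_point (N := N) i.
Proof.
exists (Num.truncn C).+1 => z zC; apply: box_point_surj => k.
rewrite -(ler_int R) intr_norm -pmulrn.
have := ler_coord_enorm (map_mx intr z : 'cV[R]_m) k; rewrite mxE => h.
by apply: le_trans h _; apply: le_trans zC _; rewrite ltW// truncnS_gt.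
Qed.

End BoxPoints.

Section HitsSuffice.
Context {R : realType} {m n : nat} (nrm : 'cV[R]_m -> R).
Variables (Lat : set 'cV[R]_m) (B : 'M[R]_m) (W : 'I_n -> 'cV[int]_m)
  (M : 'M[R]_(m, n)).
Hypotheses (nP : is_norm nrm) (basisB : is_lattice_basis Lat B)
  (spanL : spanR Lat = setT) (m_gt0 : (0 < m)%N).
Hypothesis colM : forall j, col j M = B *m map_mx intr (W j).
Variable r : R.
Hypothesis r_large : distortion nrm * (2 * covering_radius nrm Lat) < r.
Hypothesis hits : forall v : 'cV[int]_m,
  enorm (B *m map_mx intr (\sum_j W j - v *+ 2)) <= r ->
  exists e, subset_sum W e = v.

Lemma signed_sum (e : {ffun 'I_n -> bool}) :
  M *m (\col_j (-1) ^+ e j) = B *m map_mx intr (\sum_j W j - (subset_sum W e) *+ 2).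
Proof.
rewrite mulmx_sum_col.
have -> : \sum_j W j - (subset_sum W e) *+ 2 = \sum_j W j *~ ((-1) ^+ e j).
  rewrite /subset_sum -sumrMnl -sumrB; apply: eq_bigr => j _.
  case: (e j).
    by rewrite expr1 mulrNz mulr1z mulr1n mulr2n opprD addrA subrr sub0r.
  by rewrite expr0 mulr1z mulr0n mul0rn subr0.
rewrite map_intr_sum mulmx_sumr; apply: eq_bigr => j _.
rewrite colM mxE; case: (e j).
  by rewrite !expr1 scaleN1r mulrNz mulr1z map_mxN mulmxN.
by rewrite !expr0 scale1r mulr1z.
Qed.

(** Every point of the coset [M 1 + 2 Lat] whose norm is close to the minimum is
    a signed sum of the columns. *)
Lemma disc_le_dist :
  disc nrm M <= dist nrm (M *m const_mx 1) [set 2 *: y | y in Lat] <=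
    2 * covering_radius nrm Lat.
Proof.
rewrite (dist_double_le nP basisB spanL) andbT.
set D := dist _ _ _.
have Dr : D <= 2 * covering_radius nrm Lat by exact: (dist_double_le nP basisB spanL).
have dis0 := distortion_ge0 nP m_gt0.
have [uB LB] := basisB.
apply/ler_addgt0Pr => e e0.
pose gap := r - distortion nrm * (2 * covering_radius nrm Lat).
have gap0 : 0 < gap by rewrite subr_gt0.
pose eta := Num.min e (gap / (distortion nrm + 1)).
have eta0 : 0 < eta by rewrite lt_min e0 divr_gt0// ltr_wpDl.
have S0 : [set 2 *: y | y in Lat] !=set0.
  by exists (2 *: 0), 0 => //; exact: basis_lattice0 basisB.
have [_ [y Ly <-] yE] := dist_adherent nP (M *m const_mx 1) S0 eta0.
have [v vE] : exists v : 'cV[int]_m, y = B *m map_mx intr v by move: Ly; rewrite LB.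
have M1 : M *m const_mx 1 - 2 *: y = B *m map_mx intr (\sum_j W j - v *+ 2).
  have -> : M *m const_mx 1 = B *m map_mx intr (\sum_j W j).
    rewrite mulmx_sum_col map_intr_sum mulmx_sumr; apply: eq_bigr => j _.
    by rewrite mxE scale1r colM.
  have -> : map_mx intr (\sum_j W j - v *+ 2) =
      map_mx intr (\sum_j W j) - 2 *: (map_mx intr v : 'cV[R]_m).
    by rewrite map_mxB scaler_nat raddfMn.
  by rewrite mulmxBr -scalemxAr vE.
have [e' e'E] : exists e', subset_sum W e' = v.
  apply: hits; rewrite -M1; apply: le_trans (ler_enorm_distortion nP m_gt0 _) _.
  apply: (@le_trans _ _ (distortion nrm * (2 * covering_radius nrm Lat + eta))).
    by rewrite ler_wpM2l// (le_trans (ltW yE))// lerD2r.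
  have : distortion nrm * eta <= gap.
    apply: (@le_trans _ _ (distortion nrm * (gap / (distortion nrm + 1)))).
      by rewrite ler_wpM2l// ge_min lexx orbT.
    rewrite mulrCA ler_piMr ?(ltW gap0)// ler_pdivrMr ?ltr_wpDl// mul1r.
    by rewrite lerDl.
  by rewrite mulrDr /gap; lra.
apply: (@le_trans _ _ (nrm (M *m \col_j (-1) ^+ e' j))).
  rewrite /disc (bigD1 e')/= ?ge_min ?lexx//.
rewrite signed_sum e'E -M1; apply: le_trans (ltW yE) _.
by rewrite lerD2l ge_min lexx.
Qed.

End HitsSuffice.

(** * Spanningness of the whitened vector *)

Section WhitenedSupport.
Context {R : realType} {m : nat} {d : measure_display} {T : measurableType d}.
Variables (P : probability T R) (X : T -> 'cV[R]_m) (Lat : set 'cV[R]_m) (L : R)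
  (B : 'M[R]_m).
Hypotheses (m_gt0 : (0 < m)%N) (ndL : nondegenerate_lattice Lat)
  (LE : Lat = spanZ (supp P X)) (rX : random_vector X) (LX : forall w, Lat (X w))
  (basisB : is_lattice_basis Lat B).
Let Sigma := second_moment P X.
Let S := sqrt_mx Sigma.
Hypothesis supp_ball : supp P X `<=` [set S *m x | x in eball L].
Context {I : finType} (w : I -> 'cV[int]_m).
Local Notation "x ^R" := (map_mx intr x : 'cV[R]_m) (at level 2).
Let pt i := B *m (w i)^R.
Hypotheses (pt_inj : injective pt) (pt_supp : forall y, supp P X y -> exists i, y = pt i).
Let p := point_mass P X pt.
Let U := invmx S *m B.

Lemma whitened_unitmx : U \in unitmx.
Proof.
have [uB _] := basisB; rewrite unitmx_mul unitmx_inv uB andbT.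
exact: (sqrt_mx_unit ndL LE supp_ball).
Qed.

Lemma mul_col_rowE (u : 'cV[R]_m) k l : (u *m u^T) k l = u k 0 * u l 0.
Proof. by rewrite mxE big_ord1 mxE. Qed.

Lemma whitened_isotropic k l :
  \sum_i p i * ((U *m (w i)^R) k 0 * (U *m (w i)^R) l 0) = (k == l)%:R.
Proof.
have [[ST _] SS] := sqrt_mxP m_gt0 ndL LE supp_ball.
have uS : S \in unitmx := sqrt_mx_unit ndL LE supp_ball.
rewrite -/Sigma -/S in ST SS.
have SigmaE : Sigma = \sum_i p i *: (pt i *m (pt i)^T).
  apply/matrixP => a b; rewrite mxE summxE.
  rewrite (expectation_lattice rX basisB LX pt_inj pt_supp (fun x => x a 0 * x b 0)).
  by apply: eq_bigr => i _; rewrite [RHS]mxE mul_col_rowE.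
have : invmx S *m Sigma *m (invmx S)^T = 1%:M.
  by rewrite -SS mulmxA mulVmx// mul1mx trmx_inv ST mulmxV.
move=> /matrixP/(_ k l); rewrite [RHS]mxE => <-.
rewrite SigmaE mulmx_sumr mulmx_suml summxE; apply: eq_bigr => i _.
rewrite -scalemxAr -scalemxAl [RHS]mxE; congr (_ * _).
have -> : invmx S *m (pt i *m (pt i)^T) *m (invmx S)^T =
    (U *m (w i)^R) *m (U *m (w i)^R)^T.
  have -> : U *m (w i)^R = invmx S *m pt i by rewrite mulmxA.
  by move: (pt i) => u; rewrite trmx_mul !mulmxA.
by rewrite mul_col_rowE.
Qed.

Lemma whitened_bounded i : p i != 0 -> enorm (U *m (w i)^R) <= L.
Proof.
move=> /(point_mass_supp rX basisB LX) si; rewrite /U -mulmxA.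
exact: (supp_enorm ndL LE supp_ball).
Qed.

Let Z := fun t => invmx S *m X t.

Lemma sqr_Ztilde theta :
  Ztilde P Z theta ^+ 2 = \sum_i p i * mod1 (dot theta (U *m (w i)^R)) ^+ 2.
Proof.
rewrite /Ztilde (expectation_lattice rX basisB LX pt_inj pt_supp
  (fun x => `|mod1 (dot theta (invmx S *m x))| ^+ 2)).
have -> : \sum_i p i * mod1 (dot theta (U *m (w i)^R)) ^+ 2 =
    \sum_i point_mass P X pt i * `|mod1 (dot theta (invmx S *m pt i))| ^+ 2.
  by apply: eq_bigr => i _; rewrite real_normK ?num_real// /U -mulmxA.
rewrite sqr_sqrtr//; apply: sumr_ge0 => i _.
by rewrite mulr_ge0 ?sqr_ge0//; exact: point_mass_ge0.
Qed.

(** Away from the dual lattice, either [theta] is not pseudodual, and then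
    [Ztilde theta] is comparable to the distance to the dual lattice, or it is
    pseudodual, and then [Ztilde theta] is at least the spanningness. *)
Lemma spread_of_spanningness (K q s : R) (n : nat) :
  0 < K -> 0 < L -> 0 < q -> 0 <= s -> s ^+ 2 = q^-1 -> q = Num.sqrt n%:R / L -> (0 < n)%N ->
  ((K ^+ 2)%:E * ((spanningness P Z)^-1 ^+ 4 * (L ^- 2)%:E) <= n%:R%:E)%E ->
  1 / 4 <= K ->
  forall phi : 'cV[R]_m,
  (forall zeta : 'cV[int]_m, 2 * s / L < enorm ((invmx U)^T *m (phi - zeta^R))) ->
  q / 4 <= n%:R * \sum_i p i * mod1 (dot phi (w i)^R) ^+ 2.
Proof.
move=> K0 L0 q0 s0 s2 qE n0 sp K4 phi far.
have n0R : 0 < n%:R :> R by rewrite ltr0n.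
have nE : n%:R = q ^+ 2 * L ^+ 2 :> R.
  by rewrite qE expr_div_n divfK ?expf_neq0 ?gt_eqF// sqr_sqrtr// ltW.
pose theta := (invmx U)^T *m phi.
set Lam := dual_lattice (spanZ (supp P Z)).
have Lam0 : Lam 0 by move=> x _; rewrite dot0l.
have distE : 2 * s / L <= dist enorm theta Lam.
  apply: lb_le_inf; first by exists (enorm (theta - 0)), 0.
  move=> _ [y Ly <-].
  have [zeta ->] := dual_whitened ndL LE supp_ball basisB Ly.
  by rewrite /theta -mulmxBr ltW.
have -> : \sum_i p i * mod1 (dot phi (w i)^R) ^+ 2 = Ztilde P Z theta ^+ 2.
  by rewrite sqr_Ztilde; apply: eq_bigr => i _; rewrite (dot_dual whitened_unitmx).
set t := Ztilde P Z theta.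
have t0 : 0 <= t by exact: sqrtr_ge0.
have [pd|npd] := leP t (dist enorm theta Lam / 2); last first.
  have : s / L <= t by apply: le_trans (ltW npd); rewrite ler_pdivlMr// mulrC mulrA.
  rewrite -(@ler_pXn2r _ 2)// ?nnegrE ?divr_ge0 ?(ltW L0)// expr_div_n s2 => h.
  have : q ^+ 2 * L ^+ 2 * (q^-1 / L ^+ 2) <= n%:R * t ^+ 2 by rewrite -nE ler_wpM2l// ltW.
  have -> : q ^+ 2 * L ^+ 2 * (q^-1 / L ^+ 2) = q by field; rewrite !gt_eqF.
  lra.
have s_gt0 : 0 < s.
  by rewrite lt_def s0 andbT; apply/eqP => s00; move: s2; rewrite s00 expr0n /= => /esym/eqP;
    rewrite invr_eq0 gt_eqF.
have nLam : ~ Lam theta.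
  move=> Lt; have : dist enorm theta Lam <= 0.
    by rewrite -(@enorm0 R m) -(subrr theta); apply: ge_inf;
      [exists 0 => _ [y _ <-]; exact: enorm_ge0 | exists theta].
  have : 0 < 2 * s / L by rewrite divr_gt0// mulr_gt0.
  lra.
have spt : (spanningness P Z <= t%:E)%E by apply: ereal_inf_lbound; exists theta.
have sp0 : (0 <= spanningness P Z)%E.
  by apply: le_ereal_inf_tmp => _ [y _ <-]; rewrite lee_fin sqrtr_ge0.
move: sp spt sp0; case: (spanningness P Z) => [r| |]; last 2 first.
- by rewrite leye_eq.
- by rewrite leeNy_eq.
rewrite !lee_fin => + rt r0.
have [->|rn0] := eqVneq r 0.
  rewrite inve0.
  have -> : (+oo ^+ 4 = +oo :> \bar R)%E by rewrite !expeS expe0 mule1 !mulyy.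
  by rewrite mulyr gtr0_sg ?invr_gt0 ?exprn_gt0// mul1e mulry gtr0_sg ?exprn_gt0// mul1e leye_eq.
rewrite inver (negbTE rn0) -EFin_expe -!EFinM lee_fin => h.
have rp : 0 < r by rewrite lt_def rn0.
have tp : 0 < t by apply: lt_le_trans rt.
have h1 : K ^+ 2 <= (n%:R * t ^+ 2 / q) ^+ 2.
  have h2 : K ^+ 2 <= n%:R * (r ^+ 4 * L ^+ 2).
    move: h; rewrite mulrA ler_pdivrMr ?exprn_gt0// exprVn ler_pdivrMr ?exprn_gt0//.
    by rewrite -mulrA (mulrC (L ^+ 2)).
  apply: le_trans h2 _.
  have -> : (n%:R * t ^+ 2 / q) ^+ 2 = n%:R * (t ^+ 4 * L ^+ 2).
    by rewrite nE; field; rewrite gt_eqF.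
  by rewrite ler_pM2l// ler_pM2r ?exprn_gt0// ler_pXn2r ?nnegrE.
have : K <= n%:R * t ^+ 2 / q.
  by rewrite -(@ler_pXn2r _ 2)// ?nnegrE ?(ltW K0)// divr_ge0 ?mulr_ge0 ?sqr_ge0 ?(ltW q0) ?ler0n.
rewrite ler_pdivlMr// => h2; apply: le_trans h2.
by rewrite mulrC -(mul1r 4^-1) ler_wpM2r// ltW.
Qed.

End WhitenedSupport.

(** * Discrepancy of random lattice vectors *)

Section DimensionOne.
Context {R : realType} (nrm : 'cV[R]_1 -> R) (Lat : set 'cV[R]_1) (B : 'M[R]_1).
Hypotheses (nP : is_norm nrm) (basisB : is_lattice_basis Lat B)
  (spanL : spanR Lat = setT).

(** Half a generator of a one-dimensional lattice is a deep hole. *)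
Lemma half_generator_le :
  enorm (col 0 B) / 2 <= distortion nrm * covering_radius nrm Lat.
Proof.
set x := col 0 B.
have rho : nrm x / 2 <= covering_radius nrm Lat.
  apply: le_trans (dist_le_covering_radius nP basisB spanL (2^-1 *: x)).
  have [_ LB] := basisB.
  apply: lb_le_inf.
    by exists (nrm (2^-1 *: x - 0)), 0 => //; exact: basis_lattice0 basisB.
  move=> _ [y + <-]; rewrite LB => -[z ->].
  have -> : B *m map_mx intr z = (z 0 0)%:~R *: x.
    by rewrite mulmx_sum_col big_ord1 mxE.
  rewrite -scalerBl (nrmZ nP) mulrC ler_wpM2r ?(nrm_ge0 nP)//.
  have [zn|zp] := leP (z 0 0) 0.
    have : (z 0 0)%:~R <= 0 :> R by rewrite lerz0.
    by rewrite ler_normr => h; apply/orP; left; lra.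
  have : 1 <= (z 0 0)%:~R :> R by rewrite ler1z.
  by rewrite ler_normr => h; apply/orP; right; lra.
have h := ler_enorm_distortion nP (ltn0Sn 0) x.
have := ler_wpM2l (distortion_ge0 nP (ltn0Sn 0)) rho.
rewrite mulrA => h2; apply: le_trans h2.
by rewrite ler_wpM2r.
Qed.

End DimensionOne.

Lemma lee_mule_maxe (R : realType) (c r : R) (a b : \bar R) : 0 < c ->
  (c%:E * maxe a b <= r%:E)%E -> (c%:E * a <= r%:E)%E /\ (c%:E * b <= r%:E)%E.
Proof.
move=> c0 h; split; apply: le_trans h; apply: lee_wpmul2l; rewrite ?lee_fin ?(ltW c0)//.
  by rewrite le_max lexx.
by rewrite le_max lexx orbT.
Qed.

Theorem theorem1p6 (R : realType) :
  exists c C : R, 0 < c /\ 0 < C /\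
  forall (m : nat) (Lat : set 'cV[R]_m) (nrm : 'cV[R]_m -> R)
    (d : measure_display) (T : measurableType d) (P : probability T R)
    (X : T -> 'cV[R]_m) (sigma L : R),
  (1 <= m)%N ->
  is_lattice Lat -> nondegenerate_lattice Lat ->
  is_norm nrm ->
  random_vector X -> (forall w, Lat (X w)) -> Lat = spanZ (supp P X) ->
  let Sigma := second_moment P X in
  is_least_eigenvalue Sigma sigma ->
  0 < L ->
  supp P X `<=` [set sqrt_mx Sigma *m x | x in eball L] ->
  let Z := fun w => invmx (sqrt_mx Sigma) *m X w in
  let N : \bar R :=
    (c%:E *
     maxe (distortion nrm ^+ 2 * covering_radius nrm Lat ^+ 2 / sigma)%R%:E
    (maxe (m%:R ^+ 2 * L ^+ 2 * (ln m%:R + ln L) ^+ 2)%R%:E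
    (maxe ((spanningness P Z)^-1 ^+ 4 * (L ^- 2)%R%:E)
          (L ^+ 2 *
            ln (lattice_det Lat / Num.sqrt (\det Sigma)) ^+ 2)%R%:E)))%E in
  forall (n : nat) (d' : measure_display) (T' : measurableType d')
    (P' : probability T' R) (M : T' -> 'M[R]_(m, n)),
  (N <= (n%:R)%:E)%E ->
  independent_copies P X P' (fun j w => col j (M w)) ->
  ((1 - C * L * Num.sqrt (ln n%:R / n%:R))%:E <=
   P' [set w |
     disc nrm (M w) <=
       dist nrm (M w *m const_mx 1) [set 2 *: x | x in Lat] <=
       2 * covering_radius nrm Lat]%R)%E.
Proof.
(* [E^2] has to be at least [96^4] for the smallness of [s], and [E] at least
   [96 * 16] for the comparison with [m ln n] *)
pose E : R := 96 ^+ 2; pose D : R := 8 * E ^+ 2.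
have E96 : 96 * 16 <= E by rewrite /E expr2 ler_pM2l// ler_nat.
have E0 : 0 < E by apply: lt_le_trans E96; rewrite mulr_gt0.
have D0 : 0 < D by rewrite mulr_gt0// exprn_gt0.
have E2E : E ^+ 2 = 96 ^+ 4 by rewrite /E -exprM.
have E21 : 1 <= E ^+ 2 by rewrite E2E exprn_ege1// ler1n.
have D8 : 8 <= D by rewrite /D ler_peMr.
exists (D ^+ 2), 400; split; first by rewrite exprn_gt0.
split; first by [].
have DE : D = 8 * E ^+ 2 by [].
clearbody D E => m Lat nrm d T P X sigma L m_gt0 latL ndL nP rX LX LE Sigma sigmaP L_gt0 suppB Z N.
move=> n d' T' P' M + copies; rewrite /N => /(lee_mule_maxe (exprn_gt0 2 D0)).
move=> [H1 /(lee_mule_maxe (exprn_gt0 2 D0))].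
move=> [H2 /(lee_mule_maxe (exprn_gt0 2 D0)) [H3 H4]].
rewrite -EFinM lee_fin in H1; rewrite -EFinM lee_fin in H2; rewrite -EFinM lee_fin in H4.
have [B basisB detB] : exists2 B, is_lattice_basis Lat B & `|\det B| = lattice_det Lat.
  have [B0 B0P] := lattice_basis_exists latL ndL.
  have : [set `|\det A| | A in is_lattice_basis Lat] (lattice_det Lat).
    by apply: xgetPex; exists `|\det B0|, B0.
  by move=> [A AP AE]; exists A.
have [uB LB] := basisB.
pose S := sqrt_mx Sigma.
have uS : S \in unitmx := sqrt_mx_unit ndL LE suppB.
pose U := invmx S *m B.
have uU : U \in unitmx := whitened_unitmx ndL LE basisB suppB.
have sigma0 := least_eigenvalue_gt0 m_gt0 ndL LE suppB sigmaP.
have [CB CB0 CBP] := mulmx_bounded (invmx B *m S).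
have [Nb box] := @bounded_box R m (CB * L) B.
pose wt := @box_point m Nb.
pose pt i := B *m map_mx intr (wt i) : 'cV[R]_m.
have pt_inj : injective pt.
  move=> i j /(congr1 (mulmx (invmx B))); rewrite !mulKmx// => /matrixP h.
  apply: (@box_point_inj m Nb); apply/matrixP => k j'.
  by have := h k j'; rewrite [LHS]mxE [RHS]mxE => /intr_inj.
have pt_supp y : supp P X y -> exists i, y = pt i.
  move=> sy; have : Lat y.
    rewrite LE; exists 1%N, (fun=> 1), (fun=> y); split => //.
    by rewrite big_ord1 mulr1z.
  rewrite LB => -[z yz]; have [|i zi] := box z; last by exists i; rewrite yz zi.
  have -> : map_mx intr z = (invmx B *m S) *m (invmx S *m y).
    by rewrite mulmxA mulmxK// yz mulKmx.
  apply: le_trans (CBP _) _; rewrite ler_pM2l//.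
  exact: (supp_enorm ndL LE suppB).
have iso := whitened_isotropic m_gt0 ndL LE rX LX basisB suppB pt_inj pt_supp.
have bnd := whitened_bounded ndL LE rX LX basisB suppB (w := wt).
have p0 := point_mass_ge0 P rX pt.
have p1 := point_mass_sum1 rX basisB LX pt_inj pt_supp.
have L1 : 1 <= L.
  rewrite -(@ler_pXn2r _ 2)// ?nnegrE ?(ltW L_gt0)// expr1n.
  apply: le_trans (dim_le_sqr_radius p0 p1 iso bnd); by rewrite ler1n.
have dU0 : 0 < `|\det U| by rewrite normr_gt0 -unitfE -unitmxE.
have ratioE : lattice_det Lat / Num.sqrt (\det Sigma) = `|\det U|.
  rewrite -detB (sqr_det_sqrt_mx m_gt0 ndL LE suppB) -/S /U det_mulmx det_inv normrM normfV.
  by rewrite mulrC.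
rewrite ratioE in H4.
set l := ln `|\det U| in H4.
have H1' : m = 1%N -> D ^+ 2 * (expR l / 2) ^+ 2 <= n%:R.
  move=> mE; apply: le_trans H1; rewrite ler_pM2l ?exprn_gt0//.
  rewrite /l lnK ?posrE// ler_pdivlMr//.
  rewrite -exprMn.
  subst m.
  apply: (@le_trans _ _ ((enorm (col 0 B) / 2) ^+ 2)); last first.
    have half := half_generator_le nP basisB ndL.
    have half0 : 0 <= enorm (col 0 B) / 2 by rewrite divr_ge0 ?enorm_ge0.
    by rewrite ler_pXn2r// nnegrE (le_trans half0).
  have := enorm_whitened_le m_gt0 ndL LE suppB sigmaP (col 0 B).
  have -> : enorm (invmx (sqrt_mx (second_moment P X)) *m col 0 B) = `|\det U|.
    rewrite -sqrtr_sqr /enorm; congr (Num.sqrt _).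
    rewrite /dot big_ord1 -expr2 /U -/S; congr (_ ^+ 2).
    by rewrite det_mx11 !mxE; apply: eq_bigr => i _; rewrite !mxE.
  rewrite !expr_div_n => h; rewrite mulrAC ler_pM2r ?invr_gt0 ?exprn_gt0//.
  by rewrite mulrC.
have n_gt0 : (0 < n)%N.
  rewrite -(ltr0n R); have [m2|m1] := leqP 2 m.
    have lnm : 0 < ln m%:R + ln L by rewrite ltr_wpDr ?ln_ge0// ln_gt0// ltr1n.
    have m0 : 0 < m%:R :> R by rewrite ltr0n.
    have sq (a : R) (a0 : 0 < a) := exprn_gt0 2 a0.
    apply: lt_le_trans H2.
    exact: mulr_gt0 (sq _ D0) (mulr_gt0 (mulr_gt0 (sq _ m0) (sq _ L_gt0)) (sq _ lnm)).
  have mE : m = 1%N by apply/eqP; rewrite eqn_leq m_gt0 andbT -ltnS.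
  have el : 0 < expR l / 2 by rewrite divr_gt0 ?expR_gt0.
  apply: lt_le_trans (H1' mE).
  exact: mulr_gt0 (exprn_gt0 2 D0) (exprn_gt0 2 el).
have n0R : 0 < n%:R :> R by rewrite ltr0n.
have [qm q_ln] : E ^+ 2 * m%:R <= Num.sqrt n%:R / L /\
    96 * (2 * m%:R * ln n%:R + `|l|) <= Num.sqrt n%:R / L.
  by rewrite DE in H2 H4 H1'; exact: parameter_bounds.
have sn0 : 0 < Num.sqrt n%:R :> R by rewrite sqrtr_gt0.
set q := Num.sqrt n%:R / L in qm q_ln.
have m1R : 1 <= m%:R :> R by rewrite ler1n.
have q_big : 96 ^+ 4 <= q by rewrite -E2E; apply: le_trans qm; rewrite ler_peMr// ltW// exprn_gt0.
have q_dim : m%:R <= q by apply: le_trans qm; rewrite ler_peMl.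
have q0 : 0 < q by rewrite divr_gt0.
have spread := spread_of_spanningness ndL LE rX LX basisB suppB pt_inj pt_supp
  D0 L_gt0 q0 (sqrtr_ge0 q^-1) (sqr_sqrtr (ltW (etrans (invr_gt0 q) q0))) erefl n_gt0 H3.
have D4 : 1 / 4 <= D by move: D8; clear; lra.
have core := random_subset_sums p0 p1 iso bnd uU L_gt0 m_gt0 n_gt0 q_big q_dim q_ln
  (spread D4).
have [rY lawY indY] := copies.
have mM i j : measurable_fun setT (fun w => M w i j).
  have := measurable_coord i (rY j); congr measurable_fun.
  by apply/funext => w; rewrite mxE.
have mS : measurable [set w |
     disc nrm (M w) <=
       dist nrm (M w *m const_mx 1) [set 2 *: x | x in Lat] <=
       2 * covering_radius nrm Lat].
  have -> : [set w | disc nrm (M w) <=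
       dist nrm (M w *m const_mx 1) [set 2 *: x | x in Lat] <=
       2 * covering_radius nrm Lat] =
    (fun w => disc nrm (M w) <=
       dist nrm (M w *m const_mx 1) [set 2 *: x | x in Lat]) @^-1` [set true].
    apply/seteqP; split => w /=; first by move=> /andP[].
    by move=> ->; rewrite (dist_double_le nP basisB ndL).
  rewrite -[X in measurable X]setTI.
  apply: (measurable_fun_ler _ _ measurableT) => //.
    exact: measurable_disc.
  have -> : [set 2 *: x | x in Lat] =
      range (fun z : 'cV[int]_m => 2 *: (B *m map_mx intr z) : 'cV[R]_m).
    rewrite LB; apply/seteqP; split => [_ [_ [z ->] <-]|_ [z _ <-]]; first by exists z.
    by exists (B *m map_mx intr z) => //; exists z.
  apply: (@measurable_dist _ _ _ m nrm (fun w => M w *m const_mx 1) 'cV[int]_m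
    (fun z => 2 *: (B *m map_mx intr z)) nP 0) => i.
  under eq_fun do rewrite mxE.
  by apply: measurable_sum => j; apply: measurable_funM => //.
have prob := probability_ge_weight rX copies pt_inj p1 mS
  (good := fun f => hits_nearby_targets wt U f).
apply: le_trans (prob _); last first.
  move=> f w /asboolP hits colM.
  apply: (disc_le_dist nP basisB ndL m_gt0 colM (r := Num.sqrt (sigma * n%:R))).
    have h0 : 0 <= distortion nrm * covering_radius nrm Lat.
      by rewrite mulr_ge0 ?(distortion_ge0 nP)// (covering_radius_ge0 nP basisB ndL).
    have sn : 0 < sigma * n%:R by rewrite mulr_gt0.
    rewrite -(@ltr_pXn2r _ 2)// ?nnegrE ?sqrtr_ge0//; last by rewrite mulrCA mulr_ge0.
    rewrite sqr_sqrtr ?(ltW sn)// -ltr_pdivrMl//.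
    have : D ^+ 2 * ((distortion nrm * covering_radius nrm Lat) ^+ 2 / sigma) <= n%:R.
      by rewrite exprMn.
    have -> : sigma^-1 * (distortion nrm * (2 * covering_radius nrm Lat)) ^+ 2 =
        4 * ((distortion nrm * covering_radius nrm Lat) ^+ 2 / sigma) by ring.
    set a := _ / sigma => h.
    have a0 : 0 <= a by rewrite divr_ge0 ?sqr_ge0 ?(ltW sigma0).
    have D64 : 8 * 8 <= D ^+ 2 by rewrite expr2 ler_pM.
    have : 8 * 8 * a <= n%:R by move: h; apply: le_trans; rewrite ler_wpM2r.
    by move: a0 n0R; clear; lra.
  move=> v vn; apply: hits.
  have := enorm_whitened_le m_gt0 ndL LE suppB sigmaP
    (B *m map_mx intr (\sum_j wt (f j) - v *+ 2)).
  rewrite mulmxA -/S -/U; set x := enorm (U *m _) => h.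
  rewrite -(@ler_pXn2r _ 2)// ?nnegrE ?sqrtr_ge0 ?enorm_ge0// [leRHS]sqr_sqrtr ?ler0n//.
  rewrite -(ler_pM2l sigma0); apply: le_trans h _.
  rewrite -[leRHS]sqr_sqrtr; last by rewrite mulr_ge0 ?ltW.
  by rewrite ler_pXn2r// nnegrE ?sqrtr_ge0 ?enorm_ge0.
rewrite lee_fin lerD2l lerN2; apply: le_trans core _.
rewrite -mulrA ler_pM2l// ler_pM2l// sqrtrM; last by rewrite ln_ge0// ler1n.
rewrite sqrtrV ?ler0n// ler_peMl ?invr_ge0 ?sqrtr_ge0// -[leLHS]sqrtr1 ler_wsqrtr//.
have sn2 : 2 <= Num.sqrt n%:R :> R.
  apply: (@le_trans _ _ q); first by apply: le_trans q_big; rewrite -natrX ler_nat.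
  by rewrite ler_pdivrMr// ler_peMr// ltW.
have n4 : 2 * 2 <= n%:R :> R.
  by rewrite -[leRHS](sqr_sqrtr (ltW n0R)) expr2 ler_pM.
have ln4 : ln (2 * 2) <= ln n%:R :> R by rewrite ler_ln ?posrE// mulr_gt0.
apply: le_trans ln4; rewrite lnM ?posrE//; have := @ln2_ge R; clear; lra.
Qed.
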